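(* Let $g$ and $\bar g$ be geodesically equivalent pseudo-Riemannian metrics on a manifold $M$ of dimension $n$, let $L=L(g,\bar g)$ be the $(1,1)$-tensor associated with them, and let $\chi=\chi_1\cdot\chi_2$ be an admissible factorisation of the characteristic polynomial $\chi(t)=\det(t\cdot\mathrm{Id}-L)$. Then the distributions $D_1=\ker\chi_1(L)$ and $D_2=\ker\chi_2(L)$ on $M$ are integrable.
   Context: Two Riemannian or pseudo-Riemannian metrics $g,\bar g$ on the same manifold $M^n$ are geodesically equivalent if they have the same geodesics considered as unparametrized curves. The tensor $L=L(g,\bar g)$ is $$L^i_j=\left(\frac{\det \bar g}{\det g}\right)^{\frac1{n+1}}\bar g^{ik}g_{kj},$$ where, replacing $g$ by $-g$ if necessary, one assumes that this expression is well defined. The characteristic polynomial $\chi(t)=\det(t\cdot\mathrm{Id}-L)$ is a monic polynomial in $t$ of degree $n$ whose coefficients are smooth functions on $M$. A factorisation $\chi(t)=\chi_1(t)\chi_2(t)$ into two monic real polynomials of degree $\ge 1$ (with coefficients that are smooth functions on $M$) is admissible if $\chi_1$ and $\chi_2$ are coprime (have no common complex roots) at every point of $M$. For a polynomial $p(t)=\sum_k a_k t^k$ whose coefficients $a_k$ are functions on $M$, $p(L)=\sum_k a_k L^k$ is a $(1,1)$-tensor acting on each tangent space, and $\ker$ denotes its pointwise kernel. *)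

(* Defs.v *)
From HB Require Import structures.
From mathcomp Require Import all_boot all_order all_algebra.
From mathcomp Require Import all_classical all_reals all_analysis.
From mathcomp Require Export complex.

Set Implicit Arguments.
Unset Strict Implicit.
Unset Printing Implicit Defensive.

Import Order.TTheory GRing.Theory Num.Theory.
Import numFieldNormedType.Exports.

Local Open Scope classical_set_scope.
Local Open Scope ring_scope.

(* Only meaningful for open [U]: derivatives are taken in the ambient space. *)
Fixpoint Ck_on (R : realType) (n : nat) (V : normedModType R) (k : nat)
    (U : set 'rV[R]_n) (f : 'rV[R]_n -> V) : Prop :=
  (forall x, U x -> {for x, continuous f}) /\
  if k is k'.+1 then
    forall i : 'I_n,
      (forall x, U x -> derivable f x (delta_mx 0 i)) /\
      Ck_on k' U ('D_(delta_mx 0 i) f)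
  else True.

Definition smooth_on (R : realType) (n : nat) (V : normedModType R)
    (U : set 'rV[R]_n) (f : 'rV[R]_n -> V) : Prop :=
  forall k, Ck_on k U f.

Definition smooth_on1 (R : realType) (I : set R) (f : R -> R) : Prop :=
  forall (k : nat) (t : R), I t -> derivable (derive1n k f) t 1.

(* The inverse [cinv] is a total function whose values matter only on the
   image of the domain. *)
Record chart (R : realType) (n : nat) (M : topologicalType) := Chart {
  cdom : set M;
  cfun :> M -> 'rV[R]_n;
  cinv : 'rV[R]_n -> M;
  cdom_open : open cdom;
  cimg_open : open (cfun @` cdom);
  cfunK : forall p, cdom p -> cinv (cfun p) = p;
  cfun_continuous : forall p, cdom p -> {for p, continuous cfun};
  cinv_continuous : forall x, (cfun @` cdom) x -> {for x, continuous cinv}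
}.

Definition transition (R : realType) (n : nat) (M : topologicalType)
    (c c' : chart R n M) : 'rV[R]_n -> 'rV[R]_n := c' \o cinv c.

(* The atlas need not be maximal: it represents the smooth structure
   it generates. *)
Record smooth_manifold (R : realType) (n : nat) := SmoothManifold {
  points :> topologicalType;
  atlas : set (chart R n points);
  points_hausdorff : hausdorff_space points;
  points_second_countable : @second_countable points;
  atlas_cover : forall p : points, exists2 c, atlas c & cdom c p;
  atlas_compatible : forall c c', atlas c -> atlas c' ->
    smooth_on (c @` (cdom c `&` cdom c')) (transition c c')
}.

Definition chart_at (R : realType) (n : nat) (M : smooth_manifold R n)
    (p : M) (c : chart R n M) : Prop := atlas c /\ cdom c p.

Definition smooth_fun (R : realType) (n : nat) (M : smooth_manifold R n)
    (f : M -> R) : Prop :=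
  forall c : chart R n M, atlas c -> smooth_on (c @` cdom c) (f \o cinv c).

(* Tangent vectors at [p] are given by their coordinate row vectors in the
   charts at [p]; the row [v] in the chart [c] and the row
   [v *m transition_jacobian c c' p] in the chart [c'] are the same vector. *)
Definition transition_jacobian (R : realType) (n : nat)
    (M : smooth_manifold R n) (c c' : chart R n M) (p : M) : 'M[R]_n :=
  jacobian (transition c c') (c p).

(* [gcoef c p] is the Gram matrix g_ij at [p] in the chart [c]:
   g_p(v, w) = v *m gcoef c p *m w^T. *)
Record metric (R : realType) (n : nat) (M : smooth_manifold R n) := Metric {
  gcoef :> chart R n M -> M -> 'M[R]_n;
  gcoef_sym : forall p c, chart_at p c -> (gcoef c p)^T = gcoef c p;
  gcoef_nondegenerate : forall p c, chart_at p c -> gcoef c p \in unitmx;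
  gcoef_smooth : forall c : chart R n M, atlas c ->
    smooth_on (c @` cdom c) (fun x => gcoef c (cinv c x));
  gcoef_tensor : forall p c c', chart_at p c -> chart_at p c' ->
    gcoef c p = transition_jacobian c c' p *m gcoef c' p
                *m (transition_jacobian c c' p)^T
}.

(* Gamma^k_ij at [x] of the metric with coordinate matrix [G]. *)
Definition christoffel (R : realType) (n : nat) (G : 'rV[R]_n -> 'M[R]_n)
    (x : 'rV[R]_n) (k i j : 'I_n) : R :=
  2^-1 * \sum_(l < n) invmx (G x) k l *
    ('D_(delta_mx 0 i) (fun y => G y j l) x
     + 'D_(delta_mx 0 j) (fun y => G y i l) x
     - 'D_(delta_mx 0 l) (fun y => G y i j) x).

Definition coordinate (R : realType) (n : nat) (M : smooth_manifold R n)
    (c : chart R n M) (gamma : R -> M) (i : 'I_n) (t : R) : R :=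
  c (gamma t) 0 i.

(* Affinely parametrized geodesics on the open interval [I]; twice
   differentiable solutions of the equation are automatically smooth. *)
Definition is_geodesic (R : realType) (n : nat) (M : smooth_manifold R n)
    (g : metric M) (I : set R) (gamma : R -> M) : Prop :=
  (forall t, I t -> {for t, continuous gamma}) /\
  forall t c, I t -> chart_at (gamma t) c ->
    let x := coordinate c gamma in
    let Gamma := christoffel (fun y => g c (cinv c y)) (c (gamma t)) in
    forall k : 'I_n,
      [/\ derivable (x k) t 1, derivable (derive1 (x k)) t 1 &
          derive1n 2 (x k) t
          + \sum_(i < n) \sum_(j < n)
              Gamma k i j * derive1 (x i) t * derive1 (x j) t = 0].

(* [phi] is a diffeomorphism of the open interval [J] onto [I]; orientation may
   be reversed. *)
Definition reparametrization (R : realType) (J I : set R) (phi : R -> R) :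
    Prop :=
  [/\ open J, is_interval J, smooth_on1 J phi,
      forall t, J t -> derive1 phi t != 0 & phi @` J = I].

Definition is_unparametrized_geodesic (R : realType) (n : nat)
    (M : smooth_manifold R n) (g : metric M) (I : set R) (gamma : R -> M) :
    Prop :=
  exists (J : set R) (phi : R -> R),
    reparametrization J I phi /\ is_geodesic g J (gamma \o phi).

Definition geodesically_equivalent (R : realType) (n : nat)
    (M : smooth_manifold R n) (g gbar : metric M) : Prop :=
  forall (I : set R) (gamma : R -> M),
    is_unparametrized_geodesic g I gamma <->
    is_unparametrized_geodesic gbar I gamma.

(* The real [m]-th root of [r]: the nonnegative one for [r >= 0], and for [m]
   odd and [r < 0] the negative one. *)
Definition real_root (R : realType) (m : nat) (r : R) : R :=
  Num.sg r * (`|r| `^ (m%:R^-1)).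

Definition det_ratio (R : realType) (n : nat) (M : smooth_manifold R n)
    (g gbar : metric M) (c : chart R n M) (p : M) : R :=
  \det (gbar c p) / \det (g c p).

(* For even [n] the (n+1)-st root always exists; for odd [n] the ratio has to be
   positive. *)
Definition L_well_defined (R : realType) (n : nat) (M : smooth_manifold R n)
    (g gbar : metric M) : Prop :=
  odd n -> forall p c, chart_at p c -> 0 < det_ratio g gbar c p.

(* The matrix (L^i_j) at [p] in the chart [c], which acts on columns. *)
Definition L_tensor (R : realType) (n : nat) (M : smooth_manifold R n)
    (g gbar : metric M) (c : chart R n M) (p : M) : 'M[R]_n :=
  real_root n.+1 (det_ratio g gbar c p) *: (invmx (gbar c p) *m g c p).

Definition smooth_monic (R : realType) (n : nat) (M : smooth_manifold R n)
    (m : nat) (chi : M -> {poly R}) : Prop :=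
  (forall p, chi p \is monic /\ size (chi p) = m.+1) /\
  (forall k : nat, smooth_fun (fun p => (chi p)`_k)).

Definition no_common_complex_root (R : realType) (p q : {poly R}) : Prop :=
  forall z : R[i],
    ~ (root (map_poly (real_complex R) p) z /\
       root (map_poly (real_complex R) q) z).

(* [T] is a (1,1)-tensor field, given by its matrices in the charts. *)
Definition admissible_factorisation (R : realType) (n : nat)
    (M : smooth_manifold R n) (T : chart R n M -> M -> 'M[R]_n)
    (chi1 chi2 : M -> {poly R}) : Prop :=
  [/\ exists2 m, (1 <= m)%N & smooth_monic m chi1,
      exists2 m, (1 <= m)%N & smooth_monic m chi2,
      forall p c, chart_at p c -> char_poly (T c p) = chi1 p * chi2 p &
      forall p, no_common_complex_root (chi1 p) (chi2 p)].

(* [horner_mx] is only available for matrices of size of the form n.+1. *)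
Definition poly_mx (R : realType) (n : nat) (p : {poly R}) (A : 'M[R]_n) :
    'M[R]_n :=
  \sum_(k < size p) p`_k *: A ^+ k.

(* [D c p] is the set of the coordinate rows, in the chart [c], of the vectors
   of the distribution at [p]; only the [c] with [chart_at p c] matter. *)
Definition vector_set_field (R : realType) (n : nat)
    (M : smooth_manifold R n) : Type := chart R n M -> M -> set 'rV[R]_n.

Definition row_space (R : realType) (k n : nat) (A : 'M[R]_(k, n)) :
    set 'rV[R]_n := [set v | (v <= A)%MS].

Definition ker_poly (R : realType) (n : nat) (M : smooth_manifold R n)
    (chi : M -> {poly R}) (T : chart R n M -> M -> 'M[R]_n) :
    vector_set_field M :=
  fun c p => [set v | poly_mx (chi p) (T c p) *m v^T = 0].

(* Smooth distributions of rank [k]: chart-independent and locally spanned by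
   a smooth frame, the rows of [X]. *)
Definition is_distribution (R : realType) (n : nat) (M : smooth_manifold R n)
    (k : nat) (D : vector_set_field M) : Prop :=
  (forall p c c', chart_at p c -> chart_at p c' ->
     forall v, D c p v <-> D c' p (v *m transition_jacobian c c' p)) /\
  (forall p c, chart_at p c ->
     exists (U : set M) (X : 'rV[R]_n -> 'M[R]_(k, n)),
       [/\ open U, U p, U `<=` cdom c, smooth_on (c @` U) X &
           forall q, U q -> row_free (X (c q)) /\ D c q = row_space (X (c q))]).

(* The injectively immersed submanifold [f @` U] is everywhere tangent to [D];
   the row space of the Jacobian matrix of [c \o f] is the tangent space. *)
Definition is_integral_manifold (R : realType) (n : nat)
    (M : smooth_manifold R n) (k : nat) (D : vector_set_field M)
    (U : set 'rV[R]_k) (f : 'rV[R]_k -> M) : Prop :=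
  [/\ open U, set_inj U f, forall u, U u -> {for u, continuous f} &
      forall c : chart R n M, atlas c ->
        smooth_on (U `&` f @^-1` cdom c) (c \o f) /\
        forall u, U u -> cdom c (f u) ->
          row_free (jacobian (c \o f) u) /\
          D c (f u) = row_space (jacobian (c \o f) u)].

Definition integrable_distribution (R : realType) (n : nat)
    (M : smooth_manifold R n) (D : vector_set_field M) : Prop :=
  exists k : nat, is_distribution k D /\
    forall p : M, exists (U : set 'rV[R]_k) (f : 'rV[R]_k -> M),
      is_integral_manifold D U f /\ (f @` U) p.

(* Main.v *)
Require Import Defs.
From HB Require Import structures.
From mathcomp Require Import all_boot all_order all_algebra.
From mathcomp Require Import all_classical all_reals all_analysis.
From mathcomp Require Import perm ring lra zify.

Set Implicit Arguments.
Unset Strict Implicit.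
Unset Printing Implicit Defensive.

Import Order.TTheory GRing.Theory Num.Theory.
Import numFieldNormedType.Exports.

Local Open Scope classical_set_scope.
Local Open Scope ring_scope.

Local Notation "''e_' j" := (@delta_mx _ 1 _ 0 j) (at level 8, j at level 2) : ring_scope.

(** Idea of the proof.

    In a chart write [G] and [B] for the Gram matrices of the two metrics and
    [C a] for the matrix of the Levi-Civita connection of [G] in the direction
    [a].  Through every point and in every direction there passes a geodesic
    of [G]; reparametrized, it is a geodesic of [B], so the difference of the
    two connections, a symmetric bilinear map, takes the pair of [v] and [v]
    to a multiple of [v].  By polarization it is of the form
    [(a, u) |-> phi(a) u + phi(u) a] ([projective_relation],
    [projective_connection]).  Since both metrics are parallel for their own
    connections, differentiating [L = rho B^-1 G], where [rho] is a real root
    of [det B / det G], gives the structure equation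
      [D_a L = s(a) L + mu (a G) + a^T psi + (L C a - C a L)],
    that is, the covariant derivative of [L] is a multiple of [L] plus two
    terms of rank one, one of which has its image on the line of [a] while the
    other factors through the form [g(a, .)] ([structure_equation]).

    Let [E = chi1(L)] and let [v], [w] be vector fields in [ker E].
    Differentiating [E w = 0] along [v] and [E v = 0] along [w] expresses
    [E [v, w]] by the derivatives of [E] alone.  Expand them with the
    structure equation.  The terms with [s] stay in [ker E] because [L]
    commutes with [E]; the terms with [psi] are multiples of [v] and [w]; the
    terms with [mu] cancel because [g(v, L^k w)] is symmetric, [L] being
    selfadjoint for [g]; the terms with [C] cancel because the connection is
    torsion free and [E v = E w = 0].  What remains lies in [ker E], so
    [E^2 [v, w] = 0] ([power_bracket], [poly_field_bracket]).  As [chi1] and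
    [chi2] are coprime and [chi1(L) chi2(L) = 0] by Cayley and Hamilton,
    [E^2 u = 0] implies [E u = 0] ([poly_mx_ker_square]): the distribution is involutive.

    The same coprimality shows that [ker chi1(L)] is the image of [chi2(L)]
    and has the constant dimension [deg chi1] ([rank_real_factor],
    [ker_row_space]); so suitable combinations of the columns of [chi2(L)]
    form a smooth frame.  Normalize it so that a fixed linear projection [P]
    sends it to the standard basis.  Brackets of its members lie in the
    distribution and are killed by [P], hence vanish
    ([adapted_frame_commutes]).

    This leaves the Frobenius theorem for commuting frames
    ([commuting_frame_integral_smooth]).  The integral manifold is the time
    one map [x |-> z_x(1)] of the fields [x Y], where [Y] is the matrix whose
    rows are the frame: commutation makes [t (xi Y(z_x(t)))] the derivative of
    [z_x(t)] in the direction [xi], with a quadratic error that follows from a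
    Gronwall inequality.  Up to a translation the map is inverted by [P], and
    its Jacobian matrix [Y] at the image point bootstraps its smoothness.

    The analysis behind this is developed for the inductive notion [Ck_on]:
    its stability under algebraic operations and composition, the symmetry of
    second derivatives, and the Picard theorem, which yields both the
    geodesics and the flows. *)

(** * Norms, curves and mean values *)

Section Norm.
Variables (R : realType) (n : nat).
Implicit Types x : 'rV[R]_n.

Lemma rV_norm_le x (r : R) : 0 <= r -> (`|x| <= r) <-> forall j, `|x 0 j| <= r.
Proof.
move=> r0; rewrite {1}/Num.Def.normr/= mx_normrE; split.
  move=> H j; apply: le_trans H.
  exact: (le_bigmax _ (fun i : 'I_1 * 'I_n => `|x i.1 i.2|) (0, j)).
by move=> H; apply: bigmax_le => // -[i j] _ /=; rewrite ord1.
Qed.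

Lemma rV_norm_lt x (r : R) : 0 < r -> (`|x| < r) <-> forall j, `|x 0 j| < r.
Proof.
move=> r0; rewrite {1}/Num.Def.normr/= mx_normrE; split.
  move=> H j; apply: le_lt_trans H.
  exact: (le_bigmax _ (fun i : 'I_1 * 'I_n => `|x i.1 i.2|) (0, j)).
by move=> H; apply: bigmax_lt => // -[i j] _ /=; rewrite ord1.
Qed.

Lemma coord_norm x j : `|x 0 j| <= `|x|.
Proof. by move: j; apply/rV_norm_le. Qed.

End Norm.

Section Directional.
Variables (R : realType) (V : normedModType R).

Lemma is_derive_line (W : normedModType R) (f : V -> W) (x v : V) (s : R) :
  derivable f (x + s *: v) v ->
  is_derive s 1 (fun t : R => f (x + t *: v)) ('D_v f (x + s *: v)).
Proof.
have E : (fun h : R => h^-1 *: (((fun t : R => f (x + t *: v)) \o shift s) (h *: 1)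
            - f (x + s *: v))) =
         (fun h : R => h^-1 *: ((f \o shift (x + s *: v)) (h *: v) - f (x + s *: v))).
  apply/funext => h /=; congr (_ *: (f _ - _)).
  by rewrite [h *: 1]mulr1 scalerDl addrCA.
move=> H; apply: DeriveDef; first by rewrite /derivable E; exact: H.
by rewrite /derive E.
Qed.

End Directional.

Section Curves.
Variables (R : realType) (V : normedModType R).

(** The inner function is real, so the chain rule takes this scalar form; it
    is used for reparametrized curves. *)
Lemma is_derive_reparam (f : R -> V) (g : R -> R) (t g' : R) (f' : V) :
  is_derive t 1 g g' -> is_derive (g t) 1 f f' ->
  is_derive t 1 (f \o g) (g' *: f').
Proof.
move=> [dg <-] [df <-].
have Dg := (derivable1_diffP _ _).1 dg; have Df := (derivable1_diffP _ _).1 df.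
have D := differentiable_comp Dg Df.
apply: DeriveDef; first exact: diff_derivable.
rewrite deriveE // diff_comp //= (deriv1E df) derive1E (deriveE (1 : R) Dg).
by [].
Qed.

Lemma is_derive_mulr (t c : R) : is_derive t 1 (fun s : R => s * c) c.
Proof.
have := @is_deriveM _ _ id (cst c) t 1 1 0 (is_derive_id _ _) (is_derive_cst _ _ _).
by move/is_derive_eq; apply; rewrite scaler0 add0r /cst [LHS]mulr1.
Qed.

End Curves.

Section MeanValue.
Variables (R : realType) (n : nat).
Implicit Types (f : 'rV[R]_n -> R) (x y z a : 'rV[R]_n) (r : R).


(** The increment [c] may have either sign: the segment is parametrized by
    [s] in the unit interval, which spares a case distinction. *)
Lemma mean_value_line (V : normedModType R) (f : V -> R) (x v : V) (c : R) :
  (forall s : R, 0 <= s <= 1 -> derivable f (x + (s * c) *: v) v) ->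
  exists2 s : R, 0 <= s <= 1 &
    f (x + c *: v) - f x = c * 'D_v f (x + (s * c) *: v).
Proof.
move=> df; set phi := fun s : R => f (x + (s * c) *: v).
have dphi (s : R) : 0 <= s <= 1 ->
    is_derive s 1 phi (c * 'D_v f (x + (s * c) *: v)).
  move=> s01; pose h (t : R) := f (x + t *: v).
  have /is_derive_line dh := df _ s01.
  exact: (is_derive_reparam (is_derive_mulr s c) dh).
have dphi' (s : R) : s \in `]0, 1[ -> is_derive s 1 phi (c * 'D_v f (x + (s * c) *: v)).
  by rewrite in_itv/= => /andP[s0 s1]; apply: dphi; rewrite !ltW.
have cphi : {within `[0, 1], continuous phi}.
  apply: derivable_within_continuous => s; rewrite in_itv/= => s01.
  by have [] := dphi _ s01.
have [s] := MVT_segment ler01 dphi' cphi.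
rewrite in_itv/= => s01; rewrite subr0 mulr1 /phi mul1r mul0r scale0r addr0 => ->.
by exists s.
Qed.

(** The coordinates of [y] are changed into those of [z] one at a time, and
    the mean value theorem is applied to each change. The intermediate points
    keep within the ball because the norm is the maximum norm. *)
Lemma mean_value_box f a r y z :
  `|y - a| < r -> `|z - a| < r ->
  (forall x (j : 'I_n), `|x - a| < r -> derivable f x 'e_j) ->
  exists xi : 'I_n -> 'rV[R]_n,
    (forall j, `|xi j - a| < r /\ `|xi j - y| <= `|z - y|) /\
    f z - f y = \sum_j (z - y) 0 j * 'D_('e_j) f (xi j).
Proof.
move=> ya za df.
have r0 : 0 < r by exact: le_lt_trans ya.
pose p m : 'rV[R]_n := \row_j (if (j < m)%N then z 0 j else y 0 j).
have p0 : p 0%N = y by apply/rowP => j; rewrite mxE.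
have pn : p n = z by apply/rowP => j; rewrite mxE ltn_ord.
pose c (j : 'I_n) : R := (z - y) 0 j.
have pS (j : 'I_n) : p j.+1 = p j + c j *: 'e_j.
  apply/rowP => i; rewrite !mxE eqxx ltnS leq_eqVlt /=.
  have [->|nij] := eqVneq i j; first by rewrite eqxx ltnn /= mulr1 /c !mxE; ring.
  by rewrite (_ : (i == j :> nat) = false) ?mulr0 ?addr0 //; apply/negbTE.
have key (s : R) (j i : 'I_n) : 0 <= s <= 1 ->
    `|(p j + (s * c j) *: 'e_j - a) 0 i| < r /\
    `|(p j + (s * c j) *: 'e_j - y) 0 i| <= `|z - y|.
  move=> s01.
  (* Every coordinate of an intermediate point lies between those of [y]
     and [z]. *)
  have : exists2 t : R, 0 <= t <= 1 &
      (p j + (s * c j) *: 'e_j) 0 i = y 0 i + t * (z - y) 0 i.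
    rewrite !mxE eqxx /=; have [->|nij] := eqVneq i j.
      by exists s => //; rewrite ltnn mulr1 /c !mxE.
    case: ifP => _; first by exists 1; rewrite ?ler01 ?lexx // mulr0; ring.
    by exists 0; rewrite ?ler01 ?lexx // mulr0; ring.
  move=> [u /andP[u0 u1] E]; split.
    rewrite mxE E [X in _ + X]mxE.
    have -> : y 0 i + u * (z - y) 0 i - a 0 i
      = (1 - u) * (y - a) 0 i + u * (z - a) 0 i by rewrite !mxE; ring.
    have Y : `|(y - a) 0 i| < r by apply: le_lt_trans ya; exact: coord_norm.
    have Z : `|(z - a) 0 i| < r by apply: le_lt_trans za; exact: coord_norm.
    apply: le_lt_trans (ler_normD _ _) _; rewrite !normrM (ger0_norm u0).
    rewrite (@ger0_norm _ (1 - u)) ?subr_ge0 //.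
    set A := `|_| in Y *; set B := `|_| in Z *.
    have [M [AM BM Mr]] : exists M, [/\ A <= M, B <= M & M < r].
      by exists (Num.max A B); rewrite gt_max Y Z !le_max !lexx orbT.
    have a1 : (1 - u) * A <= (1 - u) * M by rewrite ler_wpM2l ?subr_ge0.
    have a2 : u * B <= u * M by rewrite ler_wpM2l.
    lra.
  rewrite mxE E [X in _ + X]mxE addrAC subrr add0r normrM (ger0_norm u0).
  apply: le_trans (coord_norm _ i); by rewrite ler_piMl.
have M (j : 'I_n) : exists xi, (`|xi - a| < r /\ `|xi - y| <= `|z - y|) /\
    f (p j.+1) - f (p j) = c j * 'D_('e_j) f xi.
  have B (s : R) : 0 <= s <= 1 -> `|p j + (s * c j) *: 'e_j - a| < r /\
       `|p j + (s * c j) *: 'e_j - y| <= `|z - y|.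
    move=> s01; split; first by apply/rV_norm_lt => // i; have [] := key s j i s01.
    by apply/rV_norm_le => // i; have [] := key s j i s01.
  have [s s01 E] := @mean_value_line _ f (p j) 'e_j (c j)
    (fun s s01 => df _ _ (B s s01).1).
  by exists (p j + (s * c j) *: 'e_j); split; [exact: B|rewrite pS E].
have [xi xiP] := choice M; exists xi; split; first by move=> j; have [] := xiP j.
rewrite -pn -[in LHS]p0.
have -> : f (p n) - f (p 0%N) = \sum_(0 <= j < n) (f (p j.+1) - f (p j)).
  by rewrite telescope_sumr.
rewrite big_mkord; apply: eq_bigr => j _; rewrite pn.
by have [] := xiP j.
Qed.

End MeanValue.

(** * Differentiability from continuous partial derivatives *)

Section Differentiable.
Variables (R : realType).

(** Differentiability and the value of the differential from an epsilon
    estimate, which hides the little-o notation from the proofs that follow. *)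
Lemma differentiable_by_estimate (V W : normedModType R) (f : V -> W)
    (df : {linear V -> W}) (x : V) :
  continuous df ->
  (forall e : R, 0 < e -> \forall h \near (0 : V), `|f (x + h) - f x - df h| <= e * `|h|) ->
  differentiable f x /\ 'd f x = df :> (V -> W).
Proof.
move=> cdf H.
have E : f \o shift x = cst (f x) + df +o_ (0 : V) id.
  apply/eqaddoP => e e0; near=> h.
  have -> : (f \o shift x - (cst (f x) + df)) h = f (x + h) - f x - df h.
    by rewrite -[LHS]/(f (h + x) - (f x + df h)) opprD addrA [h + x]addrC.
  near: h; exact: H.
have D := diff_unique cdf E; split=> //.
by apply/diff_locallyP; rewrite D.
Unshelve. all: by end_near. Qed.

Lemma near_norm_lt (V : normedModType R) (r : R) :
  0 < r -> \forall h \near (0 : V), `|h| < r.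
Proof. by move=> r0; apply/nbhs_normP; exists r => //= h; rewrite /= sub0r normrN. Qed.

Lemma near_ballP (V : normedModType R) (a : V) (P : V -> Prop) :
  (\forall x \near a, P x) <-> exists2 r : R, 0 < r & forall x, `|x - a| < r -> P x.
Proof.
split=> [/nbhs_normP[r /= r0 rP]|[r r0 rP]].
  by exists r => // x xr; apply: rP; rewrite /= distrC.
by apply/nbhs_normP; exists r => //= x /=; rewrite distrC; exact: rP.
Qed.

Lemma near_forall (T : topologicalType) (I : finType) (P : I -> T -> Prop) (a : T) :
  (forall i, \forall x \near a, P i x) -> \forall x \near a, forall i, P i x.
Proof. exact: (@filter_forall T I P (nbhs a)). Qed.

Lemma near_and (T : topologicalType) (P Q : T -> Prop) (a : T) :
  (\forall x \near a, P x) -> (\forall x \near a, Q x) -> \forall x \near a, P x /\ Q x.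
Proof. exact: (@filterI T (nbhs a)). Qed.

Lemma continuous_sum_fun (T : topologicalType) (V : normedModType R) m
    (f : 'I_m -> T -> V) (x : T) :
  (forall j, {for x, continuous (f j)}) ->
  {for x, continuous (fun y => \sum_j f j y)}.
Proof.
elim: m f => [|m IH] f cf.
  have -> : (fun y => \sum_j f j y) = cst 0 by apply/funext => y; rewrite big_ord0.
  exact: cvg_cst.
have -> : (fun y => \sum_j f j y) = f ord0 + (fun y => \sum_j f (lift ord0 j) y).
  by apply/funext => y; rewrite big_ord_recl.
apply: continuousD; first exact: cf.
by apply: IH => j; exact: cf.
Qed.

Variable n : nat.
Implicit Types (f : 'rV[R]_n -> R) (a v : 'rV[R]_n).

Lemma rV_sum_delta v : v = \sum_j v 0 j *: 'e_j.
Proof. by rewrite {1}[v]row_sum_delta. Qed.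

Lemma linear_of_coefs (c : 'I_n -> R) :
  exists L : {linear 'rV[R]_n -> R}, continuous L /\ forall v, L v = \sum_j v 0 j * c j.
Proof.
pose L (v : 'rV[R]_n) := \sum_j v 0 j * c j.
have linL : linear L.
  move=> k u v; rewrite /L scaler_sumr -big_split /=; apply: eq_bigr => j _.
  by rewrite !mxE mulrDl -mulrA.
pose LM := GRing.isLinear.Build _ _ _ _ _ linL.
pose L' : {linear 'rV[R]_n -> R} := HB.pack L LM.
exists L'; split => //.
  move=> v; apply: continuous_sum_fun => j.
  apply: (@continuousM _ _ (fun v : 'rV[R]_n => v 0 j) (cst (c j))).
    exact: coord_continuous.
  exact: cst_continuous.
Qed.

(** By [mean_value_box] the increment of [f] is the sum of the increments of
    the coordinates times partial derivatives at nearby points; continuity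
    replaces these by the values at [a]. *)
Lemma continuous_partials_differentiable f a :
  (forall j : 'I_n, \forall x \near a, derivable f x 'e_j) ->
  (forall j : 'I_n, {for a, continuous ('D_('e_j) f)}) ->
  differentiable f a.
Proof.
move=> df cf.
have [L [cL LE]] := linear_of_coefs (fun j => 'D_('e_j) f a).
apply: (proj1 (@differentiable_by_estimate _ _ f L a cL _)) => e e0.
have df' : \forall x \near a, forall j : 'I_n, derivable f x 'e_j.
  by apply: near_forall => j; exact: df.
(* The error is a sum of [n] terms; dividing by [n.+1] is legitimate for [n
   = 0] too. *)
pose e' := e / n.+1%:R.
have e'0 : 0 < e' by rewrite divr_gt0.
have cf' : \forall x \near a, forall j : 'I_n,
    `|'D_('e_j) f a - 'D_('e_j) f x| <= e'.
  apply: near_forall => j; move/cvgrPdist_le : (cf j); exact.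
have [r r0 rP] := (near_ballP _ _).1 (filterI df' cf').
apply: filterS (@near_norm_lt 'rV[R]_n _ r0) => h hr.
have [|||xi [xiP ->]] := @mean_value_box _ _ f a r a (a + h).
- by rewrite subrr normr0.
- by rewrite addrC addKr.
- by move=> x j xr; have [+ _] := rP _ xr; exact.
have E : a + h - a = h by rewrite addrC addKr.
rewrite E in xiP *.
rewrite LE -sumrB; apply: le_trans (ler_norm_sum _ _ _) _.
apply: (@le_trans _ _ (\sum_(j < n) `|h| * e')).
  apply: ler_sum => j _; rewrite -mulrBr normrM ler_pM //; first exact: coord_norm.
  have [xr _] := xiP j.
  by have [_ /(_ j)] := rP _ xr; rewrite distrC.
rewrite sumr_const card_ord -mulr_natr /e' mulrC !mulrA.
rewrite ler_pdivrMr ?ltr0n //.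
have : e * `|h| * n%:R <= e * `|h| * n.+1%:R by rewrite ler_wpM2l ?ler_nat ?mulr_ge0 ?(ltW e0).
by rewrite [X in X <= _](_ : _ = n%:R * `|h| * e) //; ring.
Qed.

End Differentiable.

(** * Calculus of functions of class C^k *)

Section Ck.
Variables (R : realType) (n : nat).
Implicit Types (U : set 'rV[R]_n) (k : nat).

Lemma open_near (T : topologicalType) (A : set T) x :
  open A -> A x -> \forall y \near x, A y.
Proof. by move=> oA Ax; apply: open_nbhs_nbhs. Qed.

Lemma near_eq_continuous (T S : topologicalType) (f g : T -> S) x :
  (\forall y \near x, f y = g y) -> {for x, continuous f} -> {for x, continuous g}.
Proof.
move=> fg cf; suff : g y @[y --> x] --> f x by rewrite (nbhs_singleton fg).
by apply: cvg_trans cf; apply: near_eq_cvg; apply: filterS fg.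
Qed.

Lemma Ck_on_sub (V : normedModType R) k U U' (f : 'rV[R]_n -> V) :
  U' `<=` U -> Ck_on k U f -> Ck_on k U' f.
Proof.
move=> UU; elim: k f => [|k IH] f /= [cf H].
  by split=> // x /UU; exact: cf.
split=> [x /UU|i]; first exact: cf.
by have [df Cf] := H i; split=> [x /UU|]; [exact: df | exact: IH].
Qed.

Lemma Ck_onW (V : normedModType R) k U (f : 'rV[R]_n -> V) :
  Ck_on k.+1 U f -> Ck_on k U f.
Proof.
elim: k f => [|k IH] f [cf H]; first by split.
split=> // i; have [df Cf] := H i; split=> //.
exact: IH.
Qed.

(** Openness of [U] matters: the derivatives at a point of [U] only see the
    values near that point. *)
Lemma Ck_on_eq (V : normedModType R) k U (f g : 'rV[R]_n -> V) :
  open U -> (forall x, U x -> f x = g x) -> Ck_on k U f -> Ck_on k U g.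
Proof.
move=> oU.
have N (f' g' : 'rV[R]_n -> V) : (forall x, U x -> f' x = g' x) ->
    forall x, U x -> \forall y \near x, f' y = g' y.
  by move=> fg x Ux; apply: filterS (open_near oU Ux).
elim: k f g => [|k IH] f g fg [cf H].
  by split=> // x Ux; apply: near_eq_continuous (cf x Ux); exact: N.
split=> [x Ux|i]; first by apply: near_eq_continuous (cf x Ux); exact: N.
have [df Cf] := H i; split=> [x Ux|].
  by apply: near_eq_derivable (df x Ux); exact: N.
by apply: IH Cf => x Ux; apply: near_eq_derive; exact: N.
Qed.

Lemma Ck_on_continuous (V : normedModType R) k U (f : 'rV[R]_n -> V) x :
  Ck_on k U f -> U x -> {for x, continuous f}.
Proof. by case: k => [|k] [cf _]; exact: cf. Qed.

Lemma Ck_on_derivable (V : normedModType R) k U (f : 'rV[R]_n -> V) x i :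
  Ck_on k.+1 U f -> U x -> derivable f x 'e_i.
Proof. by case=> _ /(_ i)[df _]; exact: df. Qed.

Lemma continuous_mx (T : topologicalType) a b (F : T -> 'M[R]_(a, b)) x :
  (forall i j, {for x, continuous (fun y => F y i j)}) -> {for x, continuous F}.
Proof.
move=> cF; apply/cvgrPdist_le => e e0.
have H : \forall y \near x, forall ij : 'I_a * 'I_b,
    `|F x ij.1 ij.2 - F y ij.1 ij.2| <= e.
  apply: near_forall => -[i j]; move/cvgrPdist_le: (cF i j); exact.
apply: filterS H => y H.
rewrite {1}/Num.Def.normr/= mx_normrE; apply: bigmax_le; first exact: ltW.
by move=> ij _; rewrite !mxE; exact: H.
Qed.

Lemma continuous_entry (T : topologicalType) a b (F : T -> 'M[R]_(a, b)) x i j :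
  {for x, continuous F} -> {for x, continuous (fun y => F y i j)}.
Proof.
move=> cF; apply: (@continuous_comp _ _ _ F (fun M : 'M[R]_(a, b) => M i j)) => //.
exact: coord_continuous.
Qed.

(** The norm of a matrix is the maximum of its entries, so limits and
    derivatives are taken entry by entry. This reduces every statement on
    matrix functions to real functions. *)
Lemma Ck_on_mx k U a b (F : 'rV[R]_n -> 'M[R]_(a, b)) : open U ->
  Ck_on k U F <-> forall i j, Ck_on k U (fun x => F x i j).
Proof.
move=> oU.
have cF := @continuous_entry 'rV[R]_n a b.
elim: k F => [|k IH] F; split.
- by case=> c _ i j; split=> // x Ux; apply: cF; exact: c.
- move=> H; split=> // x Ux; apply: continuous_mx => i j.
  by have [+ _] := H i j; exact.
- case=> c H i j; split=> [x Ux|l]; first by apply: cF; exact: c.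
  have [df Cf] := H l; split=> [x Ux|].
    by have /derivable_mxP := df x Ux; exact.
  apply: Ck_on_eq (((IH _).1 Cf) i j) => // x Ux.
  by rewrite derive_mx ?mxE //; exact: df.
- move=> H; split=> [x Ux|l].
    by apply: continuous_mx => i j; have [+ _] := H i j; exact.
  have df x : U x -> derivable F x 'e_l.
    by move=> Ux; apply/derivable_mxP => i j; exact: Ck_on_derivable (H i j) Ux.
  split=> //; apply/IH => i j; have [_ /(_ l)[_ Cf]] := H i j.
  apply: Ck_on_eq Cf => // x Ux.
  by rewrite derive_mx ?mxE //; exact: df.
Qed.

End Ck.

Section CkScalar.
Variables (R : realType) (n : nat) (U : set 'rV[R]_n).
Hypothesis oU : open U.
Implicit Types (f g : 'rV[R]_n -> R) (k : nat).

Lemma Ck_on_cst (V : normedModType R) k (c : V) : Ck_on k U (cst c).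
Proof.
elim: k c => [|k IH] c; split=> [x _|]; first [exact: cst_continuous | by [] | idtac].
move=> i; split=> [x _|]; first exact: derivable_cst.
by apply: Ck_on_eq (IH 0) => // x _; rewrite derive_cst.
Qed.

Lemma Ck_onD (V : normedModType R) k (f g : 'rV[R]_n -> V) :
  Ck_on k U f -> Ck_on k U g -> Ck_on k U (fun x => f x + g x).
Proof.
elim: k f g => [|k IH] f g [cf Hf] [cg Hg].
  by split=> // x Ux; apply: continuousD; [exact: cf | exact: cg].
split=> [x Ux|i]; first by apply: continuousD; [exact: cf | exact: cg].
have [df Cf] := Hf i; have [dg Cg] := Hg i; split=> [x Ux|].
  by apply: derivableD; [exact: df | exact: dg].
apply: Ck_on_eq (IH _ _ Cf Cg) => // x Ux.
by rewrite (deriveD (df x Ux) (dg x Ux)).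
Qed.

Lemma Ck_onM k f g :
  Ck_on k U f -> Ck_on k U g -> Ck_on k U (fun x => f x * g x).
Proof.
elim: k f g => [|k IH] f g.
  move=> [cf _] [cg _].
  by split=> // x Ux; apply: continuousM; [exact: cf | exact: cg].
move=> F G; have [cf Hf] := F; have [cg Hg] := G.
split=> [x Ux|i]; first by apply: continuousM; [exact: cf | exact: cg].
have [df Cf] := Hf i; have [dg Cg] := Hg i; split=> [x Ux|].
  by apply: derivableM; [exact: df | exact: dg].
apply: Ck_on_eq (Ck_onD (IH _ _ (Ck_onW F) Cg) (IH _ _ (Ck_onW G) Cf)) => // x Ux.
by rewrite (deriveM (df x Ux) (dg x Ux)).
Qed.

Lemma Ck_onN k f : Ck_on k U f -> Ck_on k U (fun x => - f x).
Proof.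
move=> F; apply: Ck_on_eq (Ck_onM (Ck_on_cst k (-1 : R)) F) => // x _.
by rewrite mulN1r.
Qed.

Lemma Ck_on_sum (V : normedModType R) k m (f : 'I_m -> 'rV[R]_n -> V) :
  (forall j, Ck_on k U (f j)) -> Ck_on k U (fun x => \sum_j f j x).
Proof.
elim: m f => [|m IH] f F.
  by apply: Ck_on_eq (Ck_on_cst k 0) => // x _; rewrite big_ord0.
have G : Ck_on k U (fun x => \sum_j f (lift ord0 j) x) by apply: IH => j; exact: F.
by apply: Ck_on_eq (Ck_onD (F ord0) G) => // x _; rewrite big_ord_recl.
Qed.

Lemma Ck_on_prod k m (f : 'I_m -> 'rV[R]_n -> R) :
  (forall j, Ck_on k U (f j)) -> Ck_on k U (fun x => \prod_j f j x).
Proof.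
elim: m f => [|m IH] f F.
  by apply: Ck_on_eq (Ck_on_cst k (1 : R)) => // x _; rewrite big_ord0.
have G : Ck_on k U (fun x => \prod_j f (lift ord0 j) x) by apply: IH => j; exact: F.
by apply: Ck_on_eq (Ck_onM (F ord0) G) => // x _; rewrite big_ord_recl.
Qed.

(** The derivative of the inverse contains the inverse itself, whence the
    induction on [k]. *)
Lemma Ck_onV k f : (forall x, U x -> f x != 0) ->
  Ck_on k U f -> Ck_on k U (fun x => (f x)^-1).
Proof.
elim: k f => [|k IH] f f0 F; have [cf Hf] := F.
  by split=> // x Ux; apply: (@continuousV _ _ f x (f0 x Ux)); exact: cf.
split=> [x Ux|i]; first by apply: (@continuousV _ _ f x (f0 x Ux)); exact: cf.
have [df Cf] := Hf i; split=> [x Ux|].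
  by apply: derivableV; [exact: f0 | exact: df].
have I := IH _ f0 (Ck_onW F).
apply: Ck_on_eq (Ck_onN (Ck_onM (Ck_onM I I) Cf)) => // x Ux.
by rewrite (deriveV (f0 x Ux) (df x Ux)) -exprVn scaleNr expr2.
Qed.

(** A coordinate is affine: its partial derivatives are constants, read off
    from the derivative of the identity. *)
Lemma Ck_on_coord k (j : 'I_n) : Ck_on k U (fun x : 'rV[R]_n => x 0 j).
Proof.
have did (i : 'I_n) x : derivable (id : 'rV[R]_n -> 'rV[R]_n) x 'e_i.
  exact: derivable_id.
have d (i : 'I_n) x : is_derive x 'e_i (fun x : 'rV[R]_n => x 0 j) (('e_i : 'rV[R]_n) 0 j).
  apply: DeriveDef; first by have /derivable_mxP := did i x; exact.
  have := derive_mx (did i x).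
  by rewrite derive_id => /matrixP/(_ 0 j); rewrite [in X in _ = X -> _]mxE.
case: k => [|k]; first by split=> // x _; exact: coord_continuous.
split=> [x _|i]; first exact: coord_continuous.
split=> [x _|]; first by have [] := d i x.
apply: Ck_on_eq (Ck_on_cst k (('e_i : 'rV[R]_n) 0 j)) => // x _.
by case: (d i x).
Qed.

(** All partial derivatives exist near [x] and are continuous at [x]. *)
Lemma Ck_on_differentiable k f x : Ck_on k.+1 U f -> U x -> differentiable f x.
Proof.
move=> F Ux; apply: continuous_partials_differentiable => j.
  by apply: filterS (open_near oU Ux) => y Uy; exact: Ck_on_derivable F Uy.
by have [_ /(_ j)[_ C]] := F; exact: Ck_on_continuous C Ux.
Qed.

Lemma differentiable_mx (V : normedModType R) a b (F : V -> 'M[R]_(a, b)) x :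
  (forall i j, differentiable (fun y => F y i j) x) -> differentiable F x.
Proof.
move=> dF.
have -> : F = \sum_i \sum_j (fun y => F y i j *: delta_mx i j).
  apply/funext => y; rewrite fct_sumE [LHS]matrix_sum_delta.
  by apply: eq_bigr => i _; rewrite fct_sumE.
apply: differentiable_sum => i; apply: differentiable_sum => j.
exact: differentiableZl.
Qed.

Lemma Ck_on_differentiable_mx k a b (F : 'rV[R]_n -> 'M[R]_(a, b)) x :
  Ck_on k.+1 U F -> U x -> differentiable F x.
Proof.
move=> /(Ck_on_mx _ _ oU) H Ux; apply: differentiable_mx => i j.
exact: Ck_on_differentiable (H i j) Ux.
Qed.

Lemma derive_rV (V : normedModType R) (f : 'rV[R]_n -> V) x v :
  differentiable f x -> 'D_v f x = \sum_j v 0 j *: 'D_('e_j) f x.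
Proof.
move=> df; rewrite deriveE // {1}[v]rV_sum_delta linear_sum /=.
by apply: eq_bigr => j _; rewrite linearZ /= deriveE.
Qed.

End CkScalar.

Section CkComp.
Variables (R : realType) (m n : nat) (U : set 'rV[R]_m) (V : set 'rV[R]_n).
Hypotheses (oU : open U) (oV : open V).

(** Induction on [k] through the chain rule: the partial derivatives of [f \o
    h] are sums of products of those of [h] and of those of [f] composed with
    [h]. *)
Lemma Ck_on_comp k (h : 'rV[R]_m -> 'rV[R]_n) (f : 'rV[R]_n -> R) :
  (forall x, U x -> V (h x)) -> Ck_on k U h -> Ck_on k V f -> Ck_on k U (f \o h).
Proof.
move=> UV; elim: k f => [|k IH] f H F.
  split=> // x Ux; apply: continuous_comp; first exact: Ck_on_continuous H Ux.
  exact: Ck_on_continuous F (UV _ Ux).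
have dh x : U x -> differentiable h x by exact: Ck_on_differentiable_mx H.
have df x : U x -> differentiable f (h x).
  by move=> /UV; exact: Ck_on_differentiable F.
split=> [x Ux|i].
  apply: continuous_comp; first exact: Ck_on_continuous H Ux.
  exact: Ck_on_continuous F (UV _ Ux).
split=> [x Ux|].
  apply: diff_derivable; apply: differentiable_comp; [exact: dh | exact: df].
have G (j : 'I_n) : Ck_on k U (fun x => ('D_(delta_mx 0 i) h x) 0 j
     * ('D_(delta_mx 0 j) f \o h) x).
  apply: Ck_onM => //.
    by have [_ /(_ i)[_ /(Ck_on_mx _ _ oU)]] := H; exact.
  by apply: IH; [exact: Ck_onW | have [_ /(_ j)[]] := F].
apply: Ck_on_eq (Ck_on_sum oU G) => // x Ux.
rewrite [RHS]deriveE; last by apply: differentiable_comp; [exact: dh | exact: df].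
rewrite diff_comp; [|exact: dh|exact: df] => /=.
by rewrite -[in RHS](deriveE _ (df _ Ux)) (derive_rV _ (df _ Ux)) (deriveE _ (dh _ Ux)).
Qed.

Lemma Ck_on_comp_mx k a b (h : 'rV[R]_m -> 'rV[R]_n) (F : 'rV[R]_n -> 'M[R]_(a, b)) :
  (forall x, U x -> V (h x)) -> Ck_on k U h -> Ck_on k V F -> Ck_on k U (F \o h).
Proof.
move=> UV H /(Ck_on_mx _ _ oV) F'; apply/Ck_on_mx => // i j.
exact: Ck_on_comp UV H (F' i j).
Qed.

End CkComp.

(** * Symmetry of second derivatives *)

Section Schwarz.
Variables (R : realType) (n : nat).

Lemma norm_delta_le (s h : R) (i : 'I_n) : 0 <= s <= 1 -> 0 <= h ->
  `|(s * h) *: 'e_i| <= h.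
Proof.
move=> /andP[s0 s1] h0; apply/rV_norm_le => // j; rewrite !mxE eqxx /=.
rewrite !normrM normr_nat !ger0_norm //.
case: (j == i); rewrite ?mulr1 ?mulr0 //.
by rewrite ler_piMl.
Qed.

Lemma dist_le_of_common (A B X Y e : R) :
  X = Y -> `|A - X| <= e / 2 -> `|B - Y| <= e / 2 -> `|A - B| <= e.
Proof.
move=> <- AX BX; rewrite -(subrKA X) (splitr e).
by apply: le_trans (ler_normD _ _) _; rewrite lerD // distrC.
Qed.

(** Two applications of the mean value theorem, first in the direction [i] to
    the increment of [f] in the direction [j], then in the direction [j]. *)
Lemma mixed_difference (f : 'rV[R]_n -> R) (U : set 'rV[R]_n) (a : 'rV[R]_n) (i j : 'I_n) (h : R) :
  0 < h -> (forall y, `|y - a| <= h + h -> U y) ->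
  (forall y, U y -> derivable f y 'e_i) ->
  (forall y, U y -> derivable ('D_('e_i) f) y 'e_j) ->
  exists xi, `|xi - a| <= h + h /\
    f (a + h *: 'e_i + h *: 'e_j) - f (a + h *: 'e_i) - f (a + h *: 'e_j) + f a
    = h * (h * 'D_('e_j) ('D_('e_i) f) xi).
Proof.
move=> h0 aU df ddf.
have near_a (s t : R) : 0 <= s <= 1 -> 0 <= t <= 1 ->
    `|a + (s * h) *: 'e_i + (t * h) *: 'e_j - a| <= h + h.
  move=> s01 t01; rewrite addrAC [a + _]addrC addrK.
  by apply: le_trans (ler_normD _ _) _; rewrite lerD // norm_delta_le // ltW.
have r00 : 0 <= (0 : R) <= 1 by rewrite lexx ler01.
have r11 : 0 <= (1 : R) <= 1 by rewrite lexx ler01.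
have near_i (s : R) : 0 <= s <= 1 -> U (a + (s * h) *: 'e_i).
  by move=> s01; apply: aU; have := near_a s 0 s01 r00; rewrite mul0r scale0r addr0.
have near_ij (s : R) : 0 <= s <= 1 -> U (a + h *: 'e_j + (s * h) *: 'e_i).
  move=> s01; apply: aU; have := near_a s 1 s01 r11.
  by rewrite mul1r (addrAC a (h *: 'e_j)).
pose phi (s : R) := f (a + h *: 'e_j + s *: 'e_i) - f (a + s *: 'e_i).
have dphi (s : R) : 0 <= s <= 1 -> is_derive (0 + (s * h) *: (1 : R^o)) (1 : R^o) (phi : R^o -> R)
     ('D_('e_i) f (a + h *: 'e_j + (s * h) *: 'e_i) - 'D_('e_i) f (a + (s * h) *: 'e_i)).
  move=> s01; rewrite add0r [_ *: 1]mulr1.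
  have /is_derive_line d1 := df _ (near_ij _ s01).
  have /is_derive_line d2 := df _ (near_i _ s01).
  exact: (is_deriveB d1 d2).
have [s s01] := @mean_value_line R R^o phi 0 1 h (fun s s01 => @ex_derive _ _ _ _ _ _ _ (dphi s s01)).
rewrite (@derive_val _ _ _ _ _ _ _ (dphi s s01)) add0r [h *: 1]mulr1 => E.
have [t t01 E'] := @mean_value_line R _ ('D_('e_i) f) (a + (s * h) *: 'e_i) 'e_j h
   (fun t t01 => ddf _ (aU _ (near_a _ _ s01 t01))).
exists (a + (s * h) *: 'e_i + (t * h) *: 'e_j); split; first exact: near_a.
rewrite -E' (addrAC a ((s * h) *: 'e_i)) -E /phi !scale0r !addr0.
rewrite (addrAC a (h *: 'e_i)); ring.
Qed.

(** The second difference of [mixed_difference] is symmetric in [i] and [j],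
    so both mixed derivatives have common values at points arbitrarily close
    to [a]; continuity concludes. *)
Lemma derive_sym (f : 'rV[R]_n -> R) (U : set 'rV[R]_n) (a : 'rV[R]_n) (i j : 'I_n) :
  open U -> U a -> Ck_on 2 U f ->
  'D_('e_j) ('D_('e_i) f) a = 'D_('e_i) ('D_('e_j) f) a.
Proof.
move=> oU Ua F.
have [_ Fi] := F.
have cc (k l : 'I_n) : {for a, continuous ('D_('e_k) ('D_('e_l) f))}.
  by have [_ [_ /(_ k)[_ [C _]]]] := Fi l; exact: C.
apply/eqP; rewrite -subr_eq0 -normr_eq0 eq_le normr_ge0 andbT.
apply/ler_addgt0Pr => e e0; rewrite add0r.
have e20 : 0 < e / 2 by rewrite divr_gt0.
have C (k l : 'I_n) : \forall y \near a,
    `|'D_('e_k) ('D_('e_l) f) a - 'D_('e_k) ('D_('e_l) f) y| <= e / 2.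
  by move/cvgrPdist_le: (cc k l); exact.
have N := near_and (open_near oU Ua) (near_and (C j i) (C i j)).
have [r r0 rP] := (near_ballP _ _).1 N.
have [h [h0 hr]] : exists h : R, 0 < h /\ h + h < r.
  by exists (r / 4); split; [rewrite divr_gt0 | lra].
have hU y : `|y - a| <= h + h -> U y by move=> /le_lt_trans/(_ hr)/rP[].
have D (k l : 'I_n) y : U y -> derivable ('D_('e_k) f) y 'e_l.
  by have [_ [_ /(_ l)[H _]]] := Fi k; exact: H.
have D1 (k : 'I_n) y : U y -> derivable f y 'e_k by have [H _] := Fi k; exact: H.
have [x [xa Ex]] := mixed_difference h0 hU (D1 i) (D i j).
have [y [ya Ey]] := mixed_difference h0 hU (D1 j) (D j i).
have E : 'D_('e_j) ('D_('e_i) f) x = 'D_('e_i) ('D_('e_j) f) y.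
  apply: (mulfI (lt0r_neq0 h0)); apply: (mulfI (lt0r_neq0 h0)).
  have Es : a + h *: 'e_i + h *: 'e_j = a + h *: 'e_j + h *: 'e_i by exact: addrAC.
  by refine (etrans (esym Ex) (etrans _ Ey)); rewrite Es; congr (_ + _); exact: addrAC.
have [_ [x1 _]] := rP _ (le_lt_trans xa hr).
have [_ [_ y1]] := rP _ (le_lt_trans ya hr).
exact: dist_le_of_common E x1 y1.
Qed.

End Schwarz.

(** * Matrix-valued functions *)

Section CkMatrix.
Variables (R : realType) (n : nat) (U : set 'rV[R]_n).
Hypothesis oU : open U.

Lemma Ck_on_mulmx k a b c (A : 'rV[R]_n -> 'M[R]_(a, b)) (B : 'rV[R]_n -> 'M[R]_(b, c)) :
  Ck_on k U A -> Ck_on k U B -> Ck_on k U (fun x => A x *m B x).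
Proof.
move=> /(Ck_on_mx _ _ oU) HA /(Ck_on_mx _ _ oU) HB; apply/Ck_on_mx => // i j.
have H l : Ck_on k U (fun x => A x i l * B x l j) by apply: Ck_onM.
by apply: Ck_on_eq (Ck_on_sum oU H) => // x _; rewrite mxE.
Qed.

Lemma Ck_on_scalemx k a b (c : 'rV[R]_n -> R) (A : 'rV[R]_n -> 'M[R]_(a, b)) :
  Ck_on k U c -> Ck_on k U A -> Ck_on k U (fun x => c x *: A x).
Proof.
move=> Hc /(Ck_on_mx _ _ oU) HA; apply/Ck_on_mx => // i j.
have H : Ck_on k U (fun x => c x * A x i j) by apply: Ck_onM.
by apply: Ck_on_eq H => // x _; rewrite mxE.
Qed.

Lemma Ck_on_trmx k a b (A : 'rV[R]_n -> 'M[R]_(a, b)) :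
  Ck_on k U A -> Ck_on k U (fun x => (A x)^T).
Proof.
move=> /(Ck_on_mx _ _ oU) HA; apply/Ck_on_mx => // i j.
by apply: Ck_on_eq (HA j i) => // x _; rewrite mxE.
Qed.

(** The determinant is a polynomial in the entries; the sum over permutations
    is reached by an induction on an arbitrary list of them. *)
Lemma Ck_on_det k a (A : 'rV[R]_n -> 'M[R]_a) :
  Ck_on k U A -> Ck_on k U (fun x => \det (A x)).
Proof.
move=> /(Ck_on_mx _ _ oU) HA.
have H (s : {perm 'I_a}) : Ck_on k U (fun x => (-1) ^+ s * \prod_i A x i (s i)).
  by apply: Ck_onM => //; [exact: Ck_on_cst | apply: Ck_on_prod].
have Hs (r : seq {perm 'I_a}) : Ck_on k U (fun x => \sum_(s <- r) (-1) ^+ s * \prod_i A x i (s i)).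
  elim: r => [|s r IH].
    by apply: Ck_on_eq (Ck_on_cst oU k (0 : R)) => // x _; rewrite big_nil.
  by apply: Ck_on_eq (Ck_onD oU (H s) IH) => // x _; rewrite big_cons.
exact: Hs.
Qed.

(** Cramer's rule. *)
Lemma Ck_on_invmx k a (A : 'rV[R]_n -> 'M[R]_a) :
  (forall x, U x -> A x \in unitmx) -> Ck_on k U A -> Ck_on k U (fun x => invmx (A x)).
Proof.
move=> uA HA.
have HdV : Ck_on k U (fun x => (\det (A x))^-1).
  apply: Ck_onV => // [x Ux|]; last exact: Ck_on_det.
  by rewrite -unitfE -unitmxE uA.
have Hadj : Ck_on k U (fun x => \adj (A x)).
  apply/Ck_on_mx => // i j.
  have Hm : Ck_on k U (fun x => row' j (col' i (A x))).
    apply/Ck_on_mx => // s t; move/(Ck_on_mx _ _ oU): HA => /(_ (lift j s) (lift i t)).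
    by apply: Ck_on_eq => // x _; rewrite !mxE.
  have Hc := Ck_onM oU (Ck_on_cst oU k ((-1) ^+ (j + i) : R)) (Ck_on_det Hm).
  by apply: Ck_on_eq Hc => // x _; rewrite mxE /cofactor.
apply: Ck_on_eq (Ck_on_scalemx HdV Hadj) => // x Ux.
by rewrite /invmx uA.
Qed.

End CkMatrix.

Section MatrixDerivative.
Variables (R : realType) (V : normedModType R) (x v : V).

Lemma is_derive_mx a b (A : V -> 'M[R]_(a, b)) (dA : 'M[R]_(a, b)) :
  (forall i j, is_derive x v (fun y => A y i j) (dA i j)) -> is_derive x v A dA.
Proof.
move=> H; have D : derivable A x v by apply/derivable_mxP => i j; have [] := H i j.
apply: DeriveDef => //; rewrite derive_mx //; apply/matrixP => i j; rewrite mxE.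
by have [_ ->] := H i j.
Qed.

Lemma is_derive_entry a b (A : V -> 'M[R]_(a, b)) (dA : 'M[R]_(a, b)) i j :
  is_derive x v A dA -> is_derive x v (fun y => A y i j) (dA i j).
Proof.
move=> [D E]; apply: DeriveDef; first by have /derivable_mxP := D; exact.
by rewrite -E derive_mx // mxE.
Qed.

Lemma is_derive_sum_fun (W : normedModType R) m (f : 'I_m -> V -> W) (df : 'I_m -> W) :
  (forall i, is_derive x v (f i) (df i)) ->
  is_derive x v (fun y => \sum_i f i y) (\sum_i df i).
Proof.
move=> H; have -> : (fun y => \sum_i f i y) = \sum_i f i by apply/funext => y; rewrite fct_sumE.
exact: is_derive_sum.
Qed.

Lemma is_derive_mulmx a b c (A : V -> 'M[R]_(a, b)) (B : V -> 'M[R]_(b, c)) dA dB :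
  is_derive x v A dA -> is_derive x v B dB ->
  is_derive x v (fun y => A y *m B y) (dA *m B x + A x *m dB).
Proof.
move=> HA HB; apply: is_derive_mx => i j.
have -> : (fun y => (A y *m B y) i j) = fun y => \sum_l A y i l * B y l j.
  by apply/funext => y; rewrite mxE.
have -> : (dA *m B x + A x *m dB) i j =
    \sum_l (A x i l * dB l j + B x l j * dA i l).
  rewrite !mxE -big_split /=; apply: eq_bigr => l _.
  by rewrite addrC [dA i l * _]mulrC.
apply: is_derive_sum_fun => l.
exact: (is_deriveM (is_derive_entry i l HA) (is_derive_entry l j HB)).
Qed.

Lemma is_derive_trmx a b (A : V -> 'M[R]_(a, b)) dA :
  is_derive x v A dA -> is_derive x v (fun y => (A y)^T) dA^T.
Proof.
move=> HA; apply: is_derive_mx => i j; rewrite mxE.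
have -> : (fun y => (A y)^T i j) = fun y => A y j i by apply/funext => y; rewrite mxE.
exact: is_derive_entry.
Qed.

Lemma is_derive_scalemx a b (c : V -> R) (A : V -> 'M[R]_(a, b)) dc dA :
  is_derive x v c dc -> is_derive x v A dA ->
  is_derive x v (fun y => c y *: A y) (dc *: A x + c x *: dA).
Proof.
move=> Hc HA; apply: is_derive_mx => i j; rewrite !mxE.
have -> : (fun y => (c y *: A y) i j) = fun y => c y * A y i j.
  by apply/funext => y; rewrite mxE.
rewrite addrC [dc * _]mulrC.
exact: (is_deriveM Hc (is_derive_entry i j HA)).
Qed.

End MatrixDerivative.

(** * Ordinary differential equations *)

Section MeanValueInequality.
Variables (R : realType) (m : nat).
Implicit Types F dF : R -> 'rV[R]_m.

Lemma is_derive_continuous (V : normedModType R) (F : R -> V) (t : R) (dF : V) :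
  is_derive t 1 F dF -> {for t, continuous F}.
Proof. by move=> [D _]; apply: differentiable_continuous; apply/derivable1_diffP. Qed.

(** Coordinatewise application of the mean value theorem; this suffices since
    the norm is the maximum norm. *)
Lemma mean_value_le F dF (a b C : R) : a <= b ->
  (forall t : R, a <= t <= b -> is_derive t 1 F (dF t)) ->
  (forall t : R, a <= t <= b -> `|dF t| <= C) ->
  `|F b - F a| <= C * (b - a).
Proof.
move=> ab DF HC.
have C0 : 0 <= C by apply: le_trans (HC a _); rewrite ?normr_ge0 ?lexx.
apply/rV_norm_le => [|j]; first by rewrite mulr_ge0 ?subr_ge0.
have D (t : R) : a <= t <= b -> is_derive t 1 (fun t => F t 0 j) (dF t 0 j).
  by move=> tab; apply: is_derive_entry; exact: DF.
have D' (t : R) : t \in `]a, b[ -> is_derive t 1 (fun t => F t 0 j) (dF t 0 j).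
  by rewrite in_itv /= => /andP[at_ tb]; apply: D; rewrite !ltW.
have cF : {within `[a, b], continuous (fun t => F t 0 j)}.
  apply: derivable_within_continuous => t; rewrite in_itv /= => tab.
  by have [] := D _ tab.
have [c] := MVT_segment ab D' cF.
rewrite in_itv /= => cab; rewrite !mxE => ->.
rewrite normrM (ger0_norm (_ : 0 <= b - a)) ?subr_ge0 //.
by rewrite ler_wpM2r ?subr_ge0 //; apply: le_trans (coord_norm _ _) (HC _ cab).
Qed.

Lemma mean_value_le0 F dF (t C : R) :
  (forall s : R, `|s| <= `|t| -> is_derive s 1 F (dF s)) ->
  (forall s : R, `|s| <= `|t| -> `|dF s| <= C) ->
  `|F t - F 0| <= C * `|t|.
Proof.
move=> DF HC; have [t0|t0] := leP 0 t.
  have B (s : R) : 0 <= s <= t -> `|s| <= `|t| by move=> /andP[s0 st]; rewrite !ger0_norm.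
  rewrite (ger0_norm t0) -[X in C * X]subr0; apply: (@mean_value_le F dF) => // s /B; [exact: DF | exact: HC].
have B (s : R) : t <= s <= 0 -> `|s| <= `|t|.
  by move=> /andP[ts s0]; rewrite (ler0_norm s0) (ltr0_norm t0) lerN2.
rewrite (ltr0_norm t0) distrC -[- t]sub0r; apply: (@mean_value_le F dF); first exact: ltW.
  by move=> s /B; exact: DF.
by move=> s /B; exact: HC.
Qed.

(** On an interval of length one and with a Lipschitz constant one half, no
    exponential is needed: at a maximum of the norm of [F] the mean value
    inequality reads [max <= max / 2 + e]. *)
Lemma small_gronwall F dF (e : R) :
  (forall t : R, 0 <= t <= 1 -> is_derive t 1 F (dF t)) -> F 0 = 0 ->
  (forall t : R, 0 <= t <= 1 -> `|dF t| <= 2^-1 * `|F t| + e) ->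
  forall t : R, 0 <= t <= 1 -> `|F t| <= 2 * e.
Proof.
move=> DF F0 HF.
have cF : {within `[0, 1], continuous (fun t => `|F t|)}.
  apply: continuous_in_subspaceT => t; rewrite inE /= in_itv /= => t01.
  apply: (@continuous_comp _ _ _ F (fun v => `|v|)); last exact: norm_continuous.
  exact: is_derive_continuous (DF _ t01).
have [c] := EVT_max ler01 cF; rewrite in_itv /= => /andP[c0 c1] cmax.
have cm (t : R) : 0 <= t <= 1 -> `|F t| <= `|F c|.
  by move=> t01; apply: cmax; rewrite in_itv.
have : `|F c - F 0| <= (2^-1 * `|F c| + e) * (c - 0).
  have sub (t : R) : 0 <= t <= c -> 0 <= t <= 1.
    by move=> /andP[-> /= tc]; exact: le_trans c1.
  apply: (@mean_value_le F dF) => // t /sub t01; first exact: DF.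
  by apply: le_trans (HF _ t01) _; rewrite lerD2r ler_wpM2l ?invr_ge0 // cm.
have E0 : 0 <= 2^-1 * `|F c| + e.
  apply: le_trans (normr_ge0 (dF c)) (HF c _); exact/andP.
rewrite F0 !subr0 => le1.
have le2 : (2^-1 * `|F c| + e) * c <= 2^-1 * `|F c| + e by rewrite ler_piMr.
have le3 := le_trans le1 le2.
move=> t t01; apply: le_trans (cm _ t01) _; lra.
Qed.

End MeanValueInequality.

Section ContinuityByEstimate.
Variables (R : realType).

Lemma continuous_normP (T : topologicalType) (W : normedModType R) (f : T -> W) (x : T) :
  {for x, continuous f} <->
  (forall e : R, 0 < e -> \forall y \near x, `|f x - f y| <= e).
Proof. by split => [/cvgrPdist_le|H]; [exact|apply/cvgrPdist_le]. Qed.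

Lemma continuous_ball (V W : normedModType R) (f : V -> W) (x : V) :
  (forall e : R, 0 < e -> exists2 r : R, 0 < r &
     forall y, `|y - x| < r -> `|f x - f y| <= e) -> {for x, continuous f}.
Proof. by move=> H; apply/continuous_normP => e e0; apply/near_ballP; exact: H. Qed.

Lemma near_norm_ball (V : normedModType R) (a t : V) (T : R) :
  `|t - a| < T -> \forall s \near t, `|s - a| < T.
Proof.
move=> tT; apply/near_ballP; exists (T - `|t - a|); first by rewrite subr_gt0.
move=> s st; rewrite -(subrKA t); apply: le_lt_trans (ler_normD _ _) _.
by rewrite -ltrBrDr.
Qed.

Lemma open_norm_ball (V : normedModType R) (a : V) (T : R) :
  open [set s : V | `|s - a| < T].
Proof. by rewrite openE => t /= tT; exact: near_norm_ball. Qed.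

End ContinuityByEstimate.

Section Primitive.
Variable R : realType.

(** The integral is taken from [- T] so that the fundamental theorem applies
    on both sides of the origin; its value at the origin is subtracted
    afterwards. *)
Lemma primitive_exists (f : R -> R) (T : R) : 0 < T -> continuous f ->
  exists F : R -> R, F 0 = 0 /\ forall t : R, `|t| < T -> is_derive t 1 F (f t).
Proof.
move=> T0 cf.
pose G (x : R) := (\int[lebesgue_measure]_(t in `[(- T)%R, x]) (f t))%R.
have DG (t : R) : `|t| < T -> is_derive t 1 G (f t).
  move=> /ltr_normlP[t1 t2].
  have fi : lebesgue_measure.-integrable `[- T, T] (EFin \o f).
    apply: continuous_compact_integrable; first exact: segment_compact.
    by apply: continuous_subspaceT => x; exact: cf.
  have [] := @continuous_FTC1_closed R f (- T) t T t2 fi _ (cf t).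
    by rewrite ltrNl.
  move=> dG EG; exact: (DeriveDef dG (etrans (esym (derive1E _ _)) EG)).
exists (fun t => G t - G 0); split; first by rewrite subrr.
move=> t tT; have := is_deriveB (DG t tT) (is_derive_cst (G 0) t 1).
by move/is_derive_eq; apply; rewrite subr0.
Qed.

Lemma primitive_rV_exists m (f : R -> 'rV[R]_m) (T : R) : 0 < T -> continuous f ->
  exists F : R -> 'rV[R]_m, F 0 = 0 /\ forall t : R, `|t| < T -> is_derive t 1 F (f t).
Proof.
move=> T0 cf.
have H (j : 'I_m) : exists F : R -> R, F 0 = 0 /\
    forall t : R, `|t| < T -> is_derive t 1 F (f t 0 j).
  apply: (primitive_exists (f := fun t => f t 0 j)) => // t.
  by apply: continuous_entry; exact: cf.
have [F HF] := choice H.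
exists (fun t => \row_j F j t); split.
  by apply/rowP => j; rewrite !mxE; have [] := HF j.
move=> t tT; apply: is_derive_mx => i j; rewrite ord1.
have -> : (fun y => (\row_j0 F j0 y) 0 j) = F j by apply/funext => y; rewrite mxE.
by have [_] := HF j; exact.
Qed.

End Primitive.

Section Geometric.
Variable R : realType.

(** The intervals of centre [u j] and radius [2 C / 2^j] are nested; the
    supremum of their left ends lies in all of them. This gives a limit
    together with its rate of convergence. *)
Lemma geometric_limit (u : nat -> R) (C : R) :
  (forall j, `|u j.+1 - u j| <= C / 2 ^+ j) ->
  exists l, forall j, `|l - u j| <= 2 * C / 2 ^+ j.
Proof.
move=> Hu.
have C0 : 0 <= C by have := Hu 0%N; rewrite expr0 divr1; apply: le_trans.
pose q j := 2 * C / 2 ^+ j.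
have qS j : q j = C / 2 ^+ j + q j.+1.
  by rewrite /q exprS invfM; field; rewrite expf_neq0.
have q0 j : 0 <= q j by rewrite /q divr_ge0 ?mulr_ge0 ?exprn_ge0.
have up i j : (i <= j)%N -> u j - q j >= u i - q i /\ u j + q j <= u i + q i.
  move=> /subnK <-; elim: (j - i)%N => [|d [IH1 IH2]]; first by rewrite add0n !lexx.
  have /ler_normlP[h1 h2] := Hu (d + i)%N.
  have E := qS (d + i)%N; rewrite addSn; split.
    by apply: le_trans IH1 _; rewrite E; lra.
  by apply: le_trans _ IH2; rewrite E; lra.
have ub i j : u i - q i <= u j + q j.
  have [ij|/ltnW ji] := leqP i j.
    by have [h _] := up _ _ ij; apply: le_trans h _; have := q0 j; lra.
  by have [_ h] := up _ _ ji; apply: le_trans _ h; have := q0 i; lra.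
pose E := range (fun i => u i - q i).
have neE : E !=set0 by exists (u 0%N - q 0%N); exists 0%N.
have ubE j : ubound E (u j + q j) by move=> _ [i _ <-]; exact: ub.
exists (sup E) => j; rewrite -/(q j); apply/ler_normlP; split.
  have : u j - q j <= sup E by apply: ub_le_sup; [exists (u j + q j); exact: ubE | exists j].
  lra.
have : sup E <= u j + q j by exact: ge_sup.
lra.
Qed.

Lemma geometric_limit_rV m (u : nat -> 'rV[R]_m) (C : R) :
  (forall j, `|u j.+1 - u j| <= C / 2 ^+ j) ->
  exists l, forall j, `|l - u j| <= 2 * C / 2 ^+ j.
Proof.
move=> Hu.
have C0 : 0 <= C by have := Hu 0%N; rewrite expr0 divr1; apply: le_trans.
have H (i : 'I_m) : exists l, forall j, `|l - u j 0 i| <= 2 * C / 2 ^+ j.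
  apply: geometric_limit => j; apply: le_trans (Hu j).
  by have := coord_norm (u j.+1 - u j) i; rewrite !mxE.
have [l Hl] := choice H.
exists (\row_i l i) => j; apply/rV_norm_le => [|i]; last by rewrite !mxE.
by rewrite divr_ge0 ?mulr_ge0 ?exprn_ge0.
Qed.

Lemma geometric_small (C e : R) : 0 < e -> exists j, C / 2 ^+ j <= e.
Proof.
move=> e0.
have [j Hj] : exists j : nat, `|C| / e <= j%:R.
  exists (Num.truncn (`|C| / e)).+1; apply/ltW; apply: Num.Theory.truncnS_gt.
exists j; rewrite ler_pdivrMr ?exprn_gt0 // mulrC -ler_pdivrMr //.
have c1 : C / e <= `|C| / e by rewrite ler_pM2r ?invr_gt0 // ler_norm.
apply: le_trans c1 (le_trans Hj _).
have : (j <= 2 ^ j)%N by exact/ltnW/ltn_expl.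
by rewrite -(ler_nat R) natrX.
Qed.

End Geometric.

Section Picard.
Variables (R : realType) (m : nat) (Y : 'rV[R]_m -> 'rV[R]_m) (Lam T : R) (x0 : 'rV[R]_m).
Hypotheses (Lam0 : 0 <= Lam) (Ylip : forall x y, `|Y x - Y y| <= Lam * `|x - y|)
  (T0 : 0 < T) (TLam : T * Lam <= 2^-1).

Lemma lipschitz_continuous : continuous Y.
Proof.
move=> x; apply: continuous_ball => e e0.
have L0 : 0 < `|Lam| + 1 by rewrite ltr_wpDl.
exists (e / (`|Lam| + 1)); first by rewrite divr_gt0.
move=> y; rewrite ltr_pdivlMr // => /ltW h; apply: le_trans (Ylip x y) _; rewrite distrC.
apply: le_trans h; rewrite mulrC ler_wpM2l //.
by apply: le_trans (ler_norm _) _; rewrite lerDl.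
Qed.

(** Functions on the interval of radius [T] are represented by functions on
    the whole line that are constant outside of it; precomposing with this
    retraction keeps the iteration among continuous functions on the line. *)
Let clamp (t : R) : R := Num.max (- T) (Num.min T t).

Lemma clamp_le t : `|clamp t| <= T.
Proof.
rewrite ler_norml /clamp le_max lexx /= ge_max ge_min lexx /= andbT.
by rewrite (le_trans _ (ltW T0)) // oppr_le0 ltW.
Qed.

Lemma clamp_id t : `|t| <= T -> clamp t = t.
Proof.
rewrite ler_norml => /andP[t1 t2]; rewrite /clamp.
by rewrite (min_idPr t2) (max_idPr t1).
Qed.

Lemma clamp_continuous : continuous clamp.
Proof.
move=> t; apply: (@continuous_max _ _ (cst (- T)) (fun t => Num.min T t)); first exact: cst_continuous.
apply: (@continuous_min _ _ (cst T) id); first exact: cst_continuous.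
exact: cvg_id.
Qed.

(** The primitive is needed on an interval larger than that of radius [T], so
    that it is continuous up to the ends of the latter. *)
Lemma picard_step (u : R -> 'rV[R]_m) : continuous u ->
  exists u' : R -> 'rV[R]_m, continuous u' /\ exists F : R -> 'rV[R]_m,
    [/\ F 0 = x0, u' = F \o clamp &
        forall t : R, `|t| < 2 * T -> is_derive t 1 F (Y (u t))].
Proof.
move=> cu.
have cYu : continuous (Y \o u).
  by move=> t; apply: continuous_comp; [exact: cu | exact: lipschitz_continuous].
have T20 : 0 < 2 * T by rewrite mulr_gt0.
have [F [F0 HF]] := primitive_rV_exists T20 cYu.
pose G t := x0 + F t.
have HG (t : R) : `|t| < 2 * T -> is_derive t 1 G (Y (u t)).
  move=> /HF HFt; have := is_deriveD (is_derive_cst x0 t 1) HFt.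
  by move/is_derive_eq; apply; rewrite add0r.
exists (G \o clamp); split; last by exists G; split => //; rewrite /G F0 addr0.
move=> t; apply: continuous_comp; first exact: clamp_continuous.
apply: is_derive_continuous (HG _ _); apply: le_lt_trans (clamp_le t) _.
by rewrite mulr_natl mulr2n ltrDl.
Qed.

(** The Picard iteration halves uniform distances, because [T Lam <= 1/2]; so
    it converges geometrically, and the limit is a continuous fixed point,
    hence a solution. *)
Lemma picard : exists u : R -> 'rV[R]_m, u 0 = x0 /\
  forall t : R, `|t| < T -> is_derive t 1 u (Y (u t)).
Proof.
pose cfun := {u : R -> 'rV[R]_m | continuous u}.
have HS0 (u : cfun) : exists v : cfun, exists F : R -> 'rV[R]_m,
    [/\ F 0 = x0, sval v = F \o clamp &
        forall t : R, `|t| < 2 * T -> is_derive t 1 F (Y (sval u t))].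
  case: u => u cu; have [u' [cu' HF]] := picard_step cu.
  by exists (exist _ u' cu').
have [S HS] := choice HS0.
have lt2 t : `|clamp t| < 2 * T.
  by apply: le_lt_trans (clamp_le t) _; rewrite mulr_natl mulr2n ltrDl.
have contr (u v : cfun) (K : R) : (forall t, `|sval u t - sval v t| <= K) ->
    forall t, `|sval (S u) t - sval (S v) t| <= K / 2.
  move=> HK t; have [F [F0 -> DF]] := HS u; have [G [G0 -> DG]] := HS v.
  rewrite /=; set s := clamp t.
  have K0 : 0 <= K by apply: le_trans (HK 0).
  have -> : F s - G s = (F - G) s - (F - G) 0.
    by rewrite -[(F - G) s]/(F s - G s) -[(F - G) 0]/(F 0 - G 0) F0 G0 subrr subr0.
  have lt' (r : R) : `|r| <= `|s| -> `|r| < 2 * T by move=> /le_lt_trans; apply; exact: lt2.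
  apply: (@le_trans _ _ (Lam * K * `|s|)).
    apply: (@mean_value_le0 _ _ (F - G) (fun r => Y (sval u r) - Y (sval v r))) => r rs.
      by apply: is_deriveB; [exact: DF (lt' _ rs) | exact: DG (lt' _ rs)].
    apply: le_trans (Ylip _ _) _.
    by rewrite ler_wpM2l.
  have L1 : Lam * `|s| <= 2^-1.
    by apply: le_trans TLam; rewrite mulrC ler_wpM2r ?clamp_le.
  by rewrite mulrAC mulrC; apply: ler_wpM2l.
pose u0 : cfun := exist _ (cst x0) (@cst_continuous _ _ x0).
pose u j := iter j S u0.
pose C := T * `|Y x0|.
have step j : forall t, `|sval (u j.+1) t - sval (u j) t| <= C / 2 ^+ j.
  elim: j => [|j IH] t.
    rewrite expr0 divr1 /u /=; have [F [F0 -> DF]] := HS u0.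
    rewrite -[X in _ - X]F0 /=; set s := clamp t.
    apply: (@le_trans _ _ (`|Y x0| * `|s|)).
      apply: (@mean_value_le0 _ _ F (fun r => Y x0)) => // r rs.
      by apply: DF; apply: le_lt_trans rs (lt2 _).
    by rewrite /C mulrC ler_wpM2r // clamp_le.
  by rewrite exprSr invfM mulrA; exact: contr.
have lim t := geometric_limit_rV (u := fun j => sval (u j) t) (fun j => step j t).
have [w Hw] := choice lim.
have cw : continuous w.
  move=> t; apply/continuous_normP => e e0.
  have e30 : 0 < e / 3 by rewrite divr_gt0.
  have [j Hj] := geometric_small (2 * C) e30.
  have cu : {for t, continuous (sval (u j))} by exact: (svalP (u j) t).
  have : \forall r \near t, `|sval (u j) t - sval (u j) r| <= e / 3.
    by move/continuous_normP: cu; exact.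
  apply: filterS => r H.
  have h1 := le_trans (Hw t j) Hj; have h2 := le_trans (Hw r j) Hj; rewrite distrC in h2.
  have -> : w t - w r = (w t - sval (u j) t) + (sval (u j) t - sval (u j) r) + (sval (u j) r - w r).
    by rewrite !subrKA.
  apply: le_trans (ler_normD _ _) _; apply: le_trans (lerD (ler_normD _ _) (lexx _)) _.
  lra.
(* The limit is a fixed point: both sides are within any [e] of [u j.+1]. *)
have Sw : forall t, sval (S (exist _ w cw)) t = w t.
  move=> t; apply/eqP; rewrite -subr_eq0 -normr_le0; apply/ler_addgt0Pr => e e0; rewrite add0r.
  have e20 : 0 < e / 2 by rewrite divr_gt0.
  have [j Hj] := geometric_small (2 * C) e20.
  have h1 : `|sval (S (exist _ w cw)) t - sval (u j.+1) t| <= 2 * C / 2 ^+ j / 2.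
    by apply: contr => r /=; exact: Hw.
  have h2 := Hw t j.+1; rewrite distrC exprSr invfM mulrA in h2.
  rewrite -(subrKA (sval (u j.+1) t)); apply: le_trans (ler_normD _ _) _.
  lra.
have [F [F0 EF DF]] := HS (exist _ w cw).
have wF t : w t = F (clamp t) by rewrite -Sw EF.
exists w; split; first by rewrite wF clamp_id ?normr0 ?ltW.
move=> t tT; have tT2 : `|t| < 2 * T.
  by apply: lt_trans tT _; rewrite mulr_natl mulr2n ltrDl.
apply: near_eq_is_derive (DF t tT2).
have : \forall s \near t, `|s - 0| < T by apply: near_norm_ball; rewrite subr0.
by apply: filterS => s; rewrite subr0 => sT; rewrite wF clamp_id // ltW.
Qed.

End Picard.

Section LocalPicard.
Variables (R : realType) (m : nat).

Lemma clamp_lipschitz (a b x y : R) :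
  `|Num.max a (Num.min b x) - Num.max a (Num.min b y)| <= `|x - y|.
Proof.
have n1 := ler_norm (x - y); have n2 := ler_norm (- (x - y)); rewrite normrN in n2.
rewrite /Num.max /Num.min; apply/ler_normlP; split;
  case: (ltP b x) => ?; case: (ltP b y) => ?; repeat case: ltP => ?; lra.
Qed.

(** Retraction onto a closed ball of the maximum norm; composing a vector
    field with it turns a local Lipschitz bound into a global one. *)
Let box (x0 : 'rV[R]_m) (r : R) (x : 'rV[R]_m) : 'rV[R]_m :=
  \row_j Num.max (x0 0 j - r) (Num.min (x0 0 j + r) (x 0 j)).

Lemma box_id x0 r x : `|x - x0| <= r -> box x0 r x = x.
Proof.
move=> xr; apply/rowP => j; rewrite mxE.
have /ler_normlP[h1 h2] := le_trans (coord_norm (x - x0) j) xr.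
rewrite !mxE in h1 h2.
have e1 : x 0 j <= x0 0 j + r by lra.
have e2 : x0 0 j - r <= x 0 j by lra.
by rewrite (min_idPr e1) (max_idPr e2).
Qed.

Lemma box_in x0 r x : 0 <= r -> `|box x0 r x - x0| <= r.
Proof.
move=> r0; apply/rV_norm_le => // j; rewrite !mxE.
rewrite /Num.max /Num.min.
apply/ler_normlP; split; case: (ltP (x0 0 j + r) (x 0 j)) => ?; case: ltP => ?; lra.
Qed.

Lemma box_lip x0 r x y : `|box x0 r x - box x0 r y| <= `|x - y|.
Proof.
apply/rV_norm_le => // j; rewrite !mxE; apply: le_trans (clamp_lipschitz _ _ _ _) _.
by have := coord_norm (x - y) j; rewrite !mxE.
Qed.

(** The solution for the field composed with the retraction onto the ball
    moves with speed at most [B], so it stays in the ball up to time [T] and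
    solves the original equation. *)
Lemma picard_local (Y : 'rV[R]_m -> 'rV[R]_m) (x0 : 'rV[R]_m) (r Lam B T : R) :
  0 <= r -> 0 <= Lam ->
  (forall x y, `|x - x0| <= r -> `|y - x0| <= r -> `|Y x - Y y| <= Lam * `|x - y|) ->
  (forall x, `|x - x0| <= r -> `|Y x| <= B) ->
  0 < T -> T * Lam <= 2^-1 -> T * B <= r ->
  exists u : R -> 'rV[R]_m, u 0 = x0 /\
  forall t : R, `|t| < T -> `|u t - x0| <= B * `|t| /\ is_derive t 1 u (Y (u t)).
Proof.
move=> r0 L0 Yl YB T0 TL TB.
have Yl' x y : `|(Y \o box x0 r) x - (Y \o box x0 r) y| <= Lam * `|x - y|.
  apply: le_trans (Yl _ _ (box_in _ _ r0) (box_in _ _ r0)) _.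
  by rewrite ler_wpM2l // box_lip.
have [u [u0 Du]] := picard x0 L0 Yl' T0 TL.
exists u; split=> // t tT.
have ut s : `|s| < T -> `|u s - x0| <= B * `|s|.
  move=> sT; rewrite -u0; apply: (@mean_value_le0 _ _ u (fun s => (Y \o box x0 r) (u s))).
    by move=> q /le_lt_trans/(_ sT); exact: Du.
  by move=> q _; apply: YB; exact: box_in.
have B0 : 0 <= B by apply: le_trans (YB x0 _) => //; rewrite subrr normr0.
split; first exact: ut.
have := Du t tT; rewrite /= box_id //.
apply: le_trans (ut _ tT) _; apply: le_trans TB.
by rewrite mulrC ler_wpM2r // ltW.
Qed.

End LocalPicard.

Section LocalEstimates.
Variables (R : realType) (n : nat) (U : set 'rV[R]_n).
Hypothesis oU : open U.
Implicit Types (f : 'rV[R]_n -> R).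

Lemma Ck_on_partial k f j : Ck_on k.+1 U f -> Ck_on k U ('D_('e_j) f).
Proof. by case=> _ /(_ j)[]. Qed.

Lemma fin_pos_bound (I : finType) (r : I -> R) :
  (forall i, 0 < r i) -> exists2 e : R, 0 < e & forall i, e <= r i.
Proof.
move=> r0; exists (\big[Num.min/1]_i r i).
  by apply/lt_bigmin; [exact: ltr01 | move=> i _; exact: r0].
by move=> i; exact: bigmin_le_cond.
Qed.

Lemma sum_coord_le (v : 'rV[R]_n) (c : 'I_n -> R) (K : R) :
  (forall j, `|c j| <= K) -> `|\sum_j v 0 j * c j| <= n%:R * K * `|v|.
Proof.
move=> cK; apply: le_trans (ler_norm_sum _ _ _) _.
apply: (@le_trans _ _ (\sum_(j < n) `|v| * K)).
  by apply: ler_sum => j _; rewrite normrM ler_pM // coord_norm.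
rewrite sumr_const card_ord -[X in X <= _]mulr_natr [X in X <= _](_ : _ = n%:R * K * `|v|) //.
by ring.
Qed.

Lemma C1_local_lipschitz f a : Ck_on 1 U f -> U a ->
  exists r K : R, [/\ 0 < r, 0 <= K,
    forall x, `|x - a| < r -> U x /\ `|f x| <= K &
    forall x y, `|x - a| < r -> `|y - a| < r -> `|f y - f x| <= K * `|y - x|].
Proof.
move=> F Ua.
have bnd (g : 'rV[R]_n -> R) : {for a, continuous g} ->
    \forall x \near a, `|g x| <= `|g a| + 1.
  move=> /continuous_normP/(_ 1 ltr01); apply: filterS => x.
  by rewrite -lerBlDl => h; apply: le_trans h; rewrite distrC lerB_dist.
have N := near_and (open_near oU Ua) (near_and (bnd f (Ck_on_continuous F Ua))
   (near_forall (fun j : 'I_n => bnd ('D_('e_j) f) _))).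
have {N}/near_ballP[r r0 rP] := N (fun j => Ck_on_continuous (Ck_on_partial j F) Ua).
pose S := \sum_(j < n) (`|'D_('e_j) f a| + 1).
have S0 : 0 <= S by apply: sumr_ge0 => j _; rewrite addr_ge0.
have SP j : `|'D_('e_j) f a| + 1 <= S.
  rewrite /S (bigD1 j) //= lerDl; apply: sumr_ge0 => i _; by rewrite addr_ge0.
exists r, (n%:R * S + (`|f a| + 1)); split=> //.
- by rewrite addr_ge0 ?mulr_ge0 ?addr_ge0.
- move=> x /rP[Ux [fx _]]; split=> //; apply: le_trans fx _.
  by rewrite lerDr mulr_ge0.
- move=> x y xr yr.
  have [|xi [xiP ->]] := mean_value_box xr yr (f := f).
    by move=> z j /rP[Uz _]; exact: Ck_on_derivable F Uz.
  apply: (@le_trans _ _ (n%:R * S * `|y - x|)).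
    apply: sum_coord_le => j; have [/rP[_ [_ h]] _] := xiP j.
    exact: le_trans (h j) (SP j).
  by rewrite ler_wpM2r // lerDl addr_ge0.
Qed.

(** All the local constants that the flow of a frame requires, with one
    radius and one bound: size, derivative, Lipschitz constant, and a
    quadratic Taylor remainder. *)
Lemma C2_local_estimates f a : Ck_on 2 U f -> U a ->
  exists r K : R, [/\ 0 < r, 0 <= K,
    forall x, `|x - a| < r -> U x /\ `|f x| <= K /\ forall v, `|'D_v f x| <= K * `|v| &
    forall x y, `|x - a| < r -> `|y - a| < r ->
      `|f y - f x| <= K * `|y - x| /\
      `|f y - f x - 'D_(y - x) f x| <= K * (`|y - x| * `|y - x|)].
Proof.
move=> F Ua.
have [r0 [K0 [r0p K0p B0 L0]]] := C1_local_lipschitz (Ck_onW F) Ua.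
have H (j : 'I_n) := C1_local_lipschitz (Ck_on_partial j F) Ua.
have [rj Hr] := choice H; have [Kj HK] := choice Hr.
have [r1 r1p r1P] : exists2 e : R, 0 < e & forall j, e <= rj j.
  by apply: fin_pos_bound => j; have [] := HK j.
pose S := \sum_j Kj j.
have Kj0 j : 0 <= Kj j by have [] := HK j.
have S0 : 0 <= S by apply: sumr_ge0.
have SP j : Kj j <= S by rewrite /S (bigD1 j) //= lerDl; apply: sumr_ge0.
pose r := Num.min r0 r1.
have rr0 x : `|x - a| < r -> `|x - a| < r0 by rewrite lt_min => /andP[].
have rrj j x : `|x - a| < r -> `|x - a| < rj j.
  by rewrite lt_min => /andP[_ /lt_le_trans]; apply.
have df x : U x -> differentiable f x by exact: Ck_on_differentiable F.
have dE x v : U x -> 'D_v f x = \sum_j v 0 j * 'D_('e_j) f x.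
  by move=> Ux; rewrite derive_rV //; exact: df.
exists r, (K0 + n%:R * S); split=> //.
- by rewrite lt_min r0p.
- by rewrite addr_ge0 ?mulr_ge0.
- move=> x xr; have [Ux fx] := B0 _ (rr0 _ xr); split=> //; split.
    by apply: le_trans fx _; rewrite lerDl mulr_ge0.
  move=> v; rewrite dE //; apply: (@le_trans _ _ (n%:R * S * `|v|)).
    apply: sum_coord_le => j; have [_ _ hK _] := HK j; have [_ h] := hK _ (rrj j _ xr).
    exact: le_trans h (SP j).
  by rewrite ler_wpM2r // lerDr.
- move=> x y xr yr; split.
    apply: le_trans (L0 _ _ (rr0 _ xr) (rr0 _ yr)) _.
    by rewrite ler_wpM2r // lerDl mulr_ge0.
  have [Ux _] := B0 _ (rr0 _ xr).
  have [|xi [xiP ->]] := mean_value_box xr yr (f := f).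
    move=> z j /rr0/B0[Uz _]; exact: Ck_on_derivable F Uz.
  rewrite dE // -sumrB.
  have -> : \sum_(j < n) ((y - x) 0 j * 'D_('e_j) f (xi j) - (y - x) 0 j * 'D_('e_j) f x)
    = \sum_(j < n) (y - x) 0 j * ('D_('e_j) f (xi j) - 'D_('e_j) f x).
    by apply: eq_bigr => j _; rewrite mulrBr.
  apply: (@le_trans _ _ (n%:R * (S * `|y - x|) * `|y - x|)).
    apply: sum_coord_le => j; have [xir xix] := xiP j.
    have [_ _ _ hK] := HK j.
    by apply: le_trans (hK _ _ (rrj j _ xr) (rrj j _ xir)) _; apply: ler_pM.
  by rewrite [n%:R * _]mulrA -[X in X <= _]mulrA ler_wpM2r ?mulr_ge0 // lerDr.
Qed.

End LocalEstimates.

(** * Integral manifolds of commuting frames *)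

Section CurveChain.
Variables (R : realType) (V W : normedModType R).

Lemma is_derive_along (F : V -> W) (z : R -> V) (t : R) (v : V) :
  differentiable F (z t) -> is_derive t 1 z v ->
  is_derive t 1 (F \o z) ('D_v F (z t)).
Proof.
move=> dF [dz <-]; have Dz := (derivable1_diffP _ _).1 dz.
have D := differentiable_comp Dz dF.
apply: DeriveDef; first exact: diff_derivable.
by rewrite (deriveE _ D) diff_comp //= (deriveE _ dF) (deriveE (1 : R) Dz).
Qed.

End CurveChain.

Lemma derive0_constant (R : realType) m (F : R -> 'rV[R]_m) :
  (forall t : R, 0 <= t <= 1 -> is_derive t 1 F (0 : 'rV[R]_m)) -> F 1 = F 0.
Proof.
move=> DF; have : `|F 1 - F 0| <= 0 * (1 - 0).
  by apply: (@mean_value_le R m F (fun=> 0)) => // t _; rewrite normr0.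
by rewrite mul0r normr_le0 subr_eq0 => /eqP.
Qed.

Lemma rV_regroup (R : realType) m (A A1 B B1 C E : 'rV[R]_m) :
  A - B1 - (B - B1 + C) = A - A1 - (B - B1) + (A1 - B1 - E) + (E - C).
Proof. by apply/rowP => j; rewrite !mxE; ring. Qed.

Section MatrixBounds.
Variables (R : realType).

Lemma mulmx_row_le k n (x : 'rV[R]_k) (M : 'M[R]_(k, n)) (K : R) :
  0 <= K -> (forall a l, `|M a l| <= K) -> `|x *m M| <= k%:R * K * `|x|.
Proof.
move=> K0 MK; apply/rV_norm_le => [|l]; first by rewrite !mulr_ge0.
by rewrite mxE; apply: sum_coord_le => a; exact: MK.
Qed.

Lemma mulmxr_continuous k n (M : 'M[R]_(k, n)) : continuous (mulmxr M : 'rV[R]_k -> 'rV[R]_n).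
Proof.
move=> x; apply: continuous_mx => i j.
have -> : (fun y : 'rV[R]_k => (mulmxr M y) i j) = fun y => \sum_a y i a * M a j.
  by apply/funext => y; rewrite /= mxE.
apply: continuous_sum_fun => a.
apply: (@continuousM _ _ (fun y : 'rV[R]_k => y i a) (cst (M a j))).
  exact: coord_continuous.
exact: cst_continuous.
Qed.

End MatrixBounds.

Section CommutingFrame.
Variables (R : realType) (n k : nat) (O : set 'rV[R]_n) (Y : 'rV[R]_n -> 'M[R]_(k, n)).
Variables (P : 'M[R]_(n, k)) (p : 'rV[R]_n).
Hypotheses (oO : open O) (Op : O p) (sY : smooth_on O Y).
(* The frame is the rows of [Y]. The hypothesis [Ycomm] says that the
   fields [xi *m Y] and [eta *m Y] commute, for all constant [xi] and
   [eta]. *)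
Hypothesis YP : forall x, O x -> Y x *m P = 1%:M.
Hypothesis Ycomm : forall x, O x -> forall xi eta : 'rV[R]_k,
  xi *m 'D_(eta *m Y x) Y x = eta *m 'D_(xi *m Y x) Y x.

Lemma frame_differentiable x : O x -> differentiable Y x.
Proof. exact: (Ck_on_differentiable_mx oO (sY 1)). Qed.

Lemma frame_estimates : exists r K : R, [/\ 0 < r, 0 <= K,
    forall x, `|x - p| < r -> O x /\ (forall a l, `|Y x a l| <= K) /\
       forall v a l, `|('D_v Y x) a l| <= K * `|v| &
    forall x y, `|x - p| < r -> `|y - p| < r -> forall a l,
      `|(Y y - Y x) a l| <= K * `|y - x| /\
      `|(Y y - Y x - 'D_(y - x) Y x) a l| <= K * (`|y - x| * `|y - x|)].
Proof.
have H (al : 'I_k * 'I_n) := C2_local_estimates oO ((Ck_on_mx _ _ oO).1 (sY 2) al.1 al.2) Op.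
have [rj Hr] := choice H; have [Kj HK] := choice Hr.
have [r1 r1p r1P] : exists2 e : R, 0 < e & forall j, e <= rj j.
  by apply: fin_pos_bound => j; have [] := HK j.
have [r2 r20 r2P] := (near_ballP _ _).1 (open_near oO Op).
pose r := Num.min r1 r2.
have Kj0 j : 0 <= Kj j by have [] := HK j.
pose K := \sum_j Kj j.
have K0 : 0 <= K by apply: sumr_ge0.
have KP j : Kj j <= K by rewrite /K (bigD1 j) //= lerDl; apply: sumr_ge0.
have rO x : `|x - p| < r -> O x by rewrite lt_min => /andP[_]; exact: r2P.
have rrj j x : `|x - p| < r -> `|x - p| < rj j.
  by rewrite lt_min => /andP[h _]; exact: lt_le_trans h (r1P j).
have DE x v a l : O x -> ('D_v Y x) a l = 'D_v (fun y => Y y a l) x.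
  move=> Ox; rewrite derive_mx ?mxE //.
  by apply: diff_derivable; exact: frame_differentiable.
exists r, K; split=> //; first by rewrite lt_min r1p.
- move=> x xr; split; first exact: rO.
  split=> [a l|v a l].
    have [_ _ h _] := HK (a, l); have [_ [h1 _]] := h _ (rrj (a, l) _ xr).
    exact: le_trans h1 (KP _).
  have [_ _ h _] := HK (a, l); have [_ [_ h1]] := h _ (rrj (a, l) _ xr).
  rewrite DE; last exact: rO.
  by apply: le_trans (h1 v) _; rewrite ler_wpM2r.
- move=> x y xr yr a l; have [_ _ _ h] := HK (a, l).
  have [h1 h2] := h _ _ (rrj (a, l) _ xr) (rrj (a, l) _ yr); split.
    by rewrite !mxE; apply: le_trans h1 _; rewrite ler_wpM2r.
  rewrite !mxE DE; last exact: rO.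
  by apply: le_trans h2 _; rewrite ler_wpM2r ?mulr_ge0.
Qed.

Lemma derive_linear_combination x (v w : 'rV[R]_n) (c : R) : O x ->
  'D_(v - c *: w) Y x = 'D_v Y x - c *: 'D_w Y x.
Proof.
move=> /frame_differentiable dY.
by rewrite !(deriveE _ dY) linearB linearZ.
Qed.

Section Flow.
Variables (r K d : R).
Hypotheses (r0 : 0 < r) (K0 : 0 <= K) (d0 : 0 < d).
Hypothesis est : forall x, `|x - p| < r -> O x /\ (forall a l, `|Y x a l| <= K) /\
       forall v a l, `|('D_v Y x) a l| <= K * `|v|.
Hypothesis est2 : forall x y, `|x - p| < r -> `|y - p| < r -> forall a l,
      `|(Y y - Y x) a l| <= K * `|y - x| /\
      `|(Y y - Y x - 'D_(y - x) Y x) a l| <= K * (`|y - x| * `|y - x|).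
(** Bounds the operator norm of [Y] on rows. The first smallness condition
    makes the equation of the flow contracting enough for [small_gronwall],
    the second keeps the flow in the ball. *)
Let N := k%:R * K.
Hypotheses (Nd : N * d <= 4^-1) (Nr : N * d <= r / 4).

Let N0 : 0 <= N. Proof. by rewrite mulr_ge0. Qed.

(** Solutions are constructed up to time 2, so that they are differentiable
    at the end point 1 of the interval that is used. *)
Lemma flow_exists (x : 'rV[R]_k) : `|x| < d ->
  exists z : R -> 'rV[R]_n, z 0 = p /\ forall t : R, 0 <= t <= 1 ->
     `|z t - p| < r /\ is_derive t 1 z (x *m Y (z t)).
Proof.
move=> xd.
have inr' y : `|y - p| <= r / 2 -> `|y - p| < r.
  by move=> /le_lt_trans; apply; rewrite ltr_pdivrMr // ltr_pMr // ltrDl.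
have Nx : N * `|x| <= N * d by rewrite ler_wpM2l // ltW.
have [|||||||z [z0 Hz]] := @picard_local R n (fun y => x *m Y y) p (r / 2) (N * d) (N * d) 2.
- by rewrite divr_ge0 // ltW.
- by rewrite mulr_ge0 // ltW.
- move=> y y' yr y'r; rewrite -mulmxBr.
  apply: (@le_trans _ _ (k%:R * (K * `|y - y'|) * `|x|)).
    apply: mulmx_row_le; first by rewrite mulr_ge0.
    by move=> a l; have [] := est2 (inr' _ y'r) (inr' _ yr) a l.
  by rewrite mulrA mulrAC ler_wpM2r.
- move=> y yr; apply: le_trans (_ : N * `|x| <= _) => //.
  by apply: mulmx_row_le => //; have [_ []] := est (inr' _ yr).
- by [].
- by move: Nd; lra.
- by move: Nr; lra.
exists z; split=> // t /andP[t0 t1].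
have tlt : `|t| < 2 by rewrite ger0_norm //; lra.
have [h1 h2] := Hz t tlt; split=> //.
apply: le_lt_trans h1 _; rewrite ger0_norm //.
apply: (@le_lt_trans _ _ (r / 4)); last by move: r0; lra.
by apply: le_trans Nr; rewrite ler_piMr // mulr_ge0 // ltW.
Qed.

Variable z : 'rV[R]_k -> R -> 'rV[R]_n.
Hypothesis z0 : forall x, `|x| < d -> z x 0 = p.
Hypothesis zr : forall x, `|x| < d -> forall t : R, 0 <= t <= 1 -> `|z x t - p| < r.
Hypothesis dz : forall x, `|x| < d -> forall t : R, 0 <= t <= 1 ->
  is_derive t 1 (z x) (x *m Y (z x t)).

Let in11 : 0 <= (1 : R) <= 1. Proof. by rewrite ler01 lexx. Qed.

(** Along the flow of [x *m Y] the projection by [P] moves with the constant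
    speed [x], since [Y *m P] is the identity. This makes the time one map
    injective. *)
Lemma flow_projection x : `|x| < d -> z x 1 *m P = p *m P + x.
Proof.
move=> xd; pose F (t : R) := z x t *m P - t *: x.
have DF (t : R) : 0 <= t <= 1 -> is_derive t 1 F (0 : 'rV[R]_k).
  move=> t01.
  have d1 := is_derive_mulmx (dz xd t01) (is_derive_cst P t 1).
  have d2 := is_derive_scalemx (is_derive_id t (1 : R)) (is_derive_cst x t 1).
  have := is_deriveB d1 d2; move/is_derive_eq; apply.
  have [Oz _] := est (zr xd t01).
  by rewrite mulmx0 addr0 scaler0 addr0 scale1r -mulmxA YP // mulmx1 subrr.
have H := derive0_constant DF.
by move/eqP: H; rewrite /F scale1r scale0r subr0 z0 // subr_eq => /eqP.
Qed.

Lemma flow_zero : z 0 1 = p.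
Proof.
have l0 : `|(0 : 'rV[R]_k)| < d by rewrite normr0.
have D (t : R) : 0 <= t <= 1 -> is_derive t 1 (z 0) (0 : 'rV[R]_n).
  by move=> t01; have := dz l0 t01; rewrite mul0mx.
by rewrite (derive0_constant D) z0.
Qed.

(** Gronwall: the difference of the two flows is driven by the difference of
    the coefficients, of size [N] times their distance. *)
Lemma flow_lipschitz x x' : `|x| < d -> `|x'| < d ->
  forall t : R, 0 <= t <= 1 -> `|z x' t - z x t| <= 2 * (N * `|x' - x|).
Proof.
move=> xd xd'.
apply: (@small_gronwall R n (z x' - z x) (fun t => x' *m Y (z x' t) - x *m Y (z x t))).
- by move=> t t01; apply: is_deriveB; exact: dz.
- by rewrite -[LHS]/(z x' 0 - z x 0) !z0 // subrr.
move=> t t01; rewrite -[(z x' - z x) t]/(z x' t - z x t).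
have -> : x' *m Y (z x' t) - x *m Y (z x t) =
    x' *m (Y (z x' t) - Y (z x t)) + (x' - x) *m Y (z x t).
  by rewrite mulmxBr mulmxBl subrKA.
apply: le_trans (ler_normD _ _) _; apply: lerD.
  apply: (@le_trans _ _ (k%:R * (K * `|z x' t - z x t|) * `|x'|)).
    apply: mulmx_row_le; first by rewrite mulr_ge0.
    by move=> a l; have [] := est2 (zr xd t01) (zr xd' t01) a l.
  rewrite mulrA mulrAC ler_wpM2r //.
  apply: (@le_trans _ _ (N * d)); first by rewrite ler_wpM2l // ltW.
  by apply: le_trans Nd _; rewrite lef_pV2 ?posrE // ler_nat.
by apply: mulmx_row_le => //; have [_ []] := est (zr xd t01).
Qed.

(** The heart of the Frobenius theorem. The error [h] of the linear
    approximation [t *: (xi *m Y)] vanishes at time 0, and by commutation it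
    satisfies the linearized equation up to terms of second order; Gronwall
    bounds it at time 1. *)
Lemma flow_quadratic x x' : `|x| < d -> `|x'| < d ->
  `|z x' 1 - z x 1 - (x' - x) *m Y (z x 1)| <= 6 * N ^+ 2 * `|x' - x| ^+ 2.
Proof.
move=> xd xd'; set xi := x' - x.
pose D t := z x' t - z x t.
pose h (t : R) := z x' t - z x t - t *: (xi *m Y (z x t)).
have Oz (t : R) : 0 <= t <= 1 -> O (z x t) by move=> t01; have [] := est (zr xd t01).
pose dh (t : R) := xi *m (Y (z x' t) - Y (z x t))
   + x *m (Y (z x' t) - Y (z x t) - 'D_(D t) Y (z x t)) + x *m 'D_(h t) Y (z x t).
have Dh (t : R) : 0 <= t <= 1 -> is_derive t 1 h (dh t).
  move=> t01.
  have dY := is_derive_along (frame_differentiable (Oz _ t01)) (dz xd t01).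
  have d1 := is_deriveB (dz xd' t01) (dz xd t01).
  have d2 := is_derive_scalemx (is_derive_id t (1 : R))
     (is_derive_mulmx (is_derive_cst xi t 1) dY).
  have := is_deriveB d1 d2; move/is_derive_eq; apply.
  (* Commutation exchanges [xi] and [x] in the derivative of [Y] along the
     flow, which then becomes part of the linearized equation for [h]. *)
  rewrite mul0mx add0r scale1r Ycomm; last exact: Oz.
  rewrite /dh /h -/(D t) derive_linear_combination; last exact: Oz.
  rewrite !mulmxBr -scalemxAr /xi !mulmxBl /=.
  set A := x' *m Y (z x' t); set B := x' *m Y (z x t).
  set A1 := x *m Y (z x' t); set B1 := x *m Y (z x t).
  set C := t *: _; set E := x *m 'D_(D t) Y (z x t).
  exact: rV_regroup.
have h0 : h 0 = 0 by rewrite /h !z0 // subrr scale0r subrr.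
have ND (t : R) : 0 <= t <= 1 -> `|D t| <= 2 * (N * `|xi|) by exact: flow_lipschitz.
have half (a : R) : 0 <= a -> N * `|x| * a <= 4^-1 * a.
  move=> a0; rewrite ler_wpM2r //; apply: le_trans Nd; rewrite ler_wpM2l // ltW //.
have bd (t : R) : 0 <= t <= 1 -> `|dh t| <= 2^-1 * `|h t| + 3 * N ^+ 2 * `|xi| ^+ 2.
  move=> t01; have [_ [_ eD]] := est (zr xd t01).
  have e2 := est2 (zr xd t01) (zr xd' t01).
  (* As the flow is Lipschitz with constant [2 N], the first part of [dh]
     is at most [2 N^2 |xi|^2] and the second one at most [(1/4) (2 N
     |xi|)^2], which makes the constant 3; the third part is absorbed by
     the factor one half of the Gronwall inequality. *)
  have b1 : `|xi *m (Y (z x' t) - Y (z x t))| <= N * `|D t| * `|xi|.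
    rewrite /N -[k%:R * K * _]mulrA; apply: mulmx_row_le; first by rewrite mulr_ge0.
    by move=> a l; have [] := e2 a l.
  have b2 : `|x *m (Y (z x' t) - Y (z x t) - 'D_(D t) Y (z x t))| <= N * `|x| * (`|D t| * `|D t|).
    rewrite [leRHS]mulrAC /N -[k%:R * K * _]mulrA; apply: mulmx_row_le; first by rewrite !mulr_ge0.
    by move=> a l; have [] := e2 a l.
  have b3 : `|x *m 'D_(h t) Y (z x t)| <= N * `|x| * `|h t|.
    rewrite [leRHS]mulrAC /N -[k%:R * K * _]mulrA; apply: mulmx_row_le; first by rewrite mulr_ge0.
    by move=> a l; exact: eD.
  have b4 := ND _ t01.
  have c2 := half _ (mulr_ge0 (normr_ge0 (D t)) (normr_ge0 (D t))).
  have c3 := half _ (normr_ge0 (h t)).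
  apply: le_trans (ler_normD _ _) _; apply: le_trans (lerD (ler_normD _ _) (lexx _)) _.
  have c1 : N * `|D t| * `|xi| <= N * (2 * (N * `|xi|)) * `|xi|.
    by rewrite ler_wpM2r // ler_wpM2l.
  have c4 : `|D t| * `|D t| <= 2 * (N * `|xi|) * (2 * (N * `|xi|)) by rewrite ler_pM.
  have := normr_ge0 (h t).
  move: b1 b2 b3 c1 c2 c3 c4.
  set b1 := `|xi *m _|; set b2 := `|x *m _|; set b3 := `|x *m _|.
  set q := `|D t|; set w := `|h t|; set s := `|xi|.
  move: (N * `|x| * w) (N * `|x| * (q * q)) => u1 u2; move: (N * q * s) => u3; move: (q * q) => u4.
  clear; move=> *; rewrite !expr2; nra.
have := small_gronwall Dh h0 bd in11.
rewrite /h scale1r => H; apply: le_trans H _.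
by rewrite !mulrA -natrM.
Qed.

End Flow.

(** The time one map [x |-> z x 1]. Outside the ball of radius [d] the curves
    are chosen arbitrarily. *)
Lemma commuting_frame_integral :
  exists (d : R) (f : 'rV[R]_k -> 'rV[R]_n), [/\ 0 < d, f 0 = p,
    forall x, `|x| < d -> O (f x) /\ f x *m P = p *m P + x &
    forall x, `|x| < d -> differentiable f x /\
      forall xi, 'd f x xi = xi *m Y (f x)].
Proof.
have [r [K [r0 K0 est est2]]] := frame_estimates.
pose N := k%:R * K.
have N0 : 0 <= N by rewrite mulr_ge0.
have N1 : 0 < N + 1 by rewrite ltr_wpDl.
pose m := Num.min 4^-1 (r / 4).
have m0 : 0 < m by rewrite lt_min invr_gt0 divr_gt0 // ltr0n.
pose d := m / (N + 1).
have d0 : 0 < d by rewrite divr_gt0.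
have Nm : N * d <= m.
  by rewrite /d mulrA ler_pdivrMr // mulrC ler_wpM2l ?lerDl // ltW.
have [Nd Nr] : N * d <= 4^-1 /\ N * d <= r / 4.
  by split; apply: le_trans Nm _; rewrite ge_min lexx ?orbT.
have H (x : 'rV[R]_k) : exists z : R -> 'rV[R]_n, `|x| < d -> z 0 = p /\ forall t : R, 0 <= t <= 1 ->
     `|z t - p| < r /\ is_derive t 1 z (x *m Y (z t)).
  have [xd|_] := ltP `|x| d; last by exists (cst p).
  by have [z Hz] := flow_exists r0 K0 d0 est est2 Nd Nr xd; exists z.
have [z Hz] := choice H.
have z0 x (xd : `|x| < d) : z x 0 = p by have [] := Hz x xd.
have zr x (xd : `|x| < d) (t : R) (t01 : 0 <= t <= 1) : `|z x t - p| < r.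
  by have [_ /(_ t t01)[]] := Hz x xd.
have dz x (xd : `|x| < d) (t : R) (t01 : 0 <= t <= 1) : is_derive t 1 (z x) (x *m Y (z x t)).
  by have [_ /(_ t t01)[]] := Hz x xd.
have t11 : 0 <= (1 : R) <= 1 by rewrite ler01 lexx.
exists d, (fun x => z x 1); split=> //.
- exact: flow_zero z0 dz.
- move=> x xd; split; first by have [] := est _ (zr _ xd _ t11).
  exact: (flow_projection est z0 zr dz xd).
- move=> x xd.
  have Q := flow_quadratic K0 est est2 Nd z0 zr dz xd.
  have [||D E] := @differentiable_by_estimate R _ _ (fun x => z x 1)
     (mulmxr (Y (z x 1)) : {linear 'rV[R]_k -> 'rV[R]_n}) x.
  + exact: mulmxr_continuous.
  + move=> e e0.
    (* The quadratic error is below [e] times the norm of [h] once the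
       latter is at most [e / (C + 1)]. *)
    pose C := 6 * N ^+ 2.
    have C0 : 0 <= C by rewrite mulr_ge0 // exprn_ge0.
    have C1 : 0 < C + 1 by rewrite ltr_wpDl.
    apply/near_ballP; exists (Num.min (d - `|x|) (e / (C + 1))).
      by rewrite lt_min subr_gt0 xd divr_gt0.
    move=> h; rewrite subr0 lt_min => /andP[h1 h2].
    have xh : `|x + h| < d by apply: le_lt_trans (ler_normD _ _) _; rewrite -ltrBrDl.
    have := Q _ xh; rewrite [x + h - x]addrAC subrr add0r => /le_trans; apply.
    rewrite -/N -/C expr2 mulrA ler_wpM2r //.
    rewrite ltr_pdivlMr // in h2.
    apply: le_trans (ltW h2); rewrite mulrC ler_wpM2l //.
    by rewrite lerDl.
  split=> // xi; by rewrite E.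
Qed.

(** The derivative of [f] is [Y \o f], which is as smooth as [f]; this
    bootstraps. Injectivity comes from the relation [f x *m P = p *m P + x]. *)
Lemma commuting_frame_integral_smooth :
  exists (d : R) (f : 'rV[R]_k -> 'rV[R]_n), let U := [set x : 'rV[R]_k | `|x| < d] in
   [/\ 0 < d, f 0 = p, smooth_on U f, set_inj U f &
    forall x, U x -> [/\ O (f x), differentiable f x & jacobian f x = Y (f x)]].
Proof.
have [d [f [d0 f0 Hf Df]]] := commuting_frame_integral.
exists d, f => U.
have oU : open U.
  have := @open_norm_ball R 'rV[R]_k 0 d.
  by congr open; apply/funext => x /=; rewrite subr0.
have UO x : U x -> O (f x) by move=> /Hf[].
split=> //.
- elim=> [|m IH].
    by split=> // x Ux; apply: differentiable_continuous; have [] := Df x Ux.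
  split=> [x Ux|i]; first by apply: differentiable_continuous; have [] := Df x Ux.
  split=> [x Ux|]; first by apply: diff_derivable; have [] := Df x Ux.
  have C1 := Ck_on_comp_mx oU oO UO IH (sY m).
  have C2 := Ck_on_mulmx oU (Ck_on_cst oU m (delta_mx 0 i : 'rV[R]_k)) C1.
  apply: Ck_on_eq C2 => // x Ux.
  by have [D E] := Df x Ux; rewrite deriveE // E.
- move=> x y; rewrite !inE => Ux Uy fxy.
  have [_ ex] := Hf x Ux; have [_ ey] := Hf y Uy.
  by move: ex; rewrite fxy ey => /addrI.
- move=> x Ux; have [D E] := Df x Ux; split=> //; first exact: UO.
  apply/row_matrixP => i; rewrite !rowE -E /jacobian.
  by rewrite mul_rV_lin1.
Qed.

End CommutingFrame.

(** * Coprime factors of the characteristic polynomial *)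

Section CharPolySplit.
Variable F : fieldType.

(** In the basis formed by the rows of [B1] and [B2] the matrix [A] is block
    diagonal; the argument multiplies determinants, so that no change of
    basis has to be inverted. *)
Lemma char_poly_split n r1 r2 (A : 'M[F]_n) (B1 : 'M[F]_(r1, n)) (B2 : 'M[F]_(r2, n))
    (A1 : 'M[F]_r1) (A2 : 'M[F]_r2) :
  (r1 + r2)%N = n -> row_full (col_mx B1 B2) ->
  B1 *m A = A1 *m B1 -> B2 *m A = A2 *m B2 ->
  char_poly A = char_poly A1 * char_poly A2.
Proof.
move=> e; subst n => fB E1 E2; set B := col_mx B1 B2 in fB.
have uB : B \in unitmx by rewrite -row_full_unit.
pose C := map_mx polyC B.
have dC : \det C != 0 by rewrite /C det_map_mx polyC_eq0 -unitfE -unitmxE.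
have BA : B *m A = block_mx A1 0 0 A2 *m B.
  by rewrite /B mul_col_mx E1 E2 mul_block_col !mul0mx addr0 add0r.
have : C *m char_poly_mx A = char_poly_mx (block_mx A1 0 0 A2) *m C.
  rewrite /char_poly_mx mulmxBr mulmxBl scalar_mxC -!map_mxM BA //.
move/(congr1 determinant); rewrite !det_mulmx mulrC => /(mulIf dC).
rewrite -/(char_poly A) => ->.
rewrite /char_poly_mx map_block_mx !map_mx0 scalar_mx_block opp_block_mx.
by rewrite add_block_mx !oppr0 !addr0 det_ublock.
Qed.

Lemma mulmx_horner_eigen n (A : 'M[F]_n.+1) (w : 'rV[F]_n.+1) (c : F) (p : {poly F}) :
  w *m A = c *: w -> w *m horner_mx A p = p.[c] *: w.
Proof.
move=> wA; elim/poly_ind: p => [|p a IH].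
  by rewrite rmorph0 mulmx0 horner0 scale0r.
rewrite rmorphD rmorphM /= horner_mx_X horner_mx_C mulmxDr -[_ * A]/(_ *m A) mulmxA.
by rewrite IH -scalemxAl wA scalerA mul_mx_scalar hornerMXaddC scalerDl.
Qed.

Lemma coprimep_bezout (p q : {poly F}) : coprimep p q ->
  exists u v, u * p + v * q = 1.
Proof.
move=> /Bezout_coprimepP[[u v] /= E].
have [c c0 Ec] : exists2 c, c != 0 & u * p + v * q = c%:P.
  by move: E; rewrite -size_poly_eq1 => /size_poly1P.
exists (c^-1 *: u), (c^-1 *: v).
by rewrite -!scalerAl -scalerDr Ec -mul_polyC -polyCM mulVf.
Qed.

(** The ranks add up to at most the size since the product vanishes, and to
    at least the size by a Bezout relation. *)
Lemma rank_coprime_factors n (A : 'M[F]_n.+1) (p q : {poly F}) :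
  coprimep p q -> horner_mx A (p * q) = 0 ->
  (\rank (horner_mx A q) + \rank (horner_mx A p))%N = n.+1.
Proof.
move=> /coprimep_bezout[u [v E]] pq0; apply/eqP; rewrite eqn_leq; apply/andP; split.
  by apply: mulmx0_rank_max; rewrite -[_ *m _]/(_ * _) -rmorphM mulrC.
have : horner_mx A (u * p + v * q) = 1%:M by rewrite E rmorph1.
rewrite rmorphD !rmorphM /= => /(congr1 (@mxrank _ _ _)); rewrite mxrank1 => E1.
rewrite -[leqLHS]E1 addnC; apply: leq_trans (mxrank_add _ _) _.
by apply: leq_add; exact: mxrankM_maxr.
Qed.

End CharPolySplit.

Section Closed.
Variable K : closedFieldType.

(** An eigenvalue of the restriction of [A] to a subspace killed by [p A] is
    a root of [p], hence not of [q]; so the characteristic polynomial of the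
    restriction divides [p]. *)
Lemma rank_factor_le n (A : 'M[K]_n.+1) (p q : {poly K}) r (B : 'M[K]_(r, n.+1)) A1 :
  coprimep p q -> p != 0 -> row_free B -> B *m A = A1 *m B -> B *m horner_mx A p = 0 ->
  char_poly A1 %| p * q -> (r < size p)%N.
Proof.
move=> cpq p0 fB BA Bp; rewrite Gauss_dvdpl.
  by move/dvdp_leq => /(_ p0); rewrite size_char_poly.
apply/Pdiv.ClosedField.root_coprimep => x.
rewrite -eigenvalue_root_char => /eigenvalueP[y yA1 y0].
apply: (coprimep_root cpq); apply/eqP.
have wA : (y *m B) *m A = x *: (y *m B) by rewrite -mulmxA BA mulmxA yA1 scalemxAl.
have := mulmx_horner_eigen p wA; rewrite -mulmxA Bp mulmx0 => /esym/eqP.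
rewrite scaler_eq0 => /orP[/eqP //|]; rewrite -[y *m B == 0]/(_ == _).
by rewrite mulmx_free_eq0 // (negbTE y0).
Qed.

(** The space is the direct sum of the images of [q A] and [p A]. Each
    dimension is at most the degree of the corresponding factor by
    [rank_factor_le], and both the dimensions and the degrees add up to the
    size of [A]; so equality holds. *)
Lemma rank_char_poly_factor n (A : 'M[K]_n.+1) (p q : {poly K}) :
  coprimep p q -> char_poly A = p * q ->
  \rank (horner_mx A q) = (size p).-1.
Proof.
move=> cpq Apq.
have pq0 : p * q != 0 by rewrite -Apq monic_neq0 // char_poly_monic.
have [p0 q0] : p != 0 /\ q != 0 by move: pq0; rewrite mulf_eq0 negb_or => /andP[].
have hpq : horner_mx A (p * q) = 0 by rewrite -Apq Cayley_Hamilton.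
have R := rank_coprime_factors cpq hpq.
have cAq s : horner_mx A s *m A = A *m horner_mx A s.
  have := comm_horner_mx s (erefl : comm_mx A A); exact.
pose B1 := row_base (horner_mx A q); pose B2 := row_base (horner_mx A p).
have stab s : (row_base (horner_mx A s) *m A <= row_base (horner_mx A s))%MS.
  by rewrite eq_row_base (eqmxMr _ (eq_row_base _)) cAq submxMl.
have /submxP[A1 E1] := stab q; have /submxP[A2 E2] := stab p.
have ann s t : horner_mx A (s * t) = 0 -> row_base (horner_mx A s) *m horner_mx A t = 0.
  move=> st; apply/eqP; rewrite -submx0 (eqmxMr _ (eq_row_base _)).
  by rewrite -[_ *m _]/(_ * _) -rmorphM /= st sub0mx.
have B1p : B1 *m horner_mx A p = 0 by apply: ann; rewrite mulrC.
have B2q : B2 *m horner_mx A q = 0 by apply: ann.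
have full : row_full (col_mx B1 B2).
  have [u [v E]] := coprimep_bezout cpq.
  have E1' : 1%:M = horner_mx A u *m horner_mx A p + horner_mx A v *m horner_mx A q.
    by rewrite -[LHS](rmorph1 (horner_mx A)) -E rmorphD !rmorphM.
  rewrite -sub1mx E1'.
  have S : (horner_mx A q + horner_mx A p <= col_mx B1 B2)%MS.
    by rewrite -addsmxE; apply: addsmxS; rewrite eq_row_base.
  apply: addmx_sub; apply: submx_trans (submxMl _ _) _; apply: submx_trans S.
    exact: addsmxSr.
  exact: addsmxSl.
have C := char_poly_split R full E1 E2.
have d1 : char_poly A1 %| p * q by rewrite -Apq C dvdp_mulr.
have d2 : char_poly A2 %| q * p by rewrite mulrC -Apq C dvdp_mull.
have l1 := rank_factor_le cpq p0 (row_base_free _) E1 B1p d1.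
have cqp : coprimep q p by rewrite coprimep_sym.
have l2 := rank_factor_le cqp q0 (row_base_free _) E2 B2q d2.
have sz : n.+2 = (size p + size q).-1 by rewrite -size_mul // -Apq size_char_poly.
have arith (r1 r2 a b m : nat) : (r1 < a -> r2 < b -> m.+2 = (a + b).-1 ->
    r1 + r2 = m.+1 -> r1 = a.-1)%N by lia.
exact: arith l1 l2 sz R.
Qed.

End Closed.

Section Real.
Variable R : realType.

Lemma no_common_root_coprimep (p q : {poly R}) :
  no_common_complex_root p q ->
  coprimep (map_poly (real_complex R) p) (map_poly (real_complex R) q).
Proof.
move=> H; apply/Pdiv.ClosedField.root_coprimep => z pz.
by apply/negP => qz; apply: (H z).
Qed.

(** Ranks do not change under extension of scalars to the complex numbers,
    where coprimality is the absence of common roots. *)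
Lemma rank_real_factor n (A : 'M[R]_n.+1) (p q : {poly R}) :
  no_common_complex_root p q -> char_poly A = p * q ->
  \rank (horner_mx A q) = (size p).-1.
Proof.
move=> /no_common_root_coprimep cpq Apq.
have := @rank_char_poly_factor _ n (map_mx (real_complex R) A) _ _ cpq.
rewrite -map_char_poly Apq rmorphM -map_horner_mx mxrank_map size_map_poly.
exact.
Qed.

Lemma no_common_root_bezout (p q : {poly R}) : no_common_complex_root p q ->
  exists u v, u * p + v * q = 1.
Proof.
by move=> /no_common_root_coprimep; rewrite coprimep_map => /coprimep_bezout.
Qed.

Lemma poly_mxE n (A : 'M[R]_n.+1) (p : {poly R}) : poly_mx p A = horner_mx A p.
Proof.
rewrite /poly_mx [in RHS](_ : p = \sum_(i < size p) p`_i *: 'X^i); last first.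
  by rewrite -{1}[p]coefK poly_def.
by rewrite rmorph_sum; apply: eq_bigr => i _; rewrite -mul_polyC rmorphM rmorphXn /= horner_mx_X horner_mx_C -[_ * _]/(_ *m _) mul_scalar_mx.
Qed.


(** Polarization: a symmetric bilinear map with [T(v, v)] always parallel to
    [v] is [phi(a) u + phi(u) a]. Comparing the coordinates of [T(v, v)] for
    [v] a basis vector and the sum and difference of two basis vectors
    determines every [T i j]. *)
Lemma pure_trace_of_parallel n (T : 'I_n -> 'I_n -> 'rV[R]_n) :
  (forall i j, T i j = T j i) ->
  (forall v : 'rV[R]_n, exists mu, \sum_i \sum_j (v 0 i * v 0 j) *: T i j = mu *: v) ->
  exists phi : 'I_n -> R, forall i j, T i j = phi i *: 'e_j + phi j *: 'e_i.
Proof.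
move=> Ts H.
pose B (a u : 'rV[R]_n) := \sum_i \sum_j (a 0 i * u 0 j) *: T i j.
have BDl a b u : B (a + b) u = B a u + B b u.
  rewrite -big_split; apply: eq_bigr => i _; rewrite -big_split; apply: eq_bigr => j _ /=.
  by rewrite mxE mulrDl scalerDl.
have BDr a b u : B u (a + b) = B u a + B u b.
  rewrite -big_split; apply: eq_bigr => i _; rewrite -big_split; apply: eq_bigr => j _ /=.
  by rewrite mxE mulrDr scalerDl.
have BNl a u : B (- a) u = - B a u.
  apply/eqP; rewrite -subr_eq0 opprK -BDl addNr.
  by apply/eqP; rewrite /B big1 // => i _; rewrite big1 // => j _; rewrite mxE mul0r scale0r.
have BNr a u : B u (- a) = - B u a.
  apply/eqP; rewrite -subr_eq0 opprK -BDr addNr.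
  by apply/eqP; rewrite /B big1 // => i _; rewrite big1 // => j _; rewrite mxE mulr0 scale0r.
have Be i j : B 'e_i 'e_j = T i j.
  rewrite /B (bigD1 i) //= [X in _ + X]big1 => [|k ki]; last first.
    by rewrite big1 // => l _; rewrite mxE eqxx (negbTE ki) mul0r scale0r.
  rewrite addr0 (bigD1 j) //= [X in _ + X]big1 => [|k kj]; last first.
    by rewrite [X in _ * X]mxE eqxx (negbTE kj) mulr0 scale0r.
  by rewrite addr0 !mxE !eqxx mulr1 scale1r.
have Hd i : exists mu, T i i = mu *: 'e_i.
  by have [mu E] := H 'e_i; exists mu; rewrite -Be.
have [mu Hmu] := choice Hd.
exists (fun i => mu i / 2) => i j.
have [->|ij] := eqVneq i j.
  by rewrite Hmu -scalerDl; congr (_ *: _); lra.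
have [al Ea] := H ('e_i + 'e_j); have [be Eb] := H ('e_i - 'e_j).
rewrite -/(B _ _) BDl !BDr !Be (Ts j i) !Hmu in Ea.
rewrite -/(B _ _) BDl !BDr !BNl !BNr opprK !Be (Ts j i) !Hmu in Eb.
have ji : (j == i) = false by rewrite eq_sym (negbTE ij).
have eai := congr1 (fun v : 'rV_n => v 0 i) Ea; have eaj := congr1 (fun v : 'rV_n => v 0 j) Ea.
have ebi := congr1 (fun v : 'rV_n => v 0 i) Eb; have ebj := congr1 (fun v : 'rV_n => v 0 j) Eb.
rewrite !mxE !eqxx (negbTE ij) ?ji /= !(mulr0, mulr1) in eai eaj ebi ebj.
apply/rowP => l.
have eal := congr1 (fun v : 'rV_n => v 0 l) Ea; have ebl := congr1 (fun v : 'rV_n => v 0 l) Eb.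
rewrite !mxE eqxx /= in eal ebl *.
have sal : al = mu i + mu j by lra.
have sbe : be = mu i - mu j by lra.
rewrite sal in eal; rewrite sbe in ebl; lra.
Qed.

End Real.

(** * The Levi-Civita connection in a chart *)

Section Forms.
Variable R : realType.

Lemma mx_formE a b (w : 'rV[R]_a) (M : 'M[R]_(a, b)) (u : 'rV[R]_b) :
  (w *m M *m u^T) 0 0 = \sum_l \sum_j w 0 l * M l j * u 0 j.
Proof.
rewrite mxE exchange_big; apply: eq_bigr => j _.
by rewrite !mxE mulr_suml.
Qed.

Lemma mx_form_inj a b (M N : 'M[R]_(a, b)) :
  (forall (w : 'rV[R]_a) (u : 'rV[R]_b), (w *m M *m u^T) 0 0 = (w *m N *m u^T) 0 0) -> M = N.
Proof.
move=> H; apply/matrixP => i j; have := H (delta_mx 0 i) (delta_mx 0 j).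
by rewrite trmx_delta -!rowE -!colE !mxE.
Qed.

Lemma mx_form_tr a (w u : 'rV[R]_a) (M : 'M[R]_a) :
  M^T = M -> (w *m M *m u^T) 0 0 = (u *m M *m w^T) 0 0.
Proof.
move=> MT; transitivity (((w *m M *m u^T)^T) 0 0); first by rewrite [RHS]mxE.
by rewrite !trmx_mul trmxK MT mulmxA.
Qed.

Lemma half_sum (g a b : R) : g + 2^-1 * (a + a - b) = g + a - 2^-1 * b.
Proof. by lra. Qed.

End Forms.

Section Connection.
Variables (R : realType) (n : nat) (O : set 'rV[R]_n) (G : 'rV[R]_n -> 'M[R]_n).
Hypotheses (oO : open O) (sG : smooth_on O G).
Hypothesis Gsym : forall x, O x -> (G x)^T = G x.
Hypothesis Gunit : forall x, O x -> G x \in unitmx.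

(** The matrix [Gamma_a] of the contraction of the Christoffel symbols with
    the vector [a], acting on columns: the covariant derivative of a field
    [u] along [a] is the derivative of [u^T] plus [Gamma_a *m u^T]. *)
Definition connection (H : 'rV[R]_n -> 'M[R]_n) (x a : 'rV[R]_n) : 'M[R]_n :=
  \matrix_(k, j) \sum_i christoffel H x k i j * a 0 i.

Lemma metric_differentiable x : O x -> differentiable G x.
Proof. exact: (Ck_on_differentiable_mx oO (sG 1)). Qed.

Lemma metric_derive_entry x a l j : O x ->
  ('D_a G x) l j = \sum_i a 0 i * 'D_('e_i) (fun y => G y l j) x.
Proof.
move=> Ox; have dG := metric_differentiable Ox.
rewrite (derive_rV _ dG) summxE; apply: eq_bigr => i _.
by rewrite mxE derive_mx ?mxE //; apply: diff_derivable.
Qed.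

Lemma metric_derive_sym x a : O x -> ('D_a G x)^T = 'D_a G x.
Proof.
move=> Ox; apply/matrixP => i j; rewrite mxE !metric_derive_entry //.
apply: eq_bigr => k _; congr (_ * _); apply: near_eq_derive.
apply: filterS (open_near oO Ox) => y Oy.
by rewrite -[in LHS](Gsym Oy) mxE.
Qed.

Lemma partial_sym x i j l : O x ->
  'D_('e_l) (fun y => G y i j) x = 'D_('e_l) (fun y => G y j i) x.
Proof.
move=> Ox; apply: near_eq_derive.
apply: filterS (open_near oO Ox) => y Oy.
by rewrite -[in LHS](Gsym Oy) mxE.
Qed.

Lemma christoffel_sym x k i j : O x -> christoffel G x k i j = christoffel G x k j i.
Proof.
move=> Ox; rewrite /christoffel; congr (_ * _); apply: eq_bigr => l _; congr (_ * _).
by rewrite [X in _ - X = _](partial_sym _ _ _ Ox) [X in X - _ = _]addrC.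
Qed.

Lemma connection_mul H x a (u : 'rV[R]_n) k :
  (connection H x a *m u^T) k 0 = \sum_i \sum_j christoffel H x k i j * a 0 i * u 0 j.
Proof.
rewrite mxE exchange_big; apply: eq_bigr => j _.
by rewrite !mxE mulr_suml.
Qed.

Lemma connection_sym x (a u : 'rV[R]_n) : O x ->
  connection G x a *m u^T = connection G x u *m a^T.
Proof.
move=> Ox; apply/colP => k; rewrite !connection_mul exchange_big.
apply: eq_bigr => i _; apply: eq_bigr => j _.
by rewrite christoffel_sym // mulrAC.
Qed.

(** The Koszul formula: lowering the index cancels the inverse matrix in the
    Christoffel symbols. *)
Lemma connection_lowered x (w a u : 'rV[R]_n) : O x ->
  (w *m G x *m (connection G x a *m u^T)) 0 0 = 2^-1 *
    ((w *m 'D_a G x *m u^T) 0 0 + (w *m 'D_u G x *m a^T) 0 0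
     - (a *m 'D_w G x *m u^T) 0 0).
Proof.
move=> Ox.
pose c : 'cV[R]_n := \col_l \sum_i \sum_j 2^-1 *
   ('D_('e_i) (fun y => G y j l) x + 'D_('e_j) (fun y => G y i l) x
     - 'D_('e_l) (fun y => G y i j) x) * a 0 i * u 0 j.
have -> : connection G x a *m u^T = invmx (G x) *m c.
  apply/colP => k; rewrite connection_mul [RHS]mxE.
  under [RHS]eq_bigr => l _ do rewrite mxE mulr_sumr.
  rewrite [RHS]exchange_big; apply: eq_bigr => i _.
  under [RHS]eq_bigr => l _ do rewrite mulr_sumr.
  rewrite [RHS]exchange_big; apply: eq_bigr => j _.
  rewrite /christoffel mulr_sumr !mulr_suml; apply: eq_bigr => l _; ring.
rewrite mulmxA mulmxK; last exact: Gunit.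
have [D DE] : exists D : 'rV[R]_n -> 'M[R]_n, forall a, 'D_a G x = D a.
  by exists (fun a => 'D_a G x).
have form (p q r : 'rV[R]_n) : (p *m D q *m r^T) 0 0 =
   \sum_l \sum_i \sum_j p 0 l * q 0 i * r 0 j * 'D_('e_i) (fun y => G y l j) x.
  rewrite mx_formE; apply: eq_bigr => l _; rewrite exchange_big; apply: eq_bigr => j _.
  rewrite -DE metric_derive_entry // mulr_sumr mulr_suml; apply: eq_bigr => i _; ring.
rewrite !DE (form w a u) (form w u a) (form a w u) mxE.
rewrite [X in _ + X - _](_ : _ = \sum_l \sum_i \sum_j w 0 l * u 0 j * a 0 i * 'D_('e_j) (fun y => G y l i) x); last first.
  by apply: eq_bigr => l _; rewrite exchange_big.
rewrite [X in _ - X](_ : _ = \sum_l \sum_i \sum_j a 0 i * w 0 l * u 0 j * 'D_('e_l) (fun y => G y i j) x); last first.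
  by rewrite exchange_big.
rewrite -sumrN -!big_split /= mulr_sumr; apply: eq_bigr => l _.
rewrite mxE -sumrN -!big_split /= !mulr_sumr; apply: eq_bigr => i _.
rewrite -sumrN -!big_split /= !mulr_sumr; apply: eq_bigr => j _.
rewrite (partial_sym l j _ Ox) (partial_sym l i _ Ox); ring.
Qed.

(** The metric is parallel: the Koszul formula for [a] and [u], and for [a]
    and [w], added up. *)
Lemma connection_compat x a : O x ->
  'D_a G x = (connection G x a)^T *m G x + G x *m connection G x a.
Proof.
move=> Ox; apply: mx_form_inj => w u.
rewrite mulmxDr mulmxDl [RHS]mxE.
have -> : (w *m ((connection G x a)^T *m G x) *m u^T) 0 0 =
    (u *m G x *m (connection G x a *m w^T)) 0 0.
  transitivity (((w *m ((connection G x a)^T *m G x) *m u^T)^T) 0 0); first by rewrite [RHS]mxE.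
  by rewrite !trmx_mul !trmxK (Gsym Ox) !mulmxA.
have -> : w *m (G x *m connection G x a) *m u^T = w *m G x *m (connection G x a *m u^T).
  by rewrite !mulmxA.
rewrite !connection_lowered //.
have [D [DE Dsym]] : exists D : 'rV[R]_n -> 'M[R]_n,
    (forall a, 'D_a G x = D a) /\ forall a, (D a)^T = D a.
  by exists (fun a => 'D_a G x); split=> // b; exact: metric_derive_sym.
rewrite !DE (mx_form_tr u w (Dsym a)) (mx_form_tr u a (Dsym w)) (mx_form_tr w a (Dsym u)).
lra.
Qed.

(** The equation of geodesics with the index lowered, in which no inverse
    matrix and no Christoffel symbol is left; this form transforms easily
    under a change of chart. *)
Lemma geodesic_lowered x v (A : 'rV[R]_n) : O x ->
  A^T + connection G x v *m v^T = 0 <->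
  forall w : 'rV[R]_n, (w *m G x *m A^T) 0 0 + (w *m 'D_v G x *m v^T) 0 0
     - 2^-1 * (v *m 'D_w G x *m v^T) 0 0 = 0.
Proof.
move=> Ox.
have E w : (w *m G x *m (A^T + connection G x v *m v^T)) 0 0 =
   (w *m G x *m A^T) 0 0 + (w *m 'D_v G x *m v^T) 0 0 - 2^-1 * (v *m 'D_w G x *m v^T) 0 0.
  by rewrite mulmxDr [LHS]mxE connection_lowered //; exact: half_sum.
split=> [H w|H]; first by rewrite -E H mulmx0 mxE.
apply/colP => k; rewrite [RHS]mxE.
have := H ('e_k *m invmx (G x)); rewrite -E mulmxKV; last exact: Gunit.
by rewrite -rowE mxE.
Qed.

End Connection.

(** * Geodesics in different charts *)

Section TransformAlgebra.
Variables (R : realType) (n : nat).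

Lemma geodesic_transform_algebra (w v A : 'rV[R]_n) (J G Jv Jw Dv Dw : 'M[R]_n) :
  G^T = G -> v *m Jw = w *m Jv ->
  (w *m (J *m G *m J^T) *m A^T) 0 0
  + (w *m (Jv *m G *m J^T + J *m Dv *m J^T + J *m G *m Jv^T) *m v^T) 0 0
  - 2^-1 * (v *m (Jw *m G *m J^T + J *m Dw *m J^T + J *m G *m Jw^T) *m v^T) 0 0 =
  ((w *m J) *m G *m (A *m J + v *m Jv)^T) 0 0 + ((w *m J) *m Dv *m (v *m J)^T) 0 0
  - 2^-1 * ((v *m J) *m Dw *m (v *m J)^T) 0 0.
Proof.
move=> GT vw.
have e1 : w *m (J *m G *m J^T) *m A^T = w *m J *m G *m (A *m J)^T.
  by rewrite trmx_mul !mulmxA.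
have e2 : w *m (Jv *m G *m J^T + J *m Dv *m J^T + J *m G *m Jv^T) *m v^T =
   w *m Jv *m G *m (v *m J)^T + w *m J *m Dv *m (v *m J)^T + w *m J *m G *m (v *m Jv)^T.
  by rewrite !trmx_mul !mulmxDr !mulmxDl !mulmxA.
have e3 : v *m (Jw *m G *m J^T + J *m Dw *m J^T + J *m G *m Jw^T) *m v^T =
   w *m Jv *m G *m (v *m J)^T + v *m J *m Dw *m (v *m J)^T + v *m J *m G *m (w *m Jv)^T.
  by rewrite -vw !trmx_mul !mulmxDr !mulmxDl !mulmxA.
have e4 : (v *m J *m G *m (w *m Jv)^T) 0 0 = (w *m Jv *m G *m (v *m J)^T) 0 0.
  exact: mx_form_tr.
have mxD (M N : 'M[R]_1) : (M + N) 0 0 = M 0 0 + N 0 0 by rewrite mxE.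
rewrite e1 e2 e3 !linearD /= !mxD e4.
move: ((w *m Jv *m G *m (v *m J)^T) 0 0) => a1.
move: ((w *m J *m G *m (A *m J)^T) 0 0) => a2.
move: ((w *m J *m Dv *m (v *m J)^T) 0 0) => a3.
move: ((w *m J *m G *m (v *m Jv)^T) 0 0) => a4.
move: ((v *m J *m Dw *m (v *m J)^T) 0 0) => a5.
lra.
Qed.

End TransformAlgebra.

Section Jacobian.
Variables (R : realType) (m n : nat) (V : set 'rV[R]_m) (tau : 'rV[R]_m -> 'rV[R]_n).
Hypotheses (oV : open V) (stau : smooth_on V tau).

Lemma smooth_differentiable x : V x -> differentiable tau x.
Proof. exact: (Ck_on_differentiable_mx oV (stau 1)). Qed.

Lemma derive_jacobian x v : V x -> 'D_v tau x = v *m jacobian tau x.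
Proof. by move=> Vx; rewrite deriveEjacobian //; exact: smooth_differentiable. Qed.

Lemma jacobian_entry x i j : V x -> jacobian tau x i j = 'D_('e_i) (fun y => tau y 0 j) x.
Proof.
move=> Vx; have D := smooth_differentiable Vx.
have -> : jacobian tau x i j = ('e_i *m jacobian tau x) 0 j by rewrite -rowE [RHS]mxE.
by rewrite -derive_jacobian // derive_mx ?mxE //; exact: diff_derivable.
Qed.

Lemma jacobian_Ck k : Ck_on k V (jacobian tau).
Proof.
apply/(Ck_on_mx _ _ oV) => i j.
have := (Ck_on_mx _ _ oV).1 (stau k.+1) 0 j; case=> _ /(_ i)[_].
by apply: Ck_on_eq => // x Vx; rewrite jacobian_entry.
Qed.

Lemma jacobian_derive_entry x w i j : V x ->
  ('D_w (jacobian tau) x) i j =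
  \sum_k w 0 k * 'D_('e_k) ('D_('e_i) (fun y => tau y 0 j)) x.
Proof.
move=> Vx; have D := Ck_on_differentiable_mx oV (jacobian_Ck 1) Vx.
rewrite (derive_rV _ D) summxE; apply: eq_bigr => k _; rewrite mxE; congr (_ * _).
rewrite derive_mx ?mxE; last exact: diff_derivable.
apply: near_eq_derive; apply: filterS (open_near oV Vx) => y Vy.
exact: jacobian_entry.
Qed.

(** Symmetry of the second derivatives of [tau], written with vectors. *)
Lemma jacobian_derive_sym x v w : V x ->
  v *m 'D_w (jacobian tau) x = w *m 'D_v (jacobian tau) x.
Proof.
move=> Vx; apply/rowP => j.
have [H [HE Hsym]] : exists H : 'I_m -> 'I_m -> R,
    (forall i k, 'D_('e_k) ('D_('e_i) (fun y => tau y 0 j)) x = H i k) /\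
    forall i k, H i k = H k i.
  exists (fun i k => 'D_('e_k) ('D_('e_i) (fun y => tau y 0 j)) x); split => i k.
    by reflexivity.
  by apply: (derive_sym _ _ oV Vx); exact: ((Ck_on_mx _ _ oV).1 (stau 2) 0 j).
have E (a b : 'rV[R]_m) : (a *m 'D_b (jacobian tau) x) 0 j =
    \sum_i \sum_k a 0 i * b 0 k * H i k.
  rewrite mxE; apply: eq_bigr => i _; rewrite jacobian_derive_entry // mulr_sumr.
  by apply: eq_bigr => k _; rewrite HE mulrA.
refine (etrans (E v w) (etrans _ (esym (E w v)))).
rewrite exchange_big; apply: eq_bigr => i _; apply: eq_bigr => k _.
by rewrite Hsym (mulrC (w 0 i)).
Qed.

End Jacobian.

Section GeodesicTransform.
Variables (R : realType) (n : nat) (O V O' : set 'rV[R]_n).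
Variables (G G' : 'rV[R]_n -> 'M[R]_n) (tau : 'rV[R]_n -> 'rV[R]_n).
Hypotheses (oO : open O) (sG : smooth_on O G).
Hypothesis Gsym : forall x, O x -> (G x)^T = G x.
Hypothesis Gunit : forall x, O x -> G x \in unitmx.
Hypotheses (oO' : open O') (sG' : smooth_on O' G').
Hypothesis Gsym' : forall x, O' x -> (G' x)^T = G' x.
Hypothesis Gunit' : forall x, O' x -> G' x \in unitmx.
Hypotheses (oV : open V) (VO : V `<=` O) (stau : smooth_on V tau).
Hypothesis VO' : forall x, V x -> O' (tau x).
Hypothesis GG' : forall x, V x ->
  G x = jacobian tau x *m G' (tau x) *m (jacobian tau x)^T.

Lemma jacobian_unit x : V x -> jacobian tau x \in unitmx.
Proof.
move=> Vx; have := Gunit (VO Vx); rewrite GG' // -mulmxA unitmx_mul.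
by case/andP.
Qed.

Lemma is_derive_of_differentiable (U W : normedModType R) (f : U -> W) x v :
  differentiable f x -> is_derive x v f ('D_v f x).
Proof. by move=> D; apply: DeriveDef => //; exact: diff_derivable. Qed.

(** Differentiates the tensor law [GG'], which holds on a whole neighbourhood
    of [x]. *)
Lemma metric_pullback_derive x w : V x ->
  'D_w G x = 'D_w (jacobian tau) x *m G' (tau x) *m (jacobian tau x)^T
   + jacobian tau x *m 'D_(w *m jacobian tau x) G' (tau x) *m (jacobian tau x)^T
   + jacobian tau x *m G' (tau x) *m ('D_w (jacobian tau) x)^T.
Proof.
move=> Vx.
have dJ := is_derive_of_differentiable w (Ck_on_differentiable_mx oV (jacobian_Ck oV stau 1) Vx).
have Dt := smooth_differentiable oV stau Vx.
have DG := Ck_on_differentiable_mx oO' (sG' 1) (VO' Vx).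
have dG : is_derive x w (G' \o tau) ('D_(w *m jacobian tau x) G' (tau x)).
  apply: DeriveDef; first by apply: diff_derivable; exact: differentiable_comp.
  rewrite deriveE; last exact: differentiable_comp.
  by rewrite diff_comp //= -(derive_jacobian oV stau w Vx) (deriveE _ Dt) (deriveE _ DG).
have D := is_derive_mulmx (is_derive_mulmx dJ dG) (is_derive_trmx dJ).
have E : \near x, (fun y => jacobian tau y *m (G' \o tau) y *m (jacobian tau y)^T) x = G x.
  by apply: filterS (open_near oV Vx) => y Vy; rewrite GG'.
have [_ ->] := near_eq_is_derive E D.
by rewrite mulmxDl.
Qed.

(** Lowering the index turns the claim into an identity between the
    derivatives of [G] and [G'], which are related by
    [metric_pullback_derive]; the second derivatives of [tau] cancel by their
    symmetry. *)
Lemma geodesic_transform x (v A : 'rV[R]_n) : V x ->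
  A^T + connection G x v *m v^T = 0 ->
  (A *m jacobian tau x + v *m 'D_v (jacobian tau) x)^T
    + connection G' (tau x) (v *m jacobian tau x) *m (v *m jacobian tau x)^T = 0.
Proof.
move=> Vx /(geodesic_lowered oO sG Gsym Gunit _ _ (VO Vx)) H.
apply/(geodesic_lowered oO' sG' Gsym' Gunit' _ _ (VO' Vx)) => w'.
(* It is enough to test on vectors transported by the Jacobian matrix, as
   it is invertible. *)
have [w ->] : exists w : 'rV[R]_n, w' = w *m jacobian tau x.
  by exists (w' *m invmx (jacobian tau x)); rewrite mulmxKV // jacobian_unit.
have := H w; rewrite !metric_pullback_derive // GG' //.
move=> H0; refine (etrans (esym _) H0).
apply: geodesic_transform_algebra; first exact: Gsym' (VO' Vx).
exact: (jacobian_derive_sym oV stau v w Vx).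
Qed.

End GeodesicTransform.

(** * Existence of geodesics *)

Lemma open_by_ball (R : realType) (V : normedModType R) (A : set V) :
  (forall x, A x -> exists2 r : R, 0 < r & forall y, `|y - x| < r -> A y) -> open A.
Proof. by move=> H; rewrite openE => x Ax; apply/near_ballP; exact: H. Qed.

Section PicardSmooth.
Variables (R : realType) (m : nat) (O : set 'rV[R]_m) (Y : 'rV[R]_m -> 'rV[R]_m).
Hypotheses (oO : open O) (CY : Ck_on 1 O Y).

(** Collects one Lipschitz constant and one bound from all coordinates and
    takes a time short enough for [picard_local]. *)
Lemma picard_C1 x0 : O x0 -> exists (T : R) (u : R -> 'rV[R]_m), [/\ 0 < T, u 0 = x0 &
  forall t : R, `|t| < T -> O (u t) /\ is_derive t 1 u (Y (u t))].
Proof.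
move=> Ox0.
have H (j : 'I_m) := C1_local_lipschitz oO ((Ck_on_mx _ _ oO).1 CY 0 j) Ox0.
have [rj Hr] := choice H; have [Kj HK] := choice Hr.
have [r1 r1p r1P] : exists2 e : R, 0 < e & forall j, e <= rj j.
  by apply: fin_pos_bound => j; have [] := HK j.
have [r2 r20 r2P] := (near_ballP _ _).1 (open_near oO Ox0).
have [r [r0 rr1 rr2]] : exists r : R, [/\ 0 < r, r < r1 & r < r2].
  (* Halving makes the closed ball of radius [r] fit in the open ones. *)
  exists (Num.min r1 r2 / 2).
  have m0 : 0 < Num.min r1 r2 by rewrite lt_min r1p.
  have mm : Num.min r1 r2 / 2 < Num.min r1 r2 by rewrite ltr_pdivrMr // ltr_pMr // ltrDl.
  rewrite divr_gt0 //; split=> //; apply: lt_le_trans mm _; by rewrite ge_min lexx ?orbT.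
have Kj0 j : 0 <= Kj j by have [] := HK j.
pose K := \sum_j Kj j.
have K0 : 0 <= K by apply: sumr_ge0.
have KP j : Kj j <= K by rewrite /K (bigD1 j) //= lerDl; apply: sumr_ge0.
have rO x : `|x - x0| <= r -> O x by move=> xr; apply: r2P; exact: le_lt_trans rr2.
have rrj j x : `|x - x0| <= r -> `|x - x0| < rj j.
  by move=> xr; apply: lt_le_trans (r1P j); exact: le_lt_trans rr1.
have YK x : `|x - x0| <= r -> `|Y x| <= K.
  move=> xr; apply/rV_norm_le => // j; have [_ _ h _] := HK j.
  by have [_ h1] := h _ (rrj j _ xr); exact: le_trans h1 (KP j).
have YL x y : `|x - x0| <= r -> `|y - x0| <= r -> `|Y x - Y y| <= K * `|x - y|.
  move=> xr yr; apply/rV_norm_le => [|j]; first by rewrite mulr_ge0.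
  have [_ _ _ h] := HK j; have h1 := h _ _ (rrj j _ yr) (rrj j _ xr).
  by rewrite !mxE; apply: le_trans h1 _; rewrite ler_wpM2r.
have K1 : 0 < K + 1 by rewrite ltr_wpDl.
pose T := Num.min 2^-1 r / (K + 1).
have m0 : 0 < Num.min 2^-1 r by rewrite lt_min invr_gt0 ltr0n.
have T0 : 0 < T by rewrite divr_gt0.
have TK : T * K <= Num.min 2^-1 r.
  by rewrite /T mulrAC ler_pdivrMr // ler_wpM2l ?lerDl // ltW.
have [|||||||u [u0 Hu]] := @picard_local R m Y x0 r K K T.
- exact: ltW.
- by [].
- exact: YL.
- exact: YK.
- by [].
- by apply: le_trans TK _; rewrite ge_min lexx.
- by apply: le_trans TK _; rewrite ge_min lexx orbT.
exists T, u; split=> // t tT; have [h1 h2] := Hu t tT; split=> //.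
apply: rO; apply: le_trans h1 _; apply: (@le_trans _ _ (T * K)).
  by rewrite mulrC ler_wpM2r // ltW.
by apply: le_trans TK _; rewrite ge_min lexx orbT.
Qed.

End PicardSmooth.

Section GeodesicExistence.
Variables (R : realType) (n : nat) (O : set 'rV[R]_n) (G : 'rV[R]_n -> 'M[R]_n).
Hypotheses (oO : open O) (sG : smooth_on O G).
Hypothesis Gunit : forall x, O x -> G x \in unitmx.

Lemma christoffel_Ck k c i j : Ck_on k O (fun x => christoffel G x c i j).
Proof.
have p (a b l : 'I_n) : Ck_on k O ('D_('e_l) (fun y => G y a b)).
  by apply: Ck_on_partial; exact: ((Ck_on_mx _ _ oO).1 (sG k.+1) a b).
have iG : Ck_on k O (fun x => invmx (G x)) by apply: Ck_on_invmx.
apply: Ck_onM => //; first exact: Ck_on_cst.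
apply: Ck_on_sum => // l; apply: Ck_onM => //.
  exact: ((Ck_on_mx _ _ oO).1 iG c l).
by apply: Ck_onD => //; [exact: Ck_onD | exact: Ck_onN].
Qed.

(** The geodesic spray: the equation of second order as a field of first
    order on pairs of a position and a velocity. *)
Let geodesic_field (Z : 'rV[R]_(n + n)) : 'rV[R]_(n + n) :=
  row_mx (rsubmx Z) (- (connection G (lsubmx Z) (rsubmx Z) *m (rsubmx Z)^T)^T).

Let phase_space : set 'rV[R]_(n + n) := [set Z | O (lsubmx Z)].

Lemma lsubmx_Ck k U : open U -> Ck_on k U (lsubmx : 'rV[R]_(n + n) -> 'rV[R]_n).
Proof.
move=> oU; apply/(Ck_on_mx _ _ oU) => i j; rewrite ord1.
apply: Ck_on_eq (Ck_on_coord oU k (lshift n j)) => // Z _.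
by rewrite mxE.
Qed.

Lemma open_phase_space : open phase_space.
Proof.
apply: open_by_ball => Z OZ.
have [r r0 rP] := (near_ballP _ _).1 (open_near oO OZ).
exists r => // Z' ZZ'; apply: rP; apply: le_lt_trans ZZ'.
apply/rV_norm_le => // j.
by have := coord_norm (Z' - Z) (lshift n j); rewrite !mxE.
Qed.

Lemma geodesic_field_Ck : Ck_on 1 phase_space geodesic_field.
Proof.
have oOO := open_phase_space.
apply/(Ck_on_mx _ _ oOO) => i j; rewrite ord1.
have cv (l : 'I_n) : Ck_on 1 phase_space (fun Z : 'rV[R]_(n + n) => Z 0 (rshift n l)) by exact: Ck_on_coord.
case: (split_ordP j) => l ->.
  by apply: Ck_on_eq (cv l) => // Z _; rewrite row_mxEl mxE.
have C (a b : 'I_n) : Ck_on 1 phase_space (fun Z : 'rV[R]_(n + n) =>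
   christoffel G (lsubmx Z) l a b * Z 0 (rshift n a) * Z 0 (rshift n b)).
  have Cc : Ck_on 1 phase_space (fun Z : 'rV[R]_(n + n) => christoffel G (lsubmx Z) l a b).
    exact: (Ck_on_comp oOO oO (fun Z OZ => OZ) (lsubmx_Ck 1 oOO) (christoffel_Ck 1 l a b)).
  exact: (Ck_onM oOO (Ck_onM oOO Cc (cv a)) (cv b)).
have S := Ck_onN oOO (Ck_on_sum oOO (fun a => Ck_on_sum oOO (C a))).
apply: Ck_on_eq S => // Z _.
rewrite row_mxEr mxE mxE connection_mul; congr (- _).
by apply: eq_bigr => a _; apply: eq_bigr => b _; rewrite !mxE.
Qed.

Lemma geodesic_exists x0 v0 : O x0 -> exists (T : R) (X V : R -> 'rV[R]_n),
  [/\ 0 < T, X 0 = x0, V 0 = v0 &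
   forall t : R, `|t| < T -> [/\ O (X t), is_derive t 1 X (V t) &
     is_derive t 1 V (- (connection G (X t) (V t) *m (V t)^T)^T)]].
Proof.
move=> Ox0; have OZ : phase_space (row_mx x0 v0) by rewrite /phase_space /= row_mxKl.
have [T [u [T0 u0 Hu]]] := picard_C1 open_phase_space geodesic_field_Ck OZ.
exists T, (fun t => lsubmx (u t)), (fun t => rsubmx (u t)); split=> //.
- by rewrite u0 row_mxKl.
- by rewrite u0 row_mxKr.
move=> t tT; have [Ou du] := Hu t tT; split=> //.
- apply: is_derive_mx => i j; rewrite ord1.
  have -> : (fun s => lsubmx (u s) 0 j) = fun s => u s 0 (lshift n j).
    by apply/funext => s; rewrite mxE.
  have := is_derive_entry 0 (lshift n j) du.
  by rewrite /geodesic_field row_mxEl.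
- apply: is_derive_mx => i j; rewrite ord1.
  have -> : (fun s => rsubmx (u s) 0 j) = fun s => u s 0 (rshift n j).
    by apply/funext => s; rewrite mxE.
  have := is_derive_entry 0 (rshift n j) du.
  by rewrite /geodesic_field row_mxEr.
Qed.

End GeodesicExistence.

Section CurveCoordinates.
Variables (R : realType) (n : nat).

(** Passes from derivatives of curves in the space of rows to the iterated
    real derivatives of their coordinates. *)
Lemma curve_second_order (F F1 : R -> 'rV[R]_n) (F2 : 'rV[R]_n) (t : R) (k : 'I_n) :
  (\forall s \near t, is_derive (s : R) 1 F (F1 s)) -> is_derive t 1 F1 F2 ->
  [/\ derivable (fun s => F s 0 k) t 1, derivable (derive1 (fun s => F s 0 k)) t 1,
      derive1 (fun s => F s 0 k) t = F1 t 0 k &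
      derive1n 2 (fun s => F s 0 k) t = F2 0 k].
Proof.
move=> dF dF1.
have E : \forall s \near t, F1 s 0 k = derive1 (fun s => F s 0 k) s.
  apply: filterS dF => s /(is_derive_entry 0 k)[_ <-].
  by rewrite derive1E.
have D := near_eq_is_derive E (is_derive_entry 0 k dF1).
have [D1 E1] := is_derive_entry 0 k (nbhs_singleton dF).
split; [exact: D1 | by have [] := D | by rewrite derive1E |].
by rewrite derive1nS derive1n1 derive1E; have [] := D.
Qed.

End CurveCoordinates.

(** * Equivalent metrics have projectively related connections *)

Section Reparametrization.
Variables (R : realType) (n : nat).

Lemma reparam_entry (a q : R) (v : 'rV[R]_n) (C : 'cV[R]_n) k :
  (a *: v + q *: (q *: (- C^T))) 0 k = a * v 0 k - q ^+ 2 * C k 0.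
Proof. by rewrite !mxE; ring. Qed.

Lemma scale_col_entry (mu : R) (v : 'rV[R]_n) (B C : 'cV[R]_n) k :
  ((B - C) k 0 = (mu *: v^T) k 0) = (B k 0 - C k 0 = mu * v 0 k).
Proof. by rewrite !mxE. Qed.

Lemma reparam_cancel (q p b a w : R) : q != 0 ->
  p * w - q ^+ 2 * a + q ^+ 2 * b = 0 -> b - a = - (p / q ^+ 2) * w.
Proof.
move=> q0 E; apply: (mulfI (expf_neq0 2 q0)).
have -> : q ^+ 2 * (- (p / q ^+ 2) * w) = - (p * w) by field.
lra.
Qed.

End Reparametrization.

Section Charts.
Variables (R : realType) (n : nat) (M : smooth_manifold R n).
Implicit Types (c : chart R n M) (g : metric M).

Lemma chart_invK c x : (c @` cdom c) x -> c (cinv c x) = x /\ cdom c (cinv c x).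
Proof. by move=> [p pc <-]; rewrite cfunK. Qed.

Definition local_metric g c (x : 'rV[R]_n) : 'M[R]_n := g c (cinv c x).

Lemma chart_at_inv c x : atlas c -> (c @` cdom c) x -> chart_at (cinv c x) c.
Proof. by move=> ac /chart_invK[_ ?]. Qed.

Lemma local_metric_sym g c x : atlas c -> (c @` cdom c) x ->
  (local_metric g c x)^T = local_metric g c x.
Proof. by move=> ac Ox; apply: gcoef_sym; exact: chart_at_inv. Qed.

Lemma local_metric_unit g c x : atlas c -> (c @` cdom c) x ->
  local_metric g c x \in unitmx.
Proof. by move=> ac Ox; apply: gcoef_nondegenerate; exact: chart_at_inv. Qed.

Lemma local_metric_smooth g c : atlas c -> smooth_on (c @` cdom c) (local_metric g c).
Proof. exact: gcoef_smooth. Qed.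

Definition overlap c c' : set 'rV[R]_n := c @` (cdom c `&` cdom c').

Lemma overlap_intro c c' x : (c @` cdom c) x -> cdom c' (cinv c x) -> overlap c c' x.
Proof.
by move=> Ox c'x; have [E cx] := chart_invK Ox; exists (cinv c x).
Qed.

Lemma overlap_sub c c' : overlap c c' `<=` c @` cdom c.
Proof. by move=> _ [p [pc _] <-]; exists p. Qed.

Lemma overlap_inv c c' x : overlap c c' x -> cdom c' (cinv c x).
Proof. by move=> [p [pc pc'] <-]; rewrite cfunK. Qed.

Lemma open_overlap c c' : open (overlap c c').
Proof.
apply: open_by_ball => x Vx.
have Ox := overlap_sub Vx; have c'x := overlap_inv Vx.
have N1 := open_near (@cimg_open _ _ _ c) Ox.
have N2 : \forall y \near x, cdom c' (cinv c y).
  have := cinv_continuous Ox; apply; exact: (open_near (@cdom_open _ _ _ c') c'x).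
have [r r0 rP] := (near_ballP _ _).1 (near_and N1 N2).
by exists r => // y /rP[Oy c'y]; exact: overlap_intro.
Qed.

Lemma transition_img c c' x : overlap c c' x -> (c' @` cdom c') (transition c c' x).
Proof. by move=> /overlap_inv c'x; exists (cinv c x). Qed.

Lemma local_metric_tensor g c c' x : atlas c -> atlas c' -> overlap c c' x ->
  local_metric g c x = jacobian (transition c c') x
     *m local_metric g c' (transition c c' x) *m (jacobian (transition c c') x)^T.
Proof.
move=> ac ac' Vx; have Ox := overlap_sub Vx; have c'x := overlap_inv Vx.
have c'at : chart_at (cinv c x) c' by split.
have E := gcoef_tensor g (chart_at_inv ac Ox) c'at.
rewrite /transition_jacobian (chart_invK Ox).1 in E.
have E2 : cinv c' (transition c c' x) = cinv c x by apply: cfunK.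
by rewrite /local_metric E2; exact: E.
Qed.

(** A solution of the equation of geodesics in the chart [c] is a geodesic of
    the manifold; the equation has to be verified in every chart [c'] around
    its points, which is [geodesic_transform] for the transition map. *)
Lemma curve_geodesic g c (X V : R -> 'rV[R]_n) (T : R) : atlas c ->
  (forall t : R, `|t| < T -> [/\ (c @` cdom c) (X t), is_derive t 1 X (V t) &
     is_derive t 1 V (- (connection (local_metric g c) (X t) (V t) *m (V t)^T)^T)]) ->
  is_geodesic g [set t : R | `|t| < T] (cinv c \o X).
Proof.
move=> ac HX; split.
  move=> t /= /HX[Ot dX _]; apply: continuous_comp; first exact: is_derive_continuous dX.
  exact: cinv_continuous.
move=> t c' /= tT [ac' c't] k.
have [Ot dX dV] := HX t tT.
set tau := transition c c'.
have Vt : overlap c c' (X t) by exact: overlap_intro.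
have stau : smooth_on (overlap c c') tau by exact: atlas_compatible.
have oV := @open_overlap c c'.
pose F s := tau (X s); pose F1 s := V s *m jacobian tau (X s).
pose A := - (connection (local_metric g c) (X t) (V t) *m (V t)^T)^T.
pose F2 := A *m jacobian tau (X t) + V t *m 'D_(V t) (jacobian tau) (X t).
have NX : \forall s \near t, overlap c c' (X s).
  have := is_derive_continuous dX; apply; exact: (open_near oV Vt).
have NT : \forall s \near t, `|s - 0| < T by apply: near_norm_ball; rewrite subr0.
have dF : \forall s \near t, is_derive (s : R) 1 F (F1 s).
  apply: filterS (near_and NX NT) => s [Vs]; rewrite subr0 => sT.
  have [_ dXs _] := HX s sT.
  have D := is_derive_along (smooth_differentiable oV stau Vs) dXs.
  by rewrite /F1 -(derive_jacobian oV stau _ Vs).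
have dF1 : is_derive t 1 F1 F2.
  have dJ := is_derive_along (Ck_on_differentiable_mx oV (jacobian_Ck oV stau 1) Vt) dX.
  exact: (is_derive_mulmx dV dJ).
have EF1 j : derive1 (fun s => F s 0 j) t = F1 t 0 j.
  by have [] := curve_second_order j dF dF1.
have [d1 d2 _ d4] := curve_second_order k dF dF1.
have Ec j : coordinate c' (cinv c \o X) j = (fun s => F s 0 j) by [].
split.
- by rewrite Ec; exact: d1.
- by rewrite Ec; exact: d2.
have Ex : c' ((cinv c \o X) t) = tau (X t) by [].
have geo : A^T + connection (local_metric g c) (X t) (V t) *m (V t)^T = 0.
  by rewrite /A linearN /= trmxK addNr.
have := @geodesic_transform R n (c @` cdom c) (overlap c c') (c' @` cdom c')
  (local_metric g c) (local_metric g c') tau (@cimg_open _ _ _ c) (local_metric_smooth g ac)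
  (fun x => local_metric_sym g ac) (fun x => local_metric_unit g ac)
  (@cimg_open _ _ _ c') (local_metric_smooth g ac')
  (fun x => local_metric_sym g ac') (fun x => local_metric_unit g ac')
  oV (@overlap_sub c c') stau (@transition_img c c')
  (fun x => local_metric_tensor g ac ac') (X t) (V t) A Vt geo.
move=> /colP/(_ k); rewrite [in X in X -> _]mxE [in X in _ = X -> _]mxE connection_mul mxE.
move=> E; rewrite -[RHS]E; congr (_ + _); first by rewrite Ec; exact: d4.
apply: eq_bigr => i _; apply: eq_bigr => j _.
by rewrite !Ec !EF1.
Qed.

Lemma reparametrization_id (T : R) :
  reparametrization [set t : R | `|t| < T] [set t : R | `|t| < T] id.
Proof.
split.
- have := @open_norm_ball R R 0 T.
  by congr open; apply/funext => t /=; rewrite subr0.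
- move=> x y /= xT yT z /andP[xz zy].
  move: xT yT; rewrite !ltr_norml => /andP[x1 x2] /andP[y1 y2].
  by rewrite (lt_le_trans x1 xz) (le_lt_trans zy y2).
- have D1 : derive1 (id : R -> R) = cst 1 by apply/funext => t; rewrite derive1_id.
  have D0 (a : R) : derive1 (cst a : R -> R) = cst 0 by apply/funext => t; rewrite derive1_cst.
  case=> [|k] t _; first exact: derivable_id.
  rewrite derive1Sn D1.
  have [a ->] : exists a : R, derive1n k (cst 1 : R -> R) = cst a.
    elim: k => [|k [a IH]]; first by exists 1.
    by rewrite derive1nS IH; exists 0; exact: D0.
  exact: derivable_cst.
- by move=> t _; rewrite derive1_id oner_eq0.
- by apply/seteqP; split => [_ [t tT <-] //|t tT]; exists t.
Qed.

(** Take the geodesic of [g] through [x0] with velocity [v]. After a change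
    of parameter [phi] it is a geodesic of [gbar], and comparing both
    equations at [x0] leaves the term with the second derivative of [phi],
    which is parallel to [v]. *)
Theorem projective_relation g gbar c x0 (v : 'rV[R]_n) :
  geodesically_equivalent g gbar -> atlas c -> (c @` cdom c) x0 ->
  exists mu, connection (local_metric gbar c) x0 v *m v^T
    - connection (local_metric g c) x0 v *m v^T = mu *: v^T.
Proof.
move=> geq ac Ox0.
have [T [X [V [T0 X0 V0 HX]]]] := geodesic_exists (@cimg_open _ _ _ c)
  (local_metric_smooth g ac) (fun x => local_metric_unit g ac) v Ox0.
have geo := curve_geodesic ac HX.
pose I := [set t : R | `|t| < T].
have : is_unparametrized_geodesic g I (cinv c \o X).
  by exists I, id; split; [exact: reparametrization_id | exact: geo].
move=> /(geq I (cinv c \o X)).1 [J [phi [[oJ _ sphi nphi imphi] [_ gb]]]].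
have I0 : I 0 by rewrite /I /= normr0.
have [s0 Js0 phis0] : (phi @` J) 0 by rewrite imphi.
have phiI s : J s -> I (phi s) by move=> Js; rewrite -imphi; exists s.
have chs0 : chart_at ((cinv c \o X \o phi) s0) c.
  by rewrite /= phis0 X0; exact: chart_at_inv.
have gb0 := gb s0 c Js0 chs0.
pose p1 := derive1 phi.
have dphi s : J s -> is_derive s 1 phi (p1 s).
  by move=> Js; apply: DeriveDef; [exact: (sphi 0%N) | rewrite /p1 derive1E].
have dp1 : is_derive s0 1 p1 (derive1 p1 s0).
  by apply: DeriveDef; [exact: (sphi 1%N s0 Js0) | rewrite derive1E].
set p2 := derive1 p1 s0 in dp1.
pose F s := X (phi s); pose F1 s := p1 s *: V (phi s).
have dF s : J s -> is_derive s 1 F (F1 s).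
  move=> Js; have [_ dX _] := HX _ (phiI _ Js).
  exact: is_derive_reparam (dphi s Js) dX.
pose A := - (connection (local_metric g c) x0 v *m v^T)^T.
have dF1 : is_derive s0 1 F1 (p2 *: v + p1 s0 *: (p1 s0 *: A)).
  have [_ _ dV] := HX _ (phiI _ Js0).
  rewrite phis0 X0 V0 in dV.
  have dVp : is_derive s0 1 (V \o phi) (p1 s0 *: A).
    by apply: is_derive_reparam (dphi s0 Js0) _; rewrite phis0.
  by have := is_derive_scalemx dp1 dVp; rewrite /= phis0 V0.
have dFn : \forall s \near s0, is_derive (s : R) 1 F (F1 s).
  by apply: filterS (open_near oJ Js0) => s; exact: dF.
have Ec j : \forall s \near s0, F s 0 j = coordinate c (cinv c \o X \o phi) j s.
  apply: filterS (open_near oJ Js0) => s Js; rewrite /coordinate /=.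
  by have [Ox _ _] := HX _ (phiI _ Js); rewrite (chart_invK Ox).1.
have Ed j : \forall s \near s0, derive1 (fun s => F s 0 j) s
     = derive1 (coordinate c (cinv c \o X \o phi) j) s.
  apply: filterS (near_join (Ec j)) => s Es.
  by rewrite !derive1E; exact: near_eq_derive.
have cx0 : c ((cinv c \o X \o phi) s0) = x0 by rewrite /= phis0 X0 (chart_invK Ox0).1.
(* The second derivative of [X \o phi] consists of the part along the
   velocity, with the factor [p2], and the acceleration [A] of [X], which
   the equation for [g] determines. *)
have eq k : (p2 *: v + p1 s0 *: (p1 s0 *: A)) 0 k
    + \sum_i \sum_j christoffel (local_metric gbar c) x0 k i j * (p1 s0 * v 0 i) * (p1 s0 * v 0 j) = 0.
  have [_ _ H] := gb0 k; rewrite -[RHS]H; congr (_ + _).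
    have [_ _ _ <-] := curve_second_order k dFn dF1.
    rewrite !derive1nS !derive1n0 derive1E [RHS]derive1E.
    by apply: near_eq_derive; exact: Ed.
  apply: eq_bigr => i _; apply: eq_bigr => j _.
  rewrite -!(nbhs_singleton (Ed _)) cx0.
  have [_ _ -> _] := curve_second_order i dFn dF1.
  have [_ _ -> _] := curve_second_order j dFn dF1.
  by rewrite /F1 phis0 V0 !mxE.
have p1n0 : p1 s0 != 0 by exact: nphi.
exists (- (p2 / p1 s0 ^+ 2)); apply/colP => k.
have := eq k.
have -> : \sum_i \sum_j christoffel (local_metric gbar c) x0 k i j * (p1 s0 * v 0 i) * (p1 s0 * v 0 j)
   = p1 s0 ^+ 2 * (connection (local_metric gbar c) x0 v *m v^T) k 0.
  rewrite connection_mul mulr_sumr; apply: eq_bigr => i _; rewrite mulr_sumr.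
  by apply: eq_bigr => j _; ring.
rewrite /A reparam_entry => E; rewrite scale_col_entry.
exact: reparam_cancel p1n0 E.
Qed.

End Charts.

(** * The structure equation *)

Section RealRoot.
Variable R : realType.

Lemma powR_predE (a t : R) : 0 < t -> t `^ (a - 1) = t `^ a / t.
Proof. move=> t0; rewrite powRB; first by rewrite powRr1 // ltW.
by rewrite (gt_eqF t0) implybT. Qed.

(** On each half line the real root is, up to sign, a power function; this
    covers both signs of the ratio of determinants. *)
Lemma is_derive_real_root (m : nat) (t : R) : t != 0 ->
  is_derive t 1 (real_root m) (real_root m t * (m%:R^-1 / t)).
Proof.
move=> t0; set a := (m%:R^-1 : R).
have [tp|tn] : 0 < t \/ t < 0 by move: t0; rewrite neq_lt => /orP[]; [right|left].
  have N : \forall s \near t, s `^ a = real_root m s.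
    have : \forall s \near t, 0 < s by exact: lt_nbhsr.
    by apply: filterS => s s0; rewrite /real_root gtr0_sg // mul1r gtr0_norm.
  have := near_eq_is_derive N (is_derive1_powR a tp).
  move/is_derive_eq; apply.
  by rewrite /real_root gtr0_sg // mul1r gtr0_norm // powR_predE // -/a mulrCA.
have N : \forall s \near t, - ((- s) `^ a) = real_root m s.
  have : \forall s \near t, s < 0 by exact: lt_nbhsl.
  by apply: filterS => s s0; rewrite /real_root ltr0_sg // mulN1r ltr0_norm.
have tn' : 0 < - t by rewrite oppr_gt0.
have d1 := is_derive_reparam (is_deriveNid t (1 : R)) (is_derive1_powR a tn').
have := near_eq_is_derive N (is_deriveN d1); move/is_derive_eq; apply.
rewrite /real_root ltr0_sg // ltr0_norm // powR_predE // -/a.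
by rewrite -[_ *: _]/(_ * _) invrN; ring.
Qed.

Lemma real_root_neq0 m (t : R) : t != 0 -> real_root m t != 0.
Proof.
move=> t0; rewrite /real_root mulf_neq0 ?sgr_eq0 // gt_eqF // powR_gt0 //.
by rewrite normr_gt0.
Qed.

Lemma is_derive_scalar_comp (V : normedModType R) (f : V -> R) (g : R -> R) (x v : V) (g' : R) :
  differentiable f x -> is_derive (f x) 1 g g' ->
  is_derive x v (g \o f) ('D_v f x * g').
Proof.
move=> Df [dg <-]; have Dg := (derivable1_diffP _ _).1 dg.
have D := differentiable_comp Df Dg.
apply: DeriveDef; first exact: diff_derivable.
by rewrite deriveE // diff_comp //= (deriv1E dg) derive1E (deriveE _ Df).
Qed.

Lemma Ck_on_real_root n (U : set 'rV[R]_n) (oU : open U) m k (f : 'rV[R]_n -> R) :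
  (forall x, U x -> f x != 0) -> smooth_on U f -> Ck_on k U (real_root m \o f).
Proof.
move=> f0 sf.
have df x (Ux : U x) : differentiable f x by exact: Ck_on_differentiable (sf 1) Ux.
have dr x v (Ux : U x) := is_derive_scalar_comp v (df x Ux) (is_derive_real_root m (f0 x Ux)).
have cr x : U x -> {for x, continuous (real_root m \o f)}.
  move=> Ux; apply: continuous_comp; first exact: Ck_on_continuous (sf 0) Ux.
  exact: is_derive_continuous (is_derive_real_root m (f0 x Ux)).
elim: k => [|k IH]; first by split.
split=> // i; split=> [x Ux|]; first by have [] := dr x (delta_mx 0 i) Ux.
have C1 : Ck_on k U ('D_(delta_mx 0 i) f) by exact: Ck_on_partial (sf k.+1).
have C2 := Ck_onM oU C1 (Ck_onM oU IH (Ck_onM oU (Ck_on_cst oU k (m%:R^-1 : R)) (Ck_onV oU f0 (sf k)))).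
apply: Ck_on_eq C2 => // x Ux.
by have [_ ->] := dr x (delta_mx 0 i) Ux.
Qed.

End RealRoot.

Section StructureAlgebra.
Variables (R : realType) (n : nat).

(** The derivative of [B^-1 G] along [a], after the derivatives of [B] and
    [G] are replaced by connection terms; [Cb] is the connection matrix of
    [B] in terms of [C], that of [G]. *)
Lemma inverse_metric_algebra (G B C : 'M[R]_n) (a phi : 'rV[R]_n) (s : R) :
  B \in unitmx ->
  let Cb := C + s%:M + a^T *m phi in let Bi := invmx B in
  - (Bi *m (Cb^T *m B + B *m Cb) *m Bi) *m G + Bi *m (C^T *m G + G *m C) =
  - (2 * s) *: (Bi *m G) - Bi *m phi^T *m (a *m G) - a^T *m (phi *m Bi *m G)
  + (Bi *m G *m C - C *m (Bi *m G)).
Proof.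
move=> uB Cb Bi.
have -> : Bi *m (Cb^T *m B + B *m Cb) *m Bi = Bi *m Cb^T + Cb *m Bi.
  by rewrite mulmxDr mulmxDl mulmxA mulmxK // mulKmx.
have -> : Cb^T = C^T + s%:M + phi^T *m a.
  by rewrite /Cb [LHS]linearD /= [X in X + _]linearD /= tr_scalar_mx trmx_mul trmxK.
rewrite /Cb !(mulmxDr, mulmxDl) mul_mx_scalar mul_scalar_mx mulNmx.
rewrite !mulmxDl -!scalemxAl !mulmxA.
move: (Bi *m C^T *m G) (Bi *m G) (Bi *m phi^T *m a *m G) (a^T *m phi *m Bi *m G).
move=> X1 X2 X3 X4; move: (C *m Bi *m G) (Bi *m G *m C) => X5 X6.
by apply/matrixP => i j; rewrite !mxE; ring.
Qed.

End StructureAlgebra.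

Section Structure.
Variables (R : realType) (n : nat) (O : set 'rV[R]_n) (G B : 'rV[R]_n -> 'M[R]_n).
Hypotheses (oO : open O) (sG : smooth_on O G) (sB : smooth_on O B).
Hypothesis Gsym : forall x, O x -> (G x)^T = G x.
Hypothesis Gunit : forall x, O x -> G x \in unitmx.
Hypothesis Bsym : forall x, O x -> (B x)^T = B x.
Hypothesis Bunit : forall x, O x -> B x \in unitmx.
Hypothesis proj : forall x v, O x -> exists mu,
  connection B x v *m v^T - connection G x v *m v^T = mu *: v^T.

(** The difference tensor is symmetric as both connections are, so
    [pure_trace_of_parallel] applies to its values on pairs of basis vectors. *)
Lemma projective_connection x : O x -> exists phi : 'rV[R]_n, forall a,
  connection B x a = connection G x a + ((a *m phi^T) 0 0)%:M + a^T *m phi.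
Proof.
move=> Ox.
pose T i j : 'rV[R]_n := \row_k (christoffel B x k i j - christoffel G x k i j).
have Ts i j : T i j = T j i.
  apply/rowP => k; rewrite !mxE (christoffel_sym oO Bsym _ _ _ Ox).
  by rewrite (christoffel_sym oO Gsym _ _ _ Ox).
have TQ (v : 'rV[R]_n) : exists mu, \sum_i \sum_j (v 0 i * v 0 j) *: T i j = mu *: v.
  have [mu E] := proj v Ox; exists mu; apply/rowP => k.
  move/colP: E => /(_ k); rewrite [in X in X -> _]mxE [in X in _ = X -> _]mxE [in X in _ + X]mxE.
  rewrite !connection_mul [v^T k 0]mxE => E; rewrite [RHS]mxE -E.
  rewrite summxE -sumrB; apply: eq_bigr => i _; rewrite summxE -sumrB.
  by apply: eq_bigr => j _; rewrite !mxE; ring.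
have [p Hp] := pure_trace_of_parallel Ts TQ.
exists (\row_i p i) => a; apply/matrixP => k j.
have -> : (a *m (\row_i p i)^T) 0 0 = \sum_i a 0 i * p i.
  by rewrite mxE; apply: eq_bigr => i _; rewrite !mxE.
rewrite [RHS]mxE [X in _ = X + _]mxE [X in _ + X + _]mxE.
have -> : (a^T *m (\row_i p i)) k j = a 0 k * p j by rewrite mxE big_ord1 !mxE.
have E i : christoffel B x k i j = christoffel G x k i j + (p i * (k == j)%:R + p j * (k == i)%:R).
  have := congr1 (fun v : 'rV[R]_n => v 0 k) (Hp i j); rewrite !mxE eqxx /= => <-.
  by rewrite addrC subrK.
have -> : connection B x a k j = \sum_i (christoffel G x k i j * a 0 i
    + (a 0 i * p i) * (k == j)%:R + p j * ((k == i)%:R * a 0 i)).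
  by rewrite mxE; apply: eq_bigr => i _; rewrite E; ring.
rewrite !big_split /= -mulr_suml -mulr_sumr.
have -> : \sum_i (k == i)%:R * a 0 i = a 0 k.
  rewrite (bigD1 k) //= eqxx mul1r big1 ?addr0 // => i ik.
  by rewrite eq_sym (negbTE ik) mul0r.
have -> : connection G x a k j = \sum_i christoffel G x k i j * a 0 i by rewrite mxE.
by rewrite mulr_natr (mulrC (p j)).
Qed.

End Structure.

Section Benenti.
Variables (R : realType) (n : nat) (O : set 'rV[R]_n) (G B : 'rV[R]_n -> 'M[R]_n).
Hypotheses (oO : open O) (sG : smooth_on O G) (sB : smooth_on O B).
Hypothesis Gsym : forall x, O x -> (G x)^T = G x.
Hypothesis Gunit : forall x, O x -> G x \in unitmx.
Hypothesis Bsym : forall x, O x -> (B x)^T = B x.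
Hypothesis Bunit : forall x, O x -> B x \in unitmx.
Hypothesis proj : forall x v, O x -> exists mu,
  connection B x v *m v^T - connection G x v *m v^T = mu *: v^T.
Variable rho : 'rV[R]_n -> R.
Hypotheses (srho : smooth_on O rho) (rho0 : forall x, O x -> rho x != 0).

Definition weighted_quotient x : 'M[R]_n := rho x *: (invmx (B x) *m G x).
Local Notation L := weighted_quotient.

Lemma weighted_quotient_smooth : smooth_on O L.
Proof.
move=> k; apply: Ck_on_scalemx => //; apply: Ck_on_mulmx => //.
exact: Ck_on_invmx.
Qed.

Lemma weighted_quotient_selfadjoint x : O x -> (G x *m L x)^T = G x *m L x.
Proof.
move=> Ox; rewrite /L -scalemxAr linearZ /= !trmx_mul trmx_inv (Gsym Ox) (Bsym Ox).
by rewrite mulmxA.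
Qed.

Lemma derive_invmx x a : O x ->
  'D_a (fun y => invmx (B y)) x = - (invmx (B x) *m 'D_a B x *m invmx (B x)).
Proof.
move=> Ox.
have iB : Ck_on 1 O (fun y => invmx (B y)) by apply: Ck_on_invmx.
have dB := is_derive_of_differentiable a (Ck_on_differentiable_mx oO (sB 1) Ox).
have diB := is_derive_of_differentiable a (Ck_on_differentiable_mx oO iB Ox).
have D := is_derive_mulmx dB diB.
have N : \forall y \near x, B y *m invmx (B y) = cst 1%:M y.
  by apply: filterS (open_near oO Ox) => y Oy; rewrite mulmxV // Bunit.
have [_ E] := near_eq_is_derive N D.
rewrite derive_cst in E; move/(congr1 (mulmx (invmx (B x)))): E.
rewrite mulmx0 mulmxDr mulKmx ?Bunit // mulmxA => /eqP.
by rewrite eq_sym addrC addr_eq0 => /eqP.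
Qed.

(** Both metrics are parallel for their own connections, and the connections
    differ by [phi]; so the derivative of [B^-1 G] is a commutator with the
    connection of [G], a multiple, and two terms of rank one. The weight
    [rho] only adds to the multiple. *)
Lemma structure_equation x : O x -> exists (s : 'rV[R]_n -> R) (mu : 'cV[R]_n) (psi : 'rV[R]_n),
  forall a, 'D_a L x = s a *: L x + mu *m (a *m G x) + a^T *m psi
    + (L x *m connection G x a - connection G x a *m L x).
Proof.
move=> Ox; have [phi Hphi] := projective_connection oO Gsym Bsym proj Ox.
exists (fun a => 'D_a rho x / rho x - 2 * (a *m phi^T) 0 0).
exists (- (rho x *: (invmx (B x) *m phi^T))), (- (rho x *: (phi *m invmx (B x) *m G x))) => a.
have iB : Ck_on 1 O (fun y => invmx (B y)) by apply: Ck_on_invmx.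
have dG := is_derive_of_differentiable a (Ck_on_differentiable_mx oO (sG 1) Ox).
have diB := is_derive_of_differentiable a (Ck_on_differentiable_mx oO iB Ox).
have drho := is_derive_of_differentiable a (Ck_on_differentiable oO (srho 1) Ox).
have [_ ->] := is_derive_scalemx drho (is_derive_mulmx diB dG).
rewrite derive_invmx // (connection_compat oO sB Bsym Bunit a Ox).
rewrite (connection_compat oO sG Gsym Gunit a Ox) Hphi.
rewrite inverse_metric_algebra; last exact: Bunit.
have r0 := rho0 Ox.
rewrite /L; move: (invmx (B x) *m G x) ('D_a rho x) ((a *m phi^T) 0 0) (connection G x a).
move: (rho x) r0 => r r0 K dr s C.
rewrite !mulNmx !mulmxN -!scalemxAl -!scalemxAr !scalerDr !scalerN !scalerA.
have e1 : (dr / r - 2 * s) * r = dr - 2 * s * r by field.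
rewrite e1.
move: (invmx (B x) *m phi^T *m (a *m G x)) (a^T *m (phi *m invmx (B x) *m G x)) => X1 X2.
move: (C *m K) (K *m C) => X3 X4.
by apply/matrixP => i j; rewrite !mxE; ring.
Qed.

End Benenti.

(** * Involutivity of the kernel of a polynomial in L *)

(** One step of the induction in [power_bracket], with the derivatives
    replaced by arbitrary matrices: the structure equation is substituted,
    and the terms with [mu] cancel by the first hypothesis. *)
Lemma bracket_step (R : comPzRingType) m (sv sw : R) (mu : 'cV[R]_m) (psi : 'rV[R]_m)
    (L P G Cv Cw Av Aw : 'M[R]_m) (v w : 'rV[R]_m) (d : 'cV[R]_m) :
  v *m G *m (P *m w^T) = w *m G *m (P *m v^T) ->
  Av *m w^T - Aw *m v^T = d - Cv *m (P *m w^T) + Cw *m (P *m v^T) ->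
  ((sv *: L + mu *m (v *m G) + v^T *m psi + (L *m Cv - Cv *m L)) *m P + L *m Av) *m w^T
  - ((sw *: L + mu *m (w *m G) + w^T *m psi + (L *m Cw - Cw *m L)) *m P + L *m Aw) *m v^T
  = sv *: (L *m (P *m w^T)) - sw *: (L *m (P *m v^T))
    + v^T *m (psi *m (P *m w^T)) - w^T *m (psi *m (P *m v^T)) + L *m d
    - Cv *m (L *m P *m w^T) + Cw *m (L *m P *m v^T).
Proof.
move=> sym IH.
have IH' : L *m (Av *m w^T) = L *m (Aw *m v^T) + L *m d
   - L *m (Cv *m (P *m w^T)) + L *m (Cw *m (P *m v^T)).
  have -> : Av *m w^T = Aw *m v^T + (d - Cv *m (P *m w^T) + Cw *m (P *m v^T)).
    by rewrite -IH addrC subrK.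
  by rewrite !mulmxDr mulmxN !addrA.
have E (a : R) (u x : 'rV[R]_m) (C A : 'M[R]_m) :
   ((a *: L + mu *m (u *m G) + u^T *m psi + (L *m C - C *m L)) *m P + L *m A) *m x^T
   = a *: (L *m (P *m x^T)) + mu *m (u *m G *m (P *m x^T)) + u^T *m (psi *m (P *m x^T))
     + (L *m (C *m (P *m x^T)) - C *m (L *m P *m x^T)) + L *m (A *m x^T).
  by rewrite !(mulmxDl, mulNmx) -!scalemxAl !mulmxA.
rewrite !E IH' sym.
move: (L *m (Aw *m v^T)) (mu *m _) (L *m d) => X1 X2 X3.
move: (L *m (Cv *m (P *m w^T))) (L *m (Cw *m (P *m v^T))) => X4 X5.
move: (Cv *m (L *m P *m w^T)) (Cw *m (L *m P *m v^T)) => X6 X7.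
move: (v^T *m (psi *m (P *m w^T))) (w^T *m (psi *m (P *m v^T))) => Y1 Y2.
move: (L *m (P *m w^T)) (L *m (P *m v^T)) => Y3 Y4.
apply/colP => i; rewrite !mxE; ring.
Qed.

Lemma bracket_term (R : comPzRingType) m (dv dw c : R) (P Dv Dw : 'M[R]_m)
    (v w : 'rV[R]_m) (d X Y : 'cV[R]_m) :
  Dv *m w^T - Dw *m v^T = d - X + Y ->
  - ((dv *: P + c *: Dv) *m w^T) + (dw *: P + c *: Dw) *m v^T
  = - (dv *: (P *m w^T) - dw *: (P *m v^T) + c *: d) + (c *: X - c *: Y).
Proof.
move=> E; rewrite !mulmxDl -!scalemxAl.
have -> : Dv *m w^T = Dw *m v^T + (d - X + Y) by rewrite -E addrC subrK.
move: (Dw *m v^T) (P *m w^T) (P *m v^T) => X1 X2 X3.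
apply/colP => i; rewrite !mxE; ring.
Qed.

Lemma bracket_sum (R : comPzRingType) m N (dv dw c : 'I_N -> R)
    (P Dv Dw : 'I_N -> 'M[R]_m) (v w : 'rV[R]_m) (d X Y : 'I_N -> 'cV[R]_m) :
  (forall k, Dv k *m w^T - Dw k *m v^T = d k - X k + Y k) ->
  \sum_k c k *: X k = 0 -> \sum_k c k *: Y k = 0 ->
  - ((\sum_k (dv k *: P k + c k *: Dv k)) *m w^T)
  + (\sum_k (dw k *: P k + c k *: Dw k)) *m v^T
  = - \sum_k (dv k *: (P k *m w^T) - dw k *: (P k *m v^T) + c k *: d k).
Proof.
move=> E EX EY.
transitivity (- \sum_k (dv k *: (P k *m w^T) - dw k *: (P k *m v^T) + c k *: d k)
  + (\sum_k c k *: X k - \sum_k c k *: Y k)); last by rewrite EX EY subrr addr0.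
rewrite !mulmx_suml -!sumrN -!big_split; apply: eq_bigr => k _ /=.
exact: bracket_term.
Qed.

Section Involutive.
Variables (R : realType) (n : nat) (x0 : 'rV[R]_n.+1).
Variables (L : 'rV[R]_n.+1 -> 'M[R]_n.+1) (G : 'M[R]_n.+1) (C : 'rV[R]_n.+1 -> 'M[R]_n.+1).
Variables (s : 'rV[R]_n.+1 -> R) (mu : 'cV[R]_n.+1) (psi : 'rV[R]_n.+1).
Hypothesis dL : differentiable L x0.
Hypothesis Gsym : G^T = G.
Hypothesis GLsym : (G *m L x0)^T = G *m L x0.
Hypothesis Csym : forall a u, C a *m u^T = C u *m a^T.
(** The conclusion of [structure_equation] at the point [x0]. *)
Hypothesis Lstr : forall a, 'D_a L x0 = s a *: L x0 + mu *m (a *m G) + a^T *m psi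
    + (L x0 *m C a - C a *m L x0).

Lemma derive_exprS k a : derivable (fun y => L y ^+ k) x0 a /\
  'D_a (fun y => L y ^+ k.+1) x0 =
   'D_a L x0 *m L x0 ^+ k + L x0 *m 'D_a (fun y => L y ^+ k) x0.
Proof.
have D := is_derive_of_differentiable a dL.
have E j : (fun y => L y ^+ j.+1) = (fun y => L y *m L y ^+ j).
  by apply/funext => y; rewrite exprS.
have H j : derivable (fun y => L y ^+ j) x0 a.
  elim: j => [|j IH].
    have -> : (fun y => L y ^+ 0) = cst 1 by apply/funext => y; rewrite expr0.
    exact: derivable_cst.
  by rewrite E; have [] := is_derive_mulmx D (DeriveDef IH erefl).
split; first exact: H.
by rewrite E; have [_ ->] := is_derive_mulmx D (DeriveDef (H k) erefl).
Qed.

Lemma selfadjoint_exp k : (G *m L x0 ^+ k)^T = G *m L x0 ^+ k.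
Proof.
have LG : (L x0)^T *m G = G *m L x0 by rewrite -[RHS]GLsym trmx_mul Gsym.
elim: k => [|k IH]; first by rewrite expr0 mulmx1.
rewrite trmx_mul Gsym in IH.
rewrite trmx_mul Gsym [in LHS]exprSr [LHS](congr1 (mulmx^~ G) (trmx_mul _ _)).
by rewrite -mulmxA IH mulmxA LG -mulmxA exprS.
Qed.

Variables (N : nat) (coef : nat -> 'rV[R]_n.+1 -> R).
Definition poly_field y : 'M[R]_n.+1 := \sum_(k < N) coef k y *: L y ^+ k.
Local Notation E := (poly_field x0).

Lemma poly_field_comm k : E *m L x0 ^+ k = L x0 ^+ k *m E.
Proof.
rewrite /poly_field mulmx_suml mulmx_sumr; apply: eq_bigr => j _.
by rewrite -scalemxAl -scalemxAr -[_ *m _]/(_ * _) -[_ *m _ in RHS]/(_ * _) -!exprD addnC.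
Qed.

Lemma poly_field_ker k (u : 'cV[R]_n.+1) : E *m u = 0 -> E *m (L x0 ^+ k *m u) = 0.
Proof. by move=> Eu; rewrite mulmxA poly_field_comm -mulmxA Eu mulmx0. Qed.

(** Up to an element of the kernel of [E], the antisymmetrized derivative of
    the [k]-th power is given by the connection alone. In the induction the
    terms with [s] stay in the kernel because [L] commutes with [E], and
    those with [psi] are multiples of [v] and [w]. *)
Lemma power_bracket (v w : 'rV[R]_n.+1) k : E *m v^T = 0 -> E *m w^T = 0 ->
  exists d : 'cV[R]_n.+1, E *m d = 0 /\
   'D_v (fun y => L y ^+ k) x0 *m w^T - 'D_w (fun y => L y ^+ k) x0 *m v^T =
    d - C v *m (L x0 ^+ k *m w^T) + C w *m (L x0 ^+ k *m v^T).
Proof.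
move=> Ev Ew; elim: k => [|k [d [Ed IH]]].
  exists 0; rewrite mulmx0; split=> //.
  have -> : (fun y => L y ^+ 0) = cst 1 by apply/funext => y; rewrite expr0.
  by rewrite !derive_cst !mul0mx subrr !expr0 !mul1mx Csym add0r addNr.
pose Lw := L x0 ^+ k *m w^T; pose Lv := L x0 ^+ k *m v^T.
exists (s v *: (L x0 *m Lw) - s w *: (L x0 *m Lv) + v^T *m (psi *m Lw) - w^T *m (psi *m Lv) + L x0 *m d).
have Lk (u : 'cV[R]_n.+1) : L x0 *m (L x0 ^+ k *m u) = L x0 ^+ k.+1 *m u.
  by rewrite mulmxA exprS.
have scal (u : 'cV[R]_n.+1) (c : 'M[R]_1) : u *m c = c 0 0 *: u.
  by rewrite [c]mx11_scalar mul_mx_scalar mxE eqxx mulr1n.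
split.
  rewrite !mulmxDr !mulmxN -!scalemxAr !Lk !poly_field_ker // !scaler0 subrr add0r.
  rewrite !scal -!scalemxAr Ev Ew !scaler0 subrr add0r.
  by rewrite -[L x0]expr1 poly_field_ker.
have [_ ->] := derive_exprS k v; have [_ ->] := derive_exprS k w.
have symt : v *m G *m (L x0 ^+ k *m w^T) = w *m G *m (L x0 ^+ k *m v^T).
  rewrite [LHS]mx11_scalar [RHS]mx11_scalar; congr (_%:M).
  have F := mx_form_tr v w (selfadjoint_exp k).
  by rewrite !mulmxA in F *; rewrite F.
rewrite (Lstr v) (Lstr w) exprS.
exact: (bracket_step (s v) (s w) mu psi (L x0) symt IH).
Qed.

Hypothesis dcoef : forall k : 'I_N, differentiable (coef k) x0.
Variables (v w : 'rV[R]_n.+1 -> 'rV[R]_n.+1).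
Hypotheses (dv : differentiable v x0) (dw : differentiable w x0).
Hypothesis kv : \forall y \near x0, poly_field y *m (v y)^T = 0.
Hypothesis kw : \forall y \near x0, poly_field y *m (w y)^T = 0.

(** Differentiating [E w = 0] along [v] and [E v = 0] along [w] shows that
    [E] maps the bracket to the antisymmetrized derivative of [E]. By
    [power_bracket] this lies in the kernel: the connection terms add up to
    connection matrices applied to [E w] and [E v], hence vanish. *)
Lemma poly_field_bracket :
  E *m (E *m ('D_(v x0) w x0 - 'D_(w x0) v x0)^T) = 0.
Proof.
have Ev := nbhs_singleton kv; have Ew := nbhs_singleton kw.
pose P k a := 'D_a (fun y => L y ^+ k) x0.
have dE a : is_derive x0 a poly_field (\sum_(k < N) ('D_a (coef k) x0 *: L x0 ^+ k + coef k x0 *: P k a)).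
  apply: is_derive_sum_fun => k.
  apply: is_derive_scalemx; first exact: is_derive_of_differentiable.
  by apply: DeriveDef; [have [] := derive_exprS k a | ].
have key (u : 'rV[R]_n.+1 -> 'rV[R]_n.+1) a : differentiable u x0 ->
    (\forall y \near x0, poly_field y *m (u y)^T = 0) ->
    E *m ('D_a u x0)^T = - ((\sum_(k < N) ('D_a (coef k) x0 *: L x0 ^+ k + coef k x0 *: P k a)) *m (u x0)^T).
  move=> du ku.
  have D := is_derive_mulmx (dE a) (is_derive_trmx (is_derive_of_differentiable a du)).
  have Nz : \forall y \near x0, poly_field y *m (u y)^T = cst 0 y by exact: ku.
  have [_ E0] := near_eq_is_derive Nz D.
  by rewrite derive_cst in E0; apply/eqP; rewrite -addr_eq0 addrC -E0.
rewrite linearB /= mulmxBr (key _ _ dw kw) (key _ _ dv kv) opprK.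
have PB k : exists d : 'cV[R]_n.+1, E *m d = 0 /\
   P k (v x0) *m (w x0)^T - P k (w x0) *m (v x0)^T =
    d - C (v x0) *m (L x0 ^+ k *m (w x0)^T) + C (w x0) *m (L x0 ^+ k *m (v x0)^T).
  exact: power_bracket.
have [d Hd] := choice PB.
pose y := \sum_(k < N) (('D_(v x0) (coef k) x0 *: (L x0 ^+ k *m (w x0)^T)
   - 'D_(w x0) (coef k) x0 *: (L x0 ^+ k *m (v x0)^T)) + coef k x0 *: d k).
have Ey : E *m y = 0.
  rewrite mulmx_sumr big1 // => k _.
  rewrite mulmxDr mulmxBr -!scalemxAr !poly_field_ker // (Hd k).1.
  by rewrite !scaler0 subrr addr0.
have Ek (u : 'rV[R]_n.+1) (a : 'rV[R]_n.+1) : E *m u^T = 0 ->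
    \sum_(k < N) coef k x0 *: (C a *m (L x0 ^+ k *m u^T)) = 0.
  move=> Eu; transitivity (C a *m (E *m u^T)); last by rewrite Eu mulmx0.
  rewrite /poly_field mulmx_suml mulmx_sumr; apply: eq_bigr => k _.
  by rewrite -scalemxAl -scalemxAr.
suff -> : - ((\sum_(k < N) ('D_(v x0) (coef k) x0 *: L x0 ^+ k + coef k x0 *: P k (v x0)))
     *m (w x0)^T) + (\sum_(k < N) ('D_(w x0) (coef k) x0 *: L x0 ^+ k
     + coef k x0 *: P k (w x0))) *m (v x0)^T = - y by rewrite mulmxN Ey oppr0.
exact: (bracket_sum _ _ _ (fun k : 'I_N => (Hd k).2) (Ek _ (v x0) Ew) (Ek _ (w x0) Ev)).
Qed.

End Involutive.

(** * The kernel distribution and its integral manifolds *)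

Section MatrixFacts.
Variable R : realType.

(** A pair of bilinear forms defines an operator, whose matrix is conjugated
    when both Gram matrices undergo the same congruence. *)
Lemma quotient_transport n (r : R) (J G G' B B' : 'M[R]_n) : B \in unitmx -> B' \in unitmx ->
  G = J *m G' *m J^T -> B = J *m B' *m J^T ->
  J^T *m (r *: (invmx B *m G)) = (r *: (invmx B' *m G')) *m J^T.
Proof.
move=> uB uB' EG EB.
have uJ : J \in unitmx by move: uB; rewrite EB !unitmx_mul => /andP[/andP[]].
rewrite -scalemxAr -scalemxAl; congr (_ *: _); rewrite -mulmxA; apply: (can_inj (mulKmx uB')).
rewrite [RHS]mulmxA mulmxV // mul1mx; apply: (can_inj (mulKmx uJ)).
by rewrite !mulmxA -EB mulmxV // mul1mx.
Qed.

Lemma poly_mx_intertwine n (p : {poly R}) (K A B : 'M[R]_n.+1) :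
  K *m A = B *m K -> K *m poly_mx p A = poly_mx p B *m K.
Proof.
move=> E; rewrite /poly_mx mulmx_sumr mulmx_suml; apply: eq_bigr => k _.
rewrite -scalemxAr -scalemxAl; congr (_ *: _).
elim: (k : nat) => [|j IH]; first by rewrite !expr0 mulmx1 mul1mx.
rewrite [A ^+ j.+1]exprS [B ^+ j.+1]exprS -[A * _]/(A *m _) -[B * _]/(B *m _).
by rewrite [LHS]mulmxA E -[LHS]mulmxA -[RHS]mulmxA; congr (_ *m _).
Qed.

Lemma poly_mx_mul_char n (A : 'M[R]_n.+1) p q : char_poly A = p * q ->
  poly_mx p A *m poly_mx q A = 0.
Proof.
by move=> E; rewrite !poly_mxE -[_ *m _]/(_ * _) -rmorphM /= -E Cayley_Hamilton.
Qed.

Lemma poly_mx_comm n (A : 'M[R]_n.+1) p q :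
  poly_mx p A *m poly_mx q A = poly_mx q A *m poly_mx p A.
Proof. by rewrite !poly_mxE -![_ *m _]/(_ * _) -!rmorphM mulrC. Qed.

(** By Bezout, the identity is [a(A) p(A) + b(A) q(A)]. Applied to [p(A) u],
    the first part vanishes by hypothesis and the second one by Cayley and
    Hamilton. *)
Lemma poly_mx_ker_square n (A : 'M[R]_n.+1) p q (u : 'cV[R]_n.+1) :
  no_common_complex_root p q -> char_poly A = p * q ->
  poly_mx p A *m (poly_mx p A *m u) = 0 -> poly_mx p A *m u = 0.
Proof.
move=> /no_common_root_bezout[a [b E]] Apq ppu.
have E1 : 1%:M = poly_mx a A *m poly_mx p A + poly_mx b A *m poly_mx q A.
  by rewrite !poly_mxE -[1%:M](rmorph1 (horner_mx A)) -E rmorphD !rmorphM.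
rewrite -[LHS]mul1mx E1 mulmxDl -!mulmxA ppu mulmx0 add0r.
by rewrite (mulmxA (poly_mx q A)) poly_mx_comm poly_mx_mul_char // mul0mx mulmx0.
Qed.

(** The kernel of [p(A)] is the image of [q(A)]: one inclusion is
    Cayley-Hamilton, the other a Bezout relation. Rows of the right number
    that are independent in the image span it. *)
Lemma ker_row_space m n (A : 'M[R]_n.+1) p q (W : 'M[R]_(m, n.+1)) :
  no_common_complex_root p q -> char_poly A = p * q -> m = (size p).-1 ->
  row_free (W *m (poly_mx q A)^T) ->
  [set v : 'rV[R]_n.+1 | poly_mx p A *m v^T = 0] = row_space (W *m (poly_mx q A)^T).
Proof.
move=> ncr Apq Em fX; set Q := (poly_mx q A)^T.
have XQ : (W *m Q <= Q)%MS by exact: submxMl.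
have rQ : \rank Q = m by rewrite mxrank_tr poly_mxE (rank_real_factor ncr Apq) Em.
have QX : (Q <= W *m Q)%MS.
  by rewrite -(mxrank_leqif_sup XQ) rQ (eqP fX).
apply/seteqP; split => v /=.
  move=> pv; apply: submx_trans QX.
  have [a [b E]] := no_common_root_bezout ncr.
  have E1 : 1%:M = poly_mx q A *m poly_mx b A + poly_mx a A *m poly_mx p A.
    rewrite poly_mx_comm !poly_mxE -[1%:M](rmorph1 (horner_mx A)) -E rmorphD !rmorphM.
    exact: addrC.
  have -> : v = v *m (poly_mx b A)^T *m Q.
    rewrite -mulmxA -trmx_mul -[LHS]trmxK -[v^T]mul1mx E1 mulmxDl -!mulmxA pv mulmx0 addr0.
    by rewrite !trmx_mul trmxK mulmxA.
  exact: submxMl.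
move=> /submxP[a ->]; rewrite mulmxA trmx_mul /Q trmxK mulmxA poly_mx_mul_char //.
by rewrite mul0mx.
Qed.

Lemma row_free_selection m n (A : 'M[R]_n) : \rank A = m ->
  exists (W : 'M[R]_(m, n)), row_free (W *m A).
Proof.
move=> Em; subst m.
have /submxP[W E] : (row_base A <= A)%MS by rewrite eq_row_base.
by exists W; rewrite -E row_base_free.
Qed.

End MatrixFacts.

Section KernelDistribution.
Variables (R : realType) (n : nat) (M : smooth_manifold R n.+1) (g gbar : metric M).
Implicit Type c : chart R n.+1 M.

Definition local_tensor c (x : 'rV[R]_n.+1) : 'M[R]_n.+1 := L_tensor g gbar c (cinv c x).

Definition local_det_ratio c (x : 'rV[R]_n.+1) : R :=
  \det (local_metric gbar c x) / \det (local_metric g c x).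

(** The tensor [L] in a chart is a weighted quotient in the sense of the
    structure equation, with the real root of the ratio of determinants as
    its weight. *)
Lemma local_tensorE c : local_tensor c =
  weighted_quotient (local_metric g c) (local_metric gbar c) (real_root n.+2 \o local_det_ratio c).
Proof. by []. Qed.

Lemma local_det_neq0 (h : metric M) c x : atlas c -> (c @` cdom c) x ->
  \det (local_metric h c x) != 0.
Proof. by move=> ac Ox; rewrite -unitfE -unitmxE local_metric_unit. Qed.

Lemma local_det_ratio_neq0 c x : atlas c -> (c @` cdom c) x -> local_det_ratio c x != 0.
Proof.
by move=> ac Ox; rewrite mulf_eq0 invr_eq0 negb_or !local_det_neq0.
Qed.

Lemma local_det_ratio_smooth c : atlas c -> smooth_on (c @` cdom c) (local_det_ratio c).
Proof.
move=> ac k; have oO := @cimg_open _ _ _ c.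
have D h : Ck_on k (c @` cdom c) (fun x => \det (local_metric h c x)).
  by apply: (Ck_on_det oO); exact: local_metric_smooth.
apply: (Ck_onM oO); first exact: D.
by apply: (Ck_onV oO); [move=> x; exact: local_det_neq0 | exact: D].
Qed.

Lemma local_weight_smooth c : atlas c ->
  smooth_on (c @` cdom c) (real_root n.+2 \o local_det_ratio c).
Proof.
move=> ac k; apply: (Ck_on_real_root (@cimg_open _ _ _ c)).
  by move=> x; exact: local_det_ratio_neq0.
exact: local_det_ratio_smooth.
Qed.

Lemma local_tensor_smooth c : atlas c -> smooth_on (c @` cdom c) (local_tensor c).
Proof.
move=> ac; apply: (weighted_quotient_smooth (@cimg_open _ _ _ c)).
- exact: local_metric_smooth.
- exact: local_metric_smooth.
- by move=> x; exact: local_metric_unit.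
- exact: local_weight_smooth.
Qed.

Section OnePolynomial.
Variables (m : nat) (chi : M -> {poly R}).
Hypothesis schi : smooth_monic m chi.

Definition local_poly_mx c x : 'M[R]_n.+1 := poly_mx (chi (cinv c x)) (local_tensor c x).

(** The degree is constant, so the sum has a fixed number of terms with
    smooth coefficients. *)
Lemma local_poly_mxE c : local_poly_mx c =
  poly_field (local_tensor c) m.+1 (fun k x => (chi (cinv c x))`_k).
Proof. by apply/funext => x; rewrite /local_poly_mx /poly_mx (schi.1 _).2. Qed.

Lemma local_coef_smooth c k : atlas c ->
  smooth_on (c @` cdom c) (fun x => (chi (cinv c x))`_k).
Proof. exact: schi.2. Qed.

Lemma local_poly_mx_smooth c : atlas c -> smooth_on (c @` cdom c) (local_poly_mx c).
Proof.
move=> ac k; have oO := @cimg_open _ _ _ c.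
rewrite local_poly_mxE; apply: (Ck_on_sum oO) => j.
apply: (Ck_on_scalemx oO); first exact: local_coef_smooth.
elim: (j : nat) => [|i IH].
  have -> : (fun x => local_tensor c x ^+ 0) = cst 1 by apply/funext => x; rewrite expr0.
  exact: Ck_on_cst.
have -> : (fun x => local_tensor c x ^+ i.+1) =
    (fun x => local_tensor c x *m local_tensor c x ^+ i) by apply/funext => x; rewrite exprS.
by apply: (Ck_on_mulmx oO); [exact: local_tensor_smooth | exact: IH].
Qed.

Lemma local_poly_mx_bracket c x0 (v w : 'rV[R]_n.+1 -> 'rV[R]_n.+1) :
  geodesically_equivalent g gbar -> atlas c -> (c @` cdom c) x0 ->
  differentiable v x0 -> differentiable w x0 ->
  (\forall x \near x0, local_poly_mx c x *m (v x)^T = 0) ->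
  (\forall x \near x0, local_poly_mx c x *m (w x)^T = 0) ->
  local_poly_mx c x0 *m (local_poly_mx c x0 *m ('D_(v x0) w x0 - 'D_(w x0) v x0)^T) = 0.
Proof.
move=> geq ac Ox0 dv dw; have oO := @cimg_open _ _ _ c.
have sG h := local_metric_smooth h ac.
have symG h x := @local_metric_sym _ _ M h c x ac.
have uG h x := @local_metric_unit _ _ M h c x ac.
have w0 x : (c @` cdom c) x -> (real_root n.+2 \o local_det_ratio c) x != 0.
  by move=> Ox; apply: real_root_neq0; exact: local_det_ratio_neq0.
have [s [mu [psi Hs]]] := structure_equation oO (sG g) (sG gbar) (symG g) (uG g)
  (symG gbar) (uG gbar) (fun x u => @projective_relation _ _ M g gbar c x u geq ac)
  (local_weight_smooth ac) w0 Ox0.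
rewrite local_poly_mxE => kv kw.
apply: (@poly_field_bracket _ _ x0 (local_tensor c) (local_metric g c x0)
  (connection (local_metric g c) x0) s mu psi _ _ _ _ Hs _ _ _ _ _ dv dw kv kw).
- exact: (Ck_on_differentiable_mx oO (local_tensor_smooth ac 1) Ox0).
- exact: symG.
- rewrite local_tensorE.
  exact: (@weighted_quotient_selfadjoint _ _ _ _ _ (symG g) (symG gbar) _ _ Ox0).
- by move=> a u; exact: (connection_sym oO (symG g) _ _ Ox0).
- by move=> k; exact: (Ck_on_differentiable oO (local_coef_smooth k ac 1%N) Ox0).
Qed.

(** The ratio of determinants is the same in both charts, as both change by
    the square of the Jacobian determinant; so the matrices of [L] are
    intertwined by the Jacobian matrix. *)
Lemma ker_poly_transport p c c' v : chart_at p c -> chart_at p c' ->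
  ker_poly chi (L_tensor g gbar) c p v <->
  ker_poly chi (L_tensor g gbar) c' p (v *m transition_jacobian c c' p).
Proof.
move=> pc pc'; rewrite /ker_poly /=; set J := transition_jacobian c c' p.
have Eg := gcoef_tensor g pc pc'; have Eb := gcoef_tensor gbar pc pc'.
rewrite -/J in Eg Eb.
have ug := gcoef_nondegenerate g pc; have ub := gcoef_nondegenerate gbar pc.
have ub' := gcoef_nondegenerate gbar pc'.
have uJ : J^T \in unitmx by move: ug; rewrite Eg !unitmx_mul => /andP[].
have dJ : \det J != 0 by rewrite -unitfE -unitmxE -unitmx_tr.
have Er : det_ratio g gbar c p = det_ratio g gbar c' p.
  rewrite /det_ratio Eg Eb !det_mulmx !det_tr ![\det J * _ * \det J]mulrAC -mulf_div divff ?mul1r //.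
  exact: mulf_neq0.
have T : J^T *m L_tensor g gbar c p = L_tensor g gbar c' p *m J^T.
  by rewrite /L_tensor Er; exact: quotient_transport.
rewrite trmx_mul mulmxA -(poly_mx_intertwine _ T) -mulmxA; split=> [->|E].
  by rewrite mulmx0.
by rewrite -[LHS](mulKmx uJ) E mulmx0.
Qed.

End OnePolynomial.
End KernelDistribution.

(** A vector of the row space of [Y] is determined by its projection by [P]. *)
Lemma row_space_projection0 (F : fieldType) m n (Y : 'M[F]_(m, n)) (P : 'M[F]_(n, m))
    (v w : 'rV[F]_n) : Y *m P = 1%:M -> (v - w <= Y)%MS -> v *m P = 0 -> w *m P = 0 -> w = v.
Proof.
move=> YP /submxP[a Ea] vP wP.
have : (v - w) *m P = 0 by rewrite mulmxBl vP wP subrr.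
rewrite Ea -mulmxA YP mulmx1 => a0.
by move: Ea; rewrite a0 mul0mx => /eqP; rewrite subr_eq0 => /eqP ->.
Qed.

Lemma jacobian_comp (R : realType) (a b c : nat) (f : 'rV[R]_a -> 'rV[R]_b)
    (h : 'rV[R]_b -> 'rV[R]_c) u : differentiable f u -> differentiable h (f u) ->
  jacobian (h \o f) u = jacobian f u *m jacobian h (f u).
Proof.
move=> df dh; apply/row_matrixP => i; rewrite !rowE mulmxA.
have E1 := deriveEjacobian (delta_mx 0 i) (differentiable_comp df dh).
have E2 := deriveEjacobian (delta_mx 0 i) df.
have E3 := deriveEjacobian ('D_(delta_mx 0 i) f u) dh.
rewrite -[LHS]E1 -E2 -E3 (deriveE _ (differentiable_comp df dh)) diff_comp //.
by rewrite (deriveE _ dh) (deriveE _ df).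
Qed.

Lemma transition_jacobian_unit (R : realType) (n : nat) (M : smooth_manifold R n)
    (g : metric M) (c c' : chart R n M) p : chart_at p c -> chart_at p c' ->
  transition_jacobian c c' p \in unitmx.
Proof.
move=> pc pc'; have := gcoef_nondegenerate g pc.
by rewrite (gcoef_tensor g pc pc') !unitmx_mul => /andP[/andP[]].
Qed.

Section Integrability.
Variables (R : realType) (n : nat) (M : smooth_manifold R n.+1) (g gbar : metric M).
Hypothesis geq : geodesically_equivalent g gbar.
Variables (m1 m2 : nat) (chi1 chi2 : M -> {poly R}).
Hypotheses (s1 : smooth_monic m1 chi1) (s2 : smooth_monic m2 chi2).
Hypothesis fac : forall p (c : chart R n.+1 M), chart_at p c ->
  char_poly (L_tensor g gbar c p) = chi1 p * chi2 p.
Hypothesis ncr : forall p, no_common_complex_root (chi1 p) (chi2 p).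
Implicit Type c : chart R n.+1 M.
Local Notation D := (ker_poly chi1 (L_tensor g gbar)).

(** The constant projection [P] normalizes the frame: a combination of its
    fields that is killed by [P] vanishes. *)
Definition adapted_frame c (V : set 'rV[R]_n.+1) (Y : 'rV[R]_n.+1 -> 'M[R]_(m1, n.+1))
    (P : 'M[R]_(n.+1, m1)) : Prop :=
  [/\ open V, V `<=` c @` cdom c, smooth_on V Y &
    forall x, V x -> Y x *m P = 1%:M /\ D c (cinv c x) = row_space (Y x)].

(** The image of [chi2(L)] is the kernel of [chi1(L)] and has dimension [m1].
    A choice [W] of [m1] independent combinations at [x0] remains independent
    nearby; [P] is a right inverse at [x0], and multiplying by the inverse of
    [X *m P] normalizes the frame around. *)
Lemma adapted_frame_exists c x0 : atlas c -> (c @` cdom c) x0 ->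
  exists V Y P, V x0 /\ adapted_frame c V Y P.
Proof.
move=> ac Ox0; have oO := @cimg_open _ _ _ c.
pose Q x := (local_poly_mx g gbar chi2 c x)^T.
have facx x : (c @` cdom c) x -> char_poly (local_tensor g gbar c x)
    = chi1 (cinv c x) * chi2 (cinv c x) by move=> Ox; apply: fac; exact: chart_at_inv.
have sz x : m1 = (size (chi1 (cinv c x))).-1 by rewrite (s1.1 _).2.
have rQ : \rank (Q x0) = m1.
  by rewrite mxrank_tr /local_poly_mx poly_mxE (rank_real_factor (@ncr _) (facx _ Ox0)) -sz.
have [W fW] := row_free_selection rQ.
have [P WP] := row_freeP fW.
pose X x := W *m Q x.
have sX : smooth_on (c @` cdom c) X.
  move=> k; apply: (Ck_on_mulmx oO); first exact: Ck_on_cst.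
  by apply: (Ck_on_trmx oO); exact: (local_poly_mx_smooth g gbar s2 ac).
have sXP k : Ck_on k (c @` cdom c) (fun x => X x *m P).
  by apply: (Ck_on_mulmx oO); [exact: sX | exact: Ck_on_cst].
have sdet k : Ck_on k (c @` cdom c) (fun x => \det (X x *m P)) by exact: Ck_on_det.
pose V := [set x | (c @` cdom c) x /\ \det (X x *m P) != 0].
have oV : open V.
  apply: open_by_ball => x [Ox dx].
  have N1 := open_near oO Ox.
  have N2 : \forall y \near x, \det (X y *m P) != 0.
    have Cx : {for x, continuous (fun x => \det (X x *m P))}.
      exact: (Ck_on_continuous (sdet 0%N) Ox).
    exact: (cvgr_neq0 (\det (X x *m P)) Cx dx).
  have [r r0 rP] := (near_ballP _ _).1 (near_and N1 N2).
  by exists r => // y /rP.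
have VO : V `<=` c @` cdom c by move=> x [].
have uXP x : V x -> X x *m P \in unitmx by move=> [_ dx]; rewrite unitmxE unitfE.
exists V, (fun x => invmx (X x *m P) *m X x), P; split.
  by split=> //; rewrite /X WP det1 oner_eq0.
split=> //.
  move=> k; apply: (Ck_on_mulmx oV); last exact: Ck_on_sub VO (sX k).
  by apply: (Ck_on_invmx oV) => //; exact: Ck_on_sub VO (sXP k).
move=> x Vx; have u := uXP x Vx; split; first by rewrite -mulmxA mulVmx.
have fX : row_free (X x) by apply/row_freeP; exists (P *m invmx (X x *m P)); rewrite mulmxA mulmxV.
rewrite [LHS](ker_row_space (@ncr _) (facx _ (VO _ Vx)) (sz x) fX).
apply/seteqP; split => v /= vX; apply: submx_trans vX _; last exact: submxMl.
have XY : X x = (X x *m P) *m (invmx (X x *m P) *m X x) by rewrite mulKVmx.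
by rewrite -/(Q x) -/(X x) [X in (X <= _)%MS]XY submxMl.
Qed.

Lemma derive_mulmx_const k m p (Z : 'rV[R]_n.+1 -> 'M[R]_(m, p)) (A : 'M[R]_(k, m)) x a :
  differentiable Z x -> 'D_a (fun y => A *m Z y) x = A *m 'D_a Z x.
Proof.
move=> dZ; have [_ ->] := is_derive_mulmx (is_derive_cst A x a) (is_derive_of_differentiable a dZ).
by rewrite mul0mx add0r.
Qed.

(** The bracket of the fields [xi *m Y] and [eta *m Y] lies in the
    distribution by [local_poly_mx_bracket], and [P] kills it because [Y *m
    P] is constant; so it vanishes. *)
Lemma adapted_frame_commutes c V Y P x (xi eta : 'rV[R]_m1) : atlas c -> adapted_frame c V Y P -> V x ->
  xi *m 'D_(eta *m Y x) Y x = eta *m 'D_(xi *m Y x) Y x.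
Proof.
move=> ac [oV VO sY HY] Vx.
have dY : differentiable Y x := Ck_on_differentiable_mx oV (sY 1) Vx.
pose fld (z : 'rV[R]_m1) := fun y => z *m Y y.
have dfld z : differentiable (fld z) x.
  apply: (Ck_on_differentiable_mx oV _ Vx (k := 0)); apply: (Ck_on_mulmx oV); first exact: Ck_on_cst.
  exact: sY.
have kfld z : \forall y \near x, local_poly_mx g gbar chi1 c y *m (fld z y)^T = 0.
  apply: filterS (open_near oV Vx) => y /HY[_ Ey].
  suff : D c (cinv c y) (fld z y) by [].
  by rewrite Ey; exact: submxMl.
have B := local_poly_mx_bracket s1 geq ac (VO _ Vx) (dfld xi) (dfld eta) (kfld xi) (kfld eta).
have Dfld z a : 'D_a (fld z) x = z *m 'D_a Y x by exact: derive_mulmx_const.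
rewrite !Dfld in B.
have at_c := chart_at_inv ac (VO _ Vx).
have {}B : D c (cinv c x) (eta *m 'D_(fld xi x) Y x - xi *m 'D_(fld eta x) Y x).
  exact: (poly_mx_ker_square (@ncr _) (fac at_c) B).
have DYP a : 'D_a Y x *m P = 0.
  have dP := is_derive_mulmx (is_derive_of_differentiable a dY) (is_derive_cst P x a).
  have N : \forall y \near x, Y y *m P = cst 1%:M y.
    by apply: filterS (open_near oV Vx) => y /HY[].
  have [_ E] := near_eq_is_derive N dP.
  by move: E; rewrite derive_cst mulmx0 addr0.
have ZP z a : z *m 'D_a Y x *m P = 0 by rewrite -mulmxA DYP mulmx0.
rewrite (HY _ Vx).2 in B.
have := ZP _ eta (fld xi x); have := ZP _ xi (fld eta x).
move: (eta *m _) (xi *m _) B => v w B wP vP.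
exact: (row_space_projection0 (HY _ Vx).1 B vP wP).
Qed.

Lemma chart_preimage_open c V : open V -> V `<=` c @` cdom c ->
  open [set q | cdom c q /\ V (c q)] /\ c @` [set q | cdom c q /\ V (c q)] = V.
Proof.
move=> oV VO; split.
  rewrite openE => q [cq Vq]; rewrite /interior.
  apply: filterI; first exact: (open_near (@cdom_open _ _ _ c) cq).
  exact: (cfun_continuous cq (open_near oV Vq)).
apply/seteqP; split => [_ [q [_ Vq] <-] //|x Vx].
have [q cq Eq] := VO _ Vx; exists q => //; split=> //; by rewrite Eq.
Qed.

Lemma kernel_is_distribution : is_distribution m1 D.
Proof.
split=> [p c c' pc pc' v|p c [ac cp]]; first exact: ker_poly_transport.
have [|V [Y [P [Vp [oV VO sY HY]]]]] := adapted_frame_exists ac (x0 := c p); first by exists p.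
have [oU EU] := chart_preimage_open oV VO.
exists [set q | cdom c q /\ V (c q)], Y; split=> //.
- by move=> q [].
- by rewrite EU.
move=> q [cq Vq]; have [YP Dq] := HY _ Vq; rewrite cfunK // in Dq; split=> //.
by apply/row_freeP; exists P.
Qed.

(** The integral manifold of an adapted frame in one chart is transported to
    the manifold by the inverse of the chart; in any other chart it is
    composed with a transition map, and both the Jacobian matrix and the
    distribution are multiplied by the Jacobian matrix of the transition. *)
Lemma kernel_integral_manifold p : exists (U : set 'rV[R]_m1) (F : 'rV[R]_m1 -> M),
  is_integral_manifold D U F /\ (F @` U) p.
Proof.
have [c ac cp] := atlas_cover p.
have Ocp : (c @` cdom c) (c p) by exists p.
have [V [Y [P [Vp fr]]]] := adapted_frame_exists ac Ocp.
have [oV VO sY HY] := fr.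
have [d [f [d0 f0 sf injf Hf]]] := commuting_frame_integral_smooth oV Vp sY
  (fun x Vx => (HY x Vx).1) (fun x Vx xi eta => adapted_frame_commutes xi eta ac fr Vx).
set U := [set x : 'rV[R]_m1 | `|x| < d] in sf injf Hf.
have oU : open U.
  have := @open_norm_ball R 'rV[R]_m1 0 d.
  by congr open; apply/funext => t /=; rewrite subr0.
have fV u : U u -> V (f u) by move=> /Hf[].
have cf u : U u -> {for u, continuous (cinv c \o f)}.
  move=> Uu; apply: continuous_comp.
    by apply: differentiable_continuous; have [] := Hf _ Uu.
  by apply: cinv_continuous; exact: VO (fV _ Uu).
exists U, (cinv c \o f); split; last first.
  by exists 0; [rewrite /U /= normr0 | rewrite /= f0 cfunK].
split=> //.
  move=> u u' Uu Uu' /= E; apply: injf => //.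
  have := congr1 c E.
  rewrite (chart_invK (VO _ (fV _ (set_mem Uu)))).1.
  by rewrite (chart_invK (VO _ (fV _ (set_mem Uu')))).1.
move=> c' ac'; set U' := U `&` _.
have oU' : open U'.
  rewrite openE => u [Uu c'u]; rewrite /interior; apply: filterI.
    exact: (open_near oU Uu).
  exact: (cf u Uu _ (open_near (@cdom_open _ _ _ c') c'u)).
have fov u : U' u -> overlap c c' (f u).
  by move=> [Uu c'u]; apply: overlap_intro => //; exact: VO (fV _ Uu).
have oW := @open_overlap _ _ M c c'.
have stau : smooth_on (overlap c c') (transition c c') by exact: atlas_compatible.
split.
  move=> k; apply: (Ck_on_comp_mx oU' oW fov _ (stau k)).
  by apply: Ck_on_sub (sf k); move=> u [].
move=> u Uu c'u; have Ou := fov u (conj Uu c'u).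
have [_ dfu Ju] := Hf _ Uu.
have EJ : jacobian (c' \o (cinv c \o f)) u = Y (f u) *m jacobian (transition c c') (f u).
  by rewrite -Ju; exact: jacobian_comp dfu (smooth_differentiable oW stau Ou).
have Of := VO _ (fV _ Uu); have pc := chart_at_inv ac Of.
have pc' : chart_at (cinv c (f u)) c' by [].
have uJ := transition_jacobian_unit g pc pc'.
have EJc : transition_jacobian c c' (cinv c (f u)) = jacobian (transition c c') (f u).
  by rewrite /transition_jacobian (chart_invK Of).1.
rewrite EJc in uJ; rewrite EJ; move: (jacobian (transition c c') (f u)) EJc uJ => J EJc uJ.
have [YP DY] := HY _ (fV _ Uu); split.
  by apply/row_freeP; exists (invmx J *m P); rewrite mulmxA mulmxK.
have tr w : D c (cinv c (f u)) w <-> D c' (cinv c (f u)) (w *m J).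
  by rewrite -EJc; exact: ker_poly_transport.
rewrite DY in tr.
apply/seteqP; split => v.
  by rewrite -{1 2}(mulmxKV uJ v) => /tr vY; exact: submxMr.
by move=> /submxP[a ->]; rewrite mulmxA; apply/tr; exact: submxMl.
Qed.

End Integrability.

Theorem theorem1 (R : realType) (n : nat) (M : smooth_manifold R n)
    (g gbar : metric M) (chi1 chi2 : M -> {poly R}) :
  geodesically_equivalent g gbar ->
  L_well_defined g gbar ->
  admissible_factorisation (L_tensor g gbar) chi1 chi2 ->
  integrable_distribution (ker_poly chi1 (L_tensor g gbar)) /\
  integrable_distribution (ker_poly chi2 (L_tensor g gbar)).
Proof.
case: n => [|n] in M g gbar chi1 chi2 *.
  (* A point would carry a factor of positive degree of a polynomial of degree 0. *)
  move=> _ _ [[m1 m1_gt0 s1] [m2 _ s2] fac _].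
  have noM (p : M) : False.
    have [c ac cp] := atlas_cover p.
    have := congr1 (size \o val) (fac p c (conj ac cp)); rewrite /= size_char_poly.
    rewrite size_monicM ?monic_neq0 ?(s1.1 p).1 ?(s2.1 p).1 // (s1.1 p).2 (s2.1 p).2.
    by case: m1 m1_gt0 {s1} => // m1; rewrite addnS.
  have empty (E : vector_set_field M) : integrable_distribution E.
    by exists 0%N; split=> [|p]; [split=> p|]; case: (noM p).
  by split; exact: empty.
move=> geq _ [[m1 _ s1] [m2 _ s2] fac ncr].
have fac' p c : chart_at p c -> char_poly (L_tensor g gbar c p) = chi2 p * chi1 p.
  by move=> /fac ->; rewrite mulrC.
have ncr' p : no_common_complex_root (chi2 p) (chi1 p).
  by move=> z [z2 z1]; apply: (ncr p z).
split; [exists m1 | exists m2]; split.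
- exact: kernel_is_distribution s1 s2 fac ncr.
- by move=> p; exact: (kernel_integral_manifold geq s1 s2 fac ncr p).
- exact: kernel_is_distribution s2 s1 fac' ncr'.
- by move=> p; exact: (kernel_integral_manifold geq s2 s1 fac' ncr' p).
Qed.
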